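(* Let $\tau=(\mathfrak g,\mathfrak s,\mathfrak c)$ be a pseudoreductive triple over $\boldsymbol k$. Then $U_\tau$ is a pseudoreductive Hopf algebra.
   Context: $\boldsymbol k$ is a field of characteristic zero. A (unital) bialgebra is a vector space $U$ with a bilinear, not necessarily associative product with unit $1$, and a coassociative cocommutative comultiplication $\Delta(u)=u_{(1)}\otimes u_{(2)}$ (Sweedler notation, summation understood) with counit $\epsilon$, such that $\Delta,\epsilon$ are homomorphisms of unital algebras. A non-associative Hopf algebra is a unital bialgebra with bilinear maps $\backslash,/$ satisfying $u_{(1)}\backslash(u_{(2)}v)=\epsilon(u)v=u_{(1)}(u_{(2)}\backslash v)$ and $(uv_{(1)})/v_{(2)}=\epsilon(v)u=(u/v_{(1)})v_{(2)}$. Unital bialgebras whose coalgebra is isomorphic to a symmetric algebra $\boldsymbol k[V]$ with its usual coalgebra structure, the unit corresponding to $1$ (connected bialgebras), are automatically non-associative Hopf algebras. A non-associative Hopf algebra $U$ is pseudoreductive if: (right pseudospeciality) there is a coalgebra morphism $\bullet\colon U\otimes U\to U$ with $1\bullet u=\epsilon(u)1=u\bullet1$ and $P(u,v)(xy)=r(u_{(1)},v_{(1)})(x)\,P(u_{(2)},v_{(2)})(y)$ for all $u,v,x,y$, where $r(u,v)(x):=((xu_{(1)})v_{(1)})/(u_{(2)}v_{(2)})$ and $P(u,v)(x):=r(u_{(1)},v_{(1)})(x)\,(u_{(2)}\bullet v_{(2)})$; and (right monoalternativity) $(((xy_{(1)})y_{(2)})\cdots)y_{(n)}=x((y_{(1)}y_{(2)})\cdots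 y_{(n)})$ for all $x,y$ and $n\ge0$ (left-normed products). A triple $(\mathfrak g,\mathfrak s,\mathfrak c)$ consists of a Lie algebra $\mathfrak g$, a subalgebra $\mathfrak s$ and a subspace $\mathfrak c$ with $\mathfrak g=\mathfrak s\oplus\mathfrak c$. It is pseudoreductive if there exists a map $\zeta\colon\mathfrak s\to\mathfrak c$ such that (PRT1) $d+\zeta(d)\in N_{\mathfrak g}(\mathfrak c):=\{x\in\mathfrak g\mid[x,\mathfrak c]\subseteq\mathfrak c\}$ for all $d\in\mathfrak s$, and (PRT2) $\mathrm{ad}_c^{2n}(\zeta(\mathfrak s))\subseteq\mathfrak c$ for all $n\ge0$ and $c\in\mathfrak c$. Construction of $U_\tau$: as a coalgebra, $U_\tau=U(\mathfrak g)/U(\mathfrak g)\mathfrak s$ (isomorphic to $\boldsymbol k[\mathfrak c]$), where $U(\mathfrak g)$ is the universal enveloping algebra; $\bar u$ denotes the class of $u$. By Poincaré–Birkhoff–Witt the classes $\sum_{\sigma\in S_n}\overline{c_{\sigma(1)}\cdots c_{\sigma(n)}}$ with $c_i\in\mathfrak c$, $n\ge0$, span $U_\tau$, and they form a basis when multisets of elements of a fixed basis of $\mathfrak c$ are used. The product on $U_\tau$ is defined by $\bar u\big(\sum_{\sigma\in S_n}\overline{c_{\sigma(1)}\cdots c_{\sigma(n)}}\big):=\sum_{\sigma\in S_n}\overline{c_{\sigma(n)}\cdots c_{\sigma(1)}u}$, with unit $\bar1$. With this product $U_\tau$ is a connected right monoalternative unital bialgebra, hence a non-associative Hopf algebra.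 *)

(* Defs.v *)
From HB Require Import structures.
From mathcomp Require Import all_boot all_order perm all_algebra.
From mathcomp Require Import freeg.
From mathcomp Require Import boolp.

Set Implicit Arguments.
Unset Strict Implicit.
Unset Printing Implicit Defensive.

Import GRing.Theory.
Local Open Scope ring_scope.
Local Open Scope quotient_scope.

Definition bilinear_map (k : fieldType) (U V W : lmodType k) (B : U -> V -> W) :=
  (forall v, linear (B ^~ v)) /\ (forall u, linear (B u)).

Section LinearFacts.
Variables (k : fieldType).

Lemma linear0f (U V : lmodType k) (f : U -> V) : linear f -> f 0 = 0.
Proof. by move=> h; move: (h (-1) 0 0); rewrite !scaler0 addr0 scaleN1r addNr. Qed.
Lemma linearDf (U V : lmodType k) (f : U -> V) : linear f -> {morph f : x y / x + y}.
Proof. by move=> h x y; move: (h 1 x y); rewrite !scale1r. Qed.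
Lemma linearZf (U V : lmodType k) (f : U -> V) a : linear f -> {morph f : x / a *: x}.
Proof. by move=> h x; move: (h a x 0); rewrite (linear0f h) !addr0. Qed.
Lemma linearBf (U V : lmodType k) (f : U -> V) : linear f -> {morph f : x y / x - y}.
Proof. by move=> h x y; rewrite -scaleN1r addrC h scaleN1r addrC. Qed.
Lemma linear_sumf (U V : lmodType k) (f : U -> V) I (r : seq I) P F : linear f ->
  f (\sum_(i <- r | P i) F i) = \sum_(i <- r | P i) f (F i).
Proof.
by move=> h; apply: (big_morph f (linearDf h) (linear0f h)).
Qed.
Lemma linear_comp (U V W : lmodType k) (f : V -> W) (g : U -> V) :
  linear f -> linear g -> linear (fun x => f (g x)).
Proof. by move=> hf hg a x y; rewrite hg hf. Qed.
Lemma linear_addf (U V : lmodType k) (f g : U -> V) :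
  linear f -> linear g -> linear (fun x => f x + g x).
Proof. by move=> hf hg a x y; rewrite hf hg scalerDr addrACA. Qed.

Lemma fglift_linear (K : choiceType) (M : lmodType k) (f : K -> M) :
  linear (fglift f).
Proof.
have fB : {morph fglift f : x y / x - y} by exact: lift_is_additive.
have f0 : fglift f 0 = 0 by rewrite -(subrr 0) fB subrr.
have fN x : fglift f (- x) = - fglift f x by rewrite -sub0r fB f0 sub0r.
have fD x y : fglift f (x + y) = fglift f x + fglift f y.
  by rewrite -{1}[y]opprK fB fN opprK.
move=> a x y; rewrite fD; congr (_ + _).
have fS I (r : seq I) F : fglift f (\sum_(i <- r) F i) = \sum_(i <- r) fglift f (F i).
  exact: (big_morph (fglift f) fD f0).
rewrite -[x]freeg_sumE scaler_sumr !fS scaler_sumr; apply: eq_bigr => i _.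
have -> : a *: (<< coeff i x *g i >> : {freeg K / k}) = << a * coeff i x *g i >>.
  by apply/eqP/freeg_eqP => z; rewrite coeffZ !coeffU mulrA.
by rewrite !liftU scalerA.
Qed.

Lemma fgliftE (K : choiceType) (M : lmodType k) (f : K -> M) x :
  fglift f << x >> = f x.
Proof. by rewrite liftU scale1r. Qed.

Lemma freeg_linear_eq (K : choiceType) (M : lmodType k) (f g : {freeg K / k} -> M) :
  linear f -> linear g -> (forall x, f << x >> = g << x >>) -> f =1 g.
Proof.
move=> hf hg h x; rewrite -[x]freeg_sumE !linear_sumf //; apply: eq_bigr => i _.
have -> : (<< coeff i x *g i >> : {freeg K / k}) = coeff i x *: << i >>.
  by apply/eqP/freeg_eqP => z; rewrite coeffZ !coeffU mul1r.
by rewrite !linearZf ?h.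
Qed.

End LinearFacts.

Section QuotientModule.
Variables (k : fieldType) (V : lmodType k) (G : V -> Prop).

Definition span_pred : {pred V} :=
  fun v => `[< forall S : {pred V},
                 submod_closed S -> (forall x, G x -> x \in S) -> v \in S >].

Lemma span_predP v : reflect
  (forall S : {pred V}, submod_closed S -> (forall x, G x -> x \in S) -> v \in S)
  (v \in span_pred).
Proof. exact: asboolP. Qed.

Lemma span_submod_closed : submod_closed span_pred.
Proof.
split=> [|a u v /span_predP uP /span_predP vP].
  by apply/span_predP => S [].
by apply/span_predP => S SP SG; apply: SP.2; [apply: uP | apply: vP].
Qed.

Lemma mem_span x : G x -> x \in span_pred.
Proof. by move=> Gx; apply/span_predP => S _; apply. Qed.

HB.instance Definition _ :=
  GRing.isSubmodClosed.Build k V span_pred span_submod_closed.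

(* V modulo the linear span of G, where G need not be a subspace *)
Definition quot_span := Quotient.quot (span_pred : zmodClosed V).
HB.instance Definition _ := GRing.Zmodule.on quot_span.
HB.instance Definition _ := Quotient.on quot_span.

Definition cls (v : V) : quot_span := \pi_quot_span v.

Lemma clsK q : cls (repr q) = q.
Proof. exact: reprK. Qed.
Lemma cls_eq x y : (cls x == cls y) = (x - y \in span_pred).
Proof. by rewrite [RHS]Quotient.idealrBE. Qed.
Lemma clsP x y : cls x = cls y <-> x - y \in span_pred.
Proof. by rewrite -cls_eq; split=> /eqP. Qed.
Lemma clsD x y : cls (x + y) = cls x + cls y.
Proof. exact: pi_addr. Qed.

Definition quot_scale (a : k) (q : quot_span) : quot_span := cls (a *: repr q).

Lemma clsZ a x : cls (a *: x) = quot_scale a (cls x).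
Proof.
apply/clsP; rewrite -scalerBr; have [S0 SP] := span_submod_closed.
rewrite -[X in X \in _]addr0; apply: SP => //; apply/clsP; by rewrite clsK.
Qed.
Fact quot_scaleA a b q : quot_scale a (quot_scale b q) = quot_scale (a * b) q.
Proof. by rewrite -[q]clsK -!clsZ scalerA. Qed.
Fact quot_scale1 : left_id 1 quot_scale.
Proof. by move=> q; rewrite -[q]clsK -!clsZ scale1r. Qed.
Fact quot_scaleDr : right_distributive quot_scale +%R.
Proof. by move=> a q r; rewrite -[q]clsK -[r]clsK -!clsZ -!clsD -clsZ scalerDr. Qed.
Fact quot_scaleDl q : {morph quot_scale^~ q : a b / a + b}.
Proof. by move=> a b; rewrite -[q]clsK -!clsZ -!clsD scalerDl. Qed.
HB.instance Definition _ := GRing.Zmodule_isLmodule.Build k quot_span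
  quot_scaleA quot_scale1 quot_scaleDr quot_scaleDl.

Lemma cls_linear : linear cls.
Proof. by move=> a x y; rewrite clsD clsZ. Qed.

Lemma cls0 x : G x -> cls x = 0.
Proof.
move=> Gx; rewrite -(linear0f cls_linear); apply/clsP; rewrite subr0.
exact: mem_span.
Qed.

Lemma quot_lift (W : lmodType k) (f : V -> W) :
  linear f -> (forall x, G x -> f x = 0) -> forall x, f (repr (cls x)) = f x.
Proof.
move=> fl fG x; apply/eqP; rewrite -subr_eq0 -linearBf //.
have /span_predP/(_ [pred v | f v == 0]) : repr (cls x) - x \in span_pred.
  by apply/clsP; rewrite clsK.
apply; last by move=> y /fG fy; rewrite inE fy.
split=> [|a u v]; first by rewrite inE linear0f.
by rewrite !inE fl => /eqP -> /eqP ->; rewrite scaler0 addr0.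
Qed.

Lemma quot_lift_linear (W : lmodType k) (f : V -> W) :
  linear f -> (forall x, G x -> f x = 0) -> linear (fun q : quot_span => f (repr q)).
Proof.
move=> fl fG a q r; rewrite -[q]clsK -[r]clsK -cls_linear.
by rewrite !(quot_lift fl fG) fl.
Qed.

End QuotientModule.

Section Tensor.
Variables (k : fieldType) (U V : lmodType k).

Inductive tensor_rel : {freeg (U * V)%type / k} -> Prop :=
| TensorL a u u' v :
    tensor_rel (<< (a *: u + u', v) >> - (a *: << (u, v) >> + << (u', v) >>))
| TensorR a u v v' :
    tensor_rel (<< (u, a *: v + v') >> - (a *: << (u, v) >> + << (u, v') >>)).

Definition tensor := quot_span tensor_rel.
HB.instance Definition _ := GRing.Lmodule.on tensor.

Definition tens (u : U) (v : V) : tensor := cls tensor_rel << (u, v) >>.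

(* the linear map on the tensor product induced by B; only meaningful when
   B is bilinear, see tens_liftE *)
Definition tens_lift (W : lmodType k) (B : U -> V -> W) (t : tensor) : W :=
  fglift (fun p => B p.1 p.2) (repr t).

End Tensor.

Notation "u ⊗ v" := (tens u v) (at level 40, left associativity) : ring_scope.

(* Sweedler sums: \Sw_(a, b <- t) B a b = \sum_i B a_i b_i for t = \sum_i a_i ⊗ b_i *)
Notation "\Sw_ ( a , b <- t ) E" := (tens_lift (fun a b => E) t)
  (at level 36, E at level 36, a name, b name, t at level 50,
   format "'[' \Sw_ ( a ,  b  <-  t ) '/  '  E ']'") : ring_scope.

Section TensorTheory.
Variables (k : fieldType) (U V : lmodType k).

Lemma tens_bilinear : bilinear_map (@tens k U V).
Proof.
have l := cls_linear (@tensor_rel k U V).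
by split=> [v a u u'|u a v v']; rewrite /tens -l; apply/clsP/mem_span; constructor.
Qed.

Section Lift.
Variables (W : lmodType k) (B : U -> V -> W).
Hypothesis Bbil : bilinear_map B.

Let lift_rel x : tensor_rel x -> fglift (fun p => B p.1 p.2) x = 0.
Proof.
have l := fglift_linear (fun p : U * V => B p.1 p.2).
by case=> *; rewrite linearBf // l !fgliftE /= (Bbil.1, Bbil.2) subrr.
Qed.

Lemma tens_lift_linear : linear (tens_lift B).
Proof. exact/quot_lift_linear/lift_rel/fglift_linear. Qed.

Lemma tens_liftE u v : tens_lift B (u ⊗ v) = B u v.
Proof. by rewrite /tens_lift (quot_lift (fglift_linear _) lift_rel) fgliftE. Qed.
End Lift.

Lemma tens_linear_eq (W : lmodType k) (f g : tensor U V -> W) :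
  linear f -> linear g -> (forall u v, f (u ⊗ v) = g (u ⊗ v)) -> f =1 g.
Proof.
move=> hf hg h q; rewrite -[q]clsK.
have l := cls_linear (@tensor_rel k U V).
by apply: (freeg_linear_eq (linear_comp hf l) (linear_comp hg l)) => -[u v]; apply: h.
Qed.

End TensorTheory.

Section TensorOps.
Variable (k : fieldType).

Definition tens_map (U V U' V' : lmodType k) (f : U -> U') (g : V -> V')
  (t : tensor U V) : tensor U' V' := \Sw_(a, b <- t) (f a ⊗ g b).

Definition tens_mul (A : lmodType k) (mul : A -> A -> A)
  (s t : tensor A A) : tensor A A :=
  \Sw_(a, b <- s) \Sw_(c, d <- t) (mul a c ⊗ mul b d).

Lemma tens_map_bilinear (U V U' V' : lmodType k) (f : U -> U') (g : V -> V') :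
  linear f -> linear g -> bilinear_map (fun a b => f a ⊗ g b).
Proof.
move=> hf hg; split=> [v|u].
  exact: linear_comp (fun y => (tens_bilinear _ _).1 _ y) hf.
exact: linear_comp ((tens_bilinear _ _).2 _) hg.
Qed.

Lemma tens_map_linear (U V U' V' : lmodType k) (f : U -> U') (g : V -> V') :
  linear f -> linear g -> linear (tens_map f g).
Proof. by move=> hf hg; apply/tens_lift_linear/tens_map_bilinear. Qed.

Lemma tens_mapE (U V U' V' : lmodType k) (f : U -> U') (g : V -> V') u v :
  linear f -> linear g -> tens_map f g (u ⊗ v) = f u ⊗ g v.
Proof. by move=> hf hg; rewrite [LHS]tens_liftE //; apply: tens_map_bilinear. Qed.

Section TensMul.
Variables (A : lmodType k) (mul : A -> A -> A).
Hypothesis mulP : bilinear_map mul.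

Let mulr_bil a b : bilinear_map (fun c d => mul a c ⊗ mul b d).
Proof. exact: tens_map_bilinear (mulP.2 _) (mulP.2 _). Qed.

Let mull_bil t : bilinear_map (fun a b => \Sw_(c, d <- t) (mul a c ⊗ mul b d)).
Proof.
split=> [b z a a'|a z b b'].
  apply: (tens_linear_eq (f := tens_lift _) (g := fun t => z *: tens_lift _ t + tens_lift _ t)) t => //.
  - exact: tens_lift_linear.
  - apply: linear_addf; last exact: tens_lift_linear.
    by apply: linear_comp (tens_lift_linear (mulr_bil _ _)) => z' x y; rewrite scalerDr !scalerA mulrC.
  - by move=> u v; rewrite !tens_liftE // mulP.1 (tens_bilinear _ _).1.
apply: (tens_linear_eq (f := tens_lift _) (g := fun t => z *: tens_lift _ t + tens_lift _ t)) t => //.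
- exact: tens_lift_linear.
- apply: linear_addf; last exact: tens_lift_linear.
  by apply: linear_comp (tens_lift_linear (mulr_bil _ _)) => z' x y; rewrite scalerDr !scalerA mulrC.
- by move=> u v; rewrite !tens_liftE // mulP.1 (tens_bilinear _ _).2.
Qed.

Lemma tens_mulE a b c d : tens_mul mul (a ⊗ b) (c ⊗ d) = mul a c ⊗ mul b d.
Proof. by rewrite /tens_mul !tens_liftE. Qed.

Lemma tens_mul_bilinear : bilinear_map (tens_mul mul).
Proof.
split=> [t|s]; first exact: tens_lift_linear.
move=> z t t'.
apply: (tens_linear_eq (f := fun s => tens_mul mul s (z *: t + t'))
   (g := fun s => z *: tens_mul mul s t + tens_mul mul s t')) s.
- exact: tens_lift_linear.
- apply: linear_addf; last exact: tens_lift_linear.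
  by apply: linear_comp (tens_lift_linear (mull_bil _)) => z' x y; rewrite scalerDr !scalerA mulrC.
- by move=> u v; rewrite /tens_mul !tens_liftE // (tens_lift_linear (mulr_bil _ _)).
Qed.
End TensMul.

End TensorOps.

HB.mixin Record Lmodule_isLieAlgebra (k : fieldType) g of GRing.Lmodule k g := {
  lie : g -> g -> g;
  lie_bilinear : bilinear_map lie;
  liexx : forall x, lie x x = 0;
  jacobi : forall x y z, lie x (lie y z) + lie y (lie z x) + lie z (lie x y) = 0
}.
#[short(type="lieAlgType")]
HB.structure Definition LieAlgebra (k : fieldType) :=
  {g of GRing.Lmodule k g & Lmodule_isLieAlgebra k g}.

Section EnvelopingAlgebra.
Variables (k : fieldType) (g : lieAlgType k).
Implicit Types (w : seq g) (x y : g).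

(* U(g) is spanned by the words in the elements of g (a word standing for the
   product of its letters), modulo linearity in each letter and xy - yx = [x, y] *)
Inductive env_rel : {freeg (seq g) / k} -> Prop :=
| EnvLinear a x y w1 w2 :
    env_rel (<< w1 ++ (a *: x + y) :: w2 >>
             - (a *: << w1 ++ x :: w2 >> + << w1 ++ y :: w2 >>))
| EnvBracket x y w1 w2 :
    env_rel (<< w1 ++ [:: x, y & w2] >>
             - (<< w1 ++ [:: y, x & w2] >> + << w1 ++ lie x y :: w2 >>)).

Definition env := quot_span env_rel.
HB.instance Definition _ := GRing.Lmodule.on env.

Definition env_word w : env := cls env_rel << w >>.
Definition env_gen x : env := env_word [:: x].

Lemma env_linear_eq (W : lmodType k) (f h : env -> W) :
  linear f -> linear h -> (forall w, f (env_word w) = h (env_word w)) -> f =1 h.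
Proof.
move=> hf hh e q; rewrite -[q]clsK.
have l := cls_linear env_rel.
by apply: (freeg_linear_eq (linear_comp hf l) (linear_comp hh l)) => w; apply: e.
Qed.

Lemma env_word_linear w1 w2 : linear (fun x => env_word (w1 ++ x :: w2)).
Proof.
move=> a x y; have l := cls_linear env_rel.
by rewrite /env_word -l; apply/clsP/mem_span; constructor.
Qed.

Lemma env_word_bracket x y w1 w2 :
  env_word (w1 ++ [:: x, y & w2]) =
  env_word (w1 ++ [:: y, x & w2]) + env_word (w1 ++ lie x y :: w2).
Proof.
rewrite /env_word -(linearDf (cls_linear env_rel)).
by apply/clsP/mem_span; constructor.
Qed.

(* the linear map on U(g) induced by a map on words *)
Definition env_lift (W : lmodType k) (f : seq g -> W) (u : env) : W :=
  fglift f (repr u).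

Section Lift.
Variables (W : lmodType k) (f : seq g -> W).
Hypothesis f_lin : forall w1 w2, linear (fun x => f (w1 ++ x :: w2)).
Hypothesis f_bracket : forall x y w1 w2,
  f (w1 ++ [:: x, y & w2]) = f (w1 ++ [:: y, x & w2]) + f (w1 ++ lie x y :: w2).

Let lift_rel (z : {freeg (seq g) / k}) : env_rel z -> fglift f z = 0.
Proof.
have l := fglift_linear f; case=> [a|] x1 y w1 w2; rewrite linearBf //.
  by rewrite l !fgliftE f_lin subrr.
by rewrite linearDf // !fgliftE f_bracket subrr.
Qed.

Lemma env_lift_linear : linear (env_lift f).
Proof. exact/quot_lift_linear/lift_rel/fglift_linear. Qed.

Lemma env_liftE w : env_lift f (env_word w) = f w.
Proof. by rewrite /env_lift (quot_lift (fglift_linear _) lift_rel) fgliftE. Qed.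
End Lift.

Definition env_mul (u v : env) : env :=
  env_lift (fun w => env_lift (fun w' => env_word (w ++ w')) v) u.

Fact env_mulr_linear w : linear (env_lift (fun w' => env_word (w ++ w'))).
Proof.
apply: env_lift_linear => [w1 w2 a x y|x y w1 w2].
  by rewrite !catA env_word_linear.
by rewrite !catA env_word_bracket.
Qed.

Fact env_mulrE w w' : env_lift (fun w' => env_word (w ++ w')) (env_word w') = env_word (w ++ w').
Proof.
apply: env_liftE => [w1 w2 a x y|x y w1 w2].
  by rewrite !catA env_word_linear.
by rewrite !catA env_word_bracket.
Qed.

Fact env_mull_lin v w1 w2 :
  linear (fun x => env_lift (fun w' => env_word ((w1 ++ x :: w2) ++ w')) v).
Proof.
move=> a x y; apply: (env_linear_eq
  (h := fun v => a *: env_lift (fun w' => env_word ((w1 ++ x :: w2) ++ w')) v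
                 + env_lift (fun w' => env_word ((w1 ++ y :: w2) ++ w')) v)) v.
- exact: env_mulr_linear.
- apply: linear_addf; last exact: env_mulr_linear.
  by apply: linear_comp (env_mulr_linear _) => z' p q; rewrite scalerDr !scalerA mulrC.
- by move=> w; rewrite !env_mulrE -!catA env_word_linear.
Qed.

Fact env_mull_br v x y w1 w2 :
  env_lift (fun w' => env_word ((w1 ++ [:: x, y & w2]) ++ w')) v =
  env_lift (fun w' => env_word ((w1 ++ [:: y, x & w2]) ++ w')) v +
  env_lift (fun w' => env_word ((w1 ++ lie x y :: w2) ++ w')) v.
Proof.
apply: (env_linear_eq
  (h := fun v => env_lift (fun w' => env_word ((w1 ++ [:: y, x & w2]) ++ w')) v
           + env_lift (fun w' => env_word ((w1 ++ lie x y :: w2) ++ w')) v)) v.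
- exact: env_mulr_linear.
- by apply: linear_addf; apply: env_mulr_linear.
- by move=> w; rewrite !env_mulrE -!catA env_word_bracket.
Qed.

Fact env_mul_wordl w v :
  env_mul (env_word w) v = env_lift (fun w' => env_word (w ++ w')) v.
Proof. exact: env_liftE (env_mull_lin v) (env_mull_br v) w. Qed.

Fact env_mull_linear v : linear (env_mul^~ v).
Proof. exact: env_lift_linear (env_mull_lin v) (env_mull_br v). Qed.

Lemma env_mulE w w' : env_mul (env_word w) (env_word w') = env_word (w ++ w').
Proof. by rewrite env_mul_wordl env_mulrE. Qed.

Lemma env_mul_bilinear : bilinear_map env_mul.
Proof.
split=> [v|u]; first exact: env_mull_linear.
move=> a v v'; apply: (env_linear_eq (f := fun u => env_mul u (a *: v + v'))
  (h := fun u => a *: env_mul u v + env_mul u v')) u.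
- exact: env_mull_linear.
- apply: linear_addf; last exact: env_mull_linear.
  apply: linear_comp (env_mull_linear v) => z' p q.
  by rewrite scalerDr !scalerA mulrC.
- by move=> w; rewrite !env_mul_wordl env_mulr_linear.
Qed.

(* the extension to U(g) of a map f from g to a unital associative algebra
   with product mul and unit one *)
Definition env_ext (A : lmodType k) (mul : A -> A -> A) (one : A) (f : g -> A) :
  env -> A := env_lift (foldr (fun x => mul (f x)) one).

Section Ext.
Variables (A : lmodType k) (mul : A -> A -> A) (one : A) (f : g -> A).
Hypotheses (mulP : bilinear_map mul) (mulA : associative mul).
Hypotheses (mul1 : left_id one mul) (mul_1 : right_id one mul).
Hypothesis f_lin : linear f.
Hypothesis f_bracket : forall x y, f (lie x y) = mul (f x) (f y) - mul (f y) (f x).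

Let F := foldr (fun x => mul (f x)) one.
Let F_cat w w' : F (w ++ w') = mul (F w) (F w').
Proof. by elim: w => [|x w IH] /=; rewrite ?mul1 // IH mulA. Qed.
Let F_lin w1 w2 : linear (fun x => F (w1 ++ x :: w2)).
Proof.
move=> a x y; rewrite !F_cat /= f_lin -mulP.2; congr (mul _ _).
by rewrite mulP.1.
Qed.
Let F_br x y w1 w2 :
  F (w1 ++ [:: x, y & w2]) = F (w1 ++ [:: y, x & w2]) + F (w1 ++ lie x y :: w2).
Proof.
rewrite !F_cat /= f_bracket -(linearDf (mulP.2 _)); congr (mul _ _).
by rewrite (linearBf (mulP.1 _)) !mulA addrC subrK.
Qed.

Lemma env_ext_linear : linear (env_ext mul one f).
Proof. exact: env_lift_linear. Qed.
Lemma env_extE x : env_ext mul one f (env_gen x) = f x.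
Proof. by rewrite /env_ext env_liftE //= mul_1. Qed.
Lemma env_ext1 : env_ext mul one f (env_word [::]) = one.
Proof. by rewrite /env_ext env_liftE. Qed.
Lemma env_extM u v :
  env_ext mul one f (env_mul u v) = mul (env_ext mul one f u) (env_ext mul one f v).
Proof.
have l := env_ext_linear.
apply: (env_linear_eq (f := fun u => env_ext mul one f (env_mul u v))
  (h := fun u => mul (env_ext mul one f u) (env_ext mul one f v))) u.
- exact: linear_comp (env_mul_bilinear.1 _).
- exact: linear_comp (mulP.1 _) l.
move=> w; apply: (env_linear_eq (f := fun v => env_ext mul one f (env_mul _ v))
  (h := fun v => mul (env_ext mul one f _) (env_ext mul one f v))) v.
- exact: linear_comp (env_mul_bilinear.2 _).
- exact: linear_comp (mulP.2 _) l.
by move=> w'; rewrite env_mulE /env_ext !env_liftE // -/F F_cat.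
Qed.
End Ext.

Definition env_counit : env -> k := @env_ext k^o *%R 1 (fun=> 0).

Fact env_counitP : [/\ bilinear_map (W := k^o) ( *%R : k^o -> k^o -> k^o),
  linear (fun _ : g => 0 : k^o) & forall x y : g, 0 = 0 * 0 - 0 * 0 :> k^o].
Proof.
split; last by move=> *; rewrite mulr0 subrr.
- split=> [v a x y|u a x y]; first by rewrite mulrDl -scalerAl.
  by rewrite mulrDr scalerAr.
- by move=> a x y; rewrite scaler0 addr0.
Qed.

Fact env_mulA : associative env_mul.
Proof.
move=> u v t; have [bl br] := env_mul_bilinear.
move: u; apply: env_linear_eq.
- exact: bl.
- exact: linear_comp (bl _) (bl _).
move=> w; move: v; apply: env_linear_eq.
- exact: linear_comp (br _) (bl _).
- exact: linear_comp (bl _) (br _).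
move=> w'; move: t; apply: env_linear_eq.
- exact: linear_comp (br _) (br _).
- exact: br.
by move=> w''; rewrite !env_mulE catA.
Qed.
Fact env_mul1 : left_id (env_word [::]) env_mul.
Proof.
by apply: env_linear_eq => [|//|w]; [exact: env_mul_bilinear.2 | rewrite env_mulE].
Qed.
Fact env_mul_1 : right_id (env_word [::]) env_mul.
Proof.
by apply: env_linear_eq => [|//|w]; [exact: env_mul_bilinear.1 | rewrite env_mulE cats0].
Qed.
Fact env_mulDl : left_distributive env_mul +%R.
Proof. by move=> u v t; exact: linearDf (env_mul_bilinear.1 t) u v. Qed.
Fact env_mulDr : right_distributive env_mul +%R.
Proof. by move=> u v t; exact: linearDf (env_mul_bilinear.2 u) v t. Qed.
Fact env_1neq0 : env_word [::] != 0.
Proof.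
have [b l br] := env_counitP.
have e1 : env_counit (env_word [::]) = 1.
  by apply: env_ext1 b _ _ _ _ => //; [exact: mulrA | exact: mul1r].
apply/eqP => e; move: e1; rewrite e (linear0f (V := k^o) (f := env_counit)).
  by move/eqP; rewrite eq_sym oner_eq0.
by apply: env_ext_linear => //; [exact: mulrA | exact: mul1r].
Qed.

HB.instance Definition _ := GRing.Zmodule_isNzRing.Build env
  env_mulA env_mul1 env_mul_1 env_mulDl env_mulDr env_1neq0.
Fact env_scaleAl (a : k) (u v : env) : a *: (u * v) = a *: u * v.
Proof. by rewrite [RHS](linearZf a (env_mul_bilinear.1 v)). Qed.
HB.instance Definition _ := GRing.Lmodule_isLalgebra.Build k env env_scaleAl.
Fact env_scaleAr (a : k) (u v : env) : a *: (u * v) = u * (a *: v).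
Proof. by rewrite [RHS](linearZf a (env_mul_bilinear.2 u)). Qed.
HB.instance Definition _ := GRing.Lalgebra_isAlgebra.Build k env env_scaleAr.

End EnvelopingAlgebra.

Section EnvelopingCoalgebra.
Variables (k : fieldType) (g : lieAlgType k).
Local Notation Ug := (env g).

Definition env_prim (x : g) : tensor Ug Ug := env_gen x ⊗ 1 + 1 ⊗ env_gen x.

Definition env_comul : Ug -> tensor Ug Ug :=
  env_ext (tens_mul *%R) (1 ⊗ 1) env_prim.

Fact tens_env_mul_bilinear : bilinear_map (tens_mul ( *%R : Ug -> Ug -> Ug)).
Proof. exact/tens_mul_bilinear/env_mul_bilinear. Qed.

Fact tens_env_mulE (a b c d : Ug) :
  tens_mul *%R (a ⊗ b) (c ⊗ d) = (a * c) ⊗ (b * d).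
Proof. exact/tens_mulE/env_mul_bilinear. Qed.

Fact tens_env_mulA : associative (tens_mul ( *%R : Ug -> Ug -> Ug)).
Proof.
move=> u v t; have [bl br] := tens_env_mul_bilinear.
move: u; apply: tens_linear_eq.
- exact: bl.
- exact: linear_comp (bl _) (bl _).
move=> a b; move: v; apply: tens_linear_eq.
- exact: linear_comp (br _) (bl _).
- exact: linear_comp (bl _) (br _).
move=> c d; move: t; apply: tens_linear_eq.
- exact: linear_comp (br _) (br _).
- exact: br.
by move=> e f; rewrite !tens_env_mulE !mulrA.
Qed.

Fact tens_env_mul1 : left_id (1 ⊗ 1) (tens_mul ( *%R : Ug -> Ug -> Ug)).
Proof.
apply: tens_linear_eq => [|//|a b]; first exact: tens_env_mul_bilinear.2.
by rewrite tens_env_mulE !mul1r.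
Qed.

Fact tens_env_mul_1 : right_id (1 ⊗ 1) (tens_mul ( *%R : Ug -> Ug -> Ug)).
Proof.
apply: tens_linear_eq => [|//|a b]; first exact: tens_env_mul_bilinear.1.
by rewrite tens_env_mulE !mulr1.
Qed.

Lemma env_gen_linear : linear (@env_gen k g).
Proof. exact: (@env_word_linear k g [::] [::]). Qed.

Lemma env_gen_lie (x y : g) :
  env_gen (lie x y) = env_gen x * env_gen y - env_gen y * env_gen x.
Proof.
rewrite [_ * env_gen y]env_mulE [env_gen y * _]env_mulE.
by rewrite (env_word_bracket x y [::] [::]) addrC addKr.
Qed.

Fact env_prim_linear : linear env_prim.
Proof.
apply: linear_addf.
  exact: linear_comp ((tens_bilinear _ _).1 _) env_gen_linear.
exact: linear_comp ((tens_bilinear _ _).2 _) env_gen_linear.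
Qed.

Fact env_prim_lie (x y : g) : env_prim (lie x y) =
  tens_mul *%R (env_prim x) (env_prim y) - tens_mul *%R (env_prim y) (env_prim x).
Proof.
have [tl tr] := tens_bilinear Ug Ug.
rewrite /env_prim !(linearDf (tens_env_mul_bilinear.1 _)).
rewrite !(linearDf (tens_env_mul_bilinear.2 _)) !tens_env_mulE !mulr1 !mul1r.
rewrite env_gen_lie (linearBf (tl _)) (linearBf (tr _)).
set A := (_ * _) ⊗ 1; set B := (_ * _) ⊗ 1; set C := 1 ⊗ (_ * _).
set D := 1 ⊗ (_ * _); set E := env_gen x ⊗ _; set F := env_gen y ⊗ _.
rewrite [F + C]addrC [A + E + _]addrACA [E + D]addrC [B + F + _]addrACA.
by rewrite [F + E]addrC opprD [RHS]addrACA subrr addr0 opprD addrACA.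
Qed.

Lemma env_comul_linear : linear env_comul.
Proof.
exact: env_ext_linear tens_env_mul_bilinear tens_env_mulA tens_env_mul1
  env_prim_linear env_prim_lie.
Qed.

Lemma env_comul_gen x : env_comul (env_gen x) = env_gen x ⊗ 1 + 1 ⊗ env_gen x.
Proof.
exact: env_extE tens_env_mul_bilinear tens_env_mulA tens_env_mul1 tens_env_mul_1
  env_prim_linear env_prim_lie x.
Qed.

Lemma env_comul1 : env_comul 1 = 1 ⊗ 1.
Proof.
exact: env_ext1 tens_env_mul_bilinear tens_env_mulA tens_env_mul1
  env_prim_linear env_prim_lie.
Qed.

Lemma env_comulM u v :
  env_comul (u * v) = tens_mul *%R (env_comul u) (env_comul v).
Proof.
exact: env_extM tens_env_mul_bilinear tens_env_mulA tens_env_mul1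
  env_prim_linear env_prim_lie u v.
Qed.

Lemma env_counit_linear : scalar (@env_counit k g).
Proof.
have [b l br] := env_counitP g.
exact: env_ext_linear b (@mulrA _) (@mul1r _) l br.
Qed.

Lemma env_counit_gen x : @env_counit k g (env_gen x) = 0.
Proof.
have [b l br] := env_counitP g.
exact: env_extE b (@mulrA _) (@mul1r _) (@mulr1 _) l br x.
Qed.

Lemma env_counit1 : @env_counit k g 1 = 1.
Proof.
have [b l br] := env_counitP g.
exact: env_ext1 b (@mulrA _) (@mul1r _) l br.
Qed.

Lemma env_counitM u v :
  @env_counit k g (u * v) = env_counit u * env_counit v.
Proof.
have [b l br] := env_counitP g.
exact: env_extM b (@mulrA _) (@mul1r _) l br u v.
Qed.

End EnvelopingCoalgebra.

Section Coalgebras.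
Variable (k : fieldType).

Definition coalgebra_axioms (C : lmodType k) (comul : C -> tensor C C)
    (counit : C -> k) : Prop :=
  [/\ linear comul, scalar counit,
      (forall u, \Sw_(a, b <- comul u) \Sw_(a1, a2 <- comul a) (a1 ⊗ (a2 ⊗ b))
               = \Sw_(a, b <- comul u) (a ⊗ comul b)),
      (forall u, \Sw_(a, b <- comul u) (counit a *: b) = u /\
                 \Sw_(a, b <- comul u) (counit b *: a) = u)
    & (forall u, \Sw_(a, b <- comul u) (b ⊗ a) = comul u)].

Definition coalgebra_morphism (C D : lmodType k)
    (comulC : C -> tensor C C) (counitC : C -> k)
    (comulD : D -> tensor D D) (counitD : D -> k) (f : C -> D) : Prop :=
  [/\ linear f, (forall x, comulD (f x) = tens_map f f (comulC x))
    & (forall x, counitD (f x) = counitC x)].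

Definition tens_comul (C : lmodType k) (comul : C -> tensor C C)
    (t : tensor C C) : tensor (tensor C C) (tensor C C) :=
  \Sw_(u, v <- t) \Sw_(u1, u2 <- comul u) \Sw_(v1, v2 <- comul v)
    ((u1 ⊗ v1) ⊗ (u2 ⊗ v2)).

Definition tens_counit (C : lmodType k) (counit : C -> k) (t : tensor C C) : k :=
  \Sw_(u, v <- t) (counit u * counit v : k^o).

End Coalgebras.

(* All Sweedler sums below are taken of multilinear expressions as soon as the
   products and divisions involved are bilinear and comul and counit linear. *)
Section NonassociativeHopf.
Variables (k : fieldType) (A : lmodType k).
Variables (comul : A -> tensor A A) (counit : A -> k) (one : A) (mul : A -> A -> A).
Local Notation "x ∗ y" := (mul x y) (at level 40, left associativity).

Definition unital_bialgebra_axioms : Prop :=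
  [/\ coalgebra_axioms comul counit,
      [/\ bilinear_map mul, left_id one mul & right_id one mul],
      comul one = one ⊗ one /\
        (forall u v, comul (u ∗ v) = tens_mul mul (comul u) (comul v))
    & counit one = 1 /\ (forall u v, counit (u ∗ v) = counit u * counit v)].

(* ldiv u v is u \ v and rdiv u v is u / v *)
Definition hopf_axioms (ldiv rdiv : A -> A -> A) : Prop :=
  [/\ unital_bialgebra_axioms, bilinear_map ldiv, bilinear_map rdiv,
      (forall u v, \Sw_(a, b <- comul u) ldiv a (b ∗ v) = counit u *: v /\
                   \Sw_(a, b <- comul u) (a ∗ ldiv b v) = counit u *: v)
    & (forall u v, \Sw_(a, b <- comul v) rdiv (u ∗ a) b = counit v *: u /\
                   \Sw_(a, b <- comul v) (rdiv u a ∗ b) = counit v *: u)].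

Section Pseudospecial.
Variable rdiv : A -> A -> A.

Definition hopf_r (u v x : A) : A :=
  \Sw_(u1, u2 <- comul u) \Sw_(v1, v2 <- comul v)
    rdiv ((x ∗ u1) ∗ v1) (u2 ∗ v2).

Definition hopf_P (bul : tensor A A -> A) (u v x : A) : A :=
  \Sw_(u1, u2 <- comul u) \Sw_(v1, v2 <- comul v)
    (hopf_r u1 v1 x ∗ bul (u2 ⊗ v2)).

Definition right_pseudospecial : Prop :=
  exists bul : tensor A A -> A,
    [/\ coalgebra_morphism (tens_comul comul) (tens_counit counit)
          comul counit bul,
        (forall u, bul (one ⊗ u) = counit u *: one /\
                   bul (u ⊗ one) = counit u *: one)
      & (forall u v x y, hopf_P bul u v (x ∗ y) =
          \Sw_(u1, u2 <- comul u) \Sw_(v1, v2 <- comul v)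
            (hopf_r u1 v1 x ∗ hopf_P bul u2 v2 y))].

End Pseudospecial.

(* ((x y_(1)) y_(2) ...) y_(n) *)
Fixpoint right_iter_mul (n : nat) (x y : A) : A :=
  match n with
  | 0 => counit y *: x
  | n'.+1 => \Sw_(a, b <- comul y) (right_iter_mul n' x a ∗ b)
  end.

(* (y_(1) y_(2) ...) y_(n) *)
Fixpoint conv_power (n : nat) (y : A) : A :=
  match n with
  | 0 => counit y *: one
  | 1 => y
  | n'.+1 => \Sw_(a, b <- comul y) (conv_power n' a ∗ b)
  end.

Definition right_monoalternative : Prop :=
  forall n x y, right_iter_mul n x y = x ∗ conv_power n y.

Definition pseudoreductive_hopf : Prop :=
  exists ldiv rdiv : A -> A -> A,
    [/\ hopf_axioms ldiv rdiv, right_pseudospecial rdiv & right_monoalternative].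

End NonassociativeHopf.

Section Triples.
Variables (k : fieldType) (g : lieAlgType k) (s c : {pred g}).

Definition lie_triple : Prop :=
  [/\ submod_closed s, {in s &, forall x y, lie x y \in s}, submod_closed c,
      (forall x, exists d e, [/\ d \in s, e \in c & x = d + e])
    & (forall x, x \in s -> x \in c -> x = 0)].

Definition lie_normalizer (x : g) : Prop := forall y, y \in c -> lie x y \in c.

(* zeta is a map from s to c: its values outside s are irrelevant *)
Definition pseudoreductive_triple : Prop :=
  lie_triple /\
  exists zeta : g -> g,
    [/\ {in s, forall d, zeta d \in c},
        {in s, forall d, lie_normalizer (d + zeta d)}
      & {in s & c, forall d e n, iter (2 * n) (lie e) (zeta d) \in c}].

End Triples.

Section Utau.
Variables (k : fieldType) (g : lieAlgType k) (s c : {pred g}).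

Definition left_ideal_rel (u : env g) : Prop :=
  exists (v : env g) (d : g), d \in s /\ u = v * env_gen d.

(* U(g) / U(g)s *)
Definition Utau := quot_span left_ideal_rel.
HB.instance Definition _ := GRing.Lmodule.on Utau.

Definition Utau_class (u : env g) : Utau := cls left_ideal_rel u.

Definition Utau_comul (q : Utau) : tensor Utau Utau :=
  tens_map Utau_class Utau_class (env_comul (repr q)).
Definition Utau_counit (q : Utau) : k := env_counit (repr q).
Definition Utau_one : Utau := Utau_class 1.

Lemma Utau_class_linear : linear Utau_class.
Proof. exact: cls_linear. Qed.

Fact Utau_class_ideal (u : env g) d : d \in s -> Utau_class (u * env_gen d) = 0.
Proof. by move=> sd; apply: cls0; exists u, d. Qed.

Lemma Utau_comulE u :
  Utau_comul (Utau_class u) = tens_map Utau_class Utau_class (env_comul u).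
Proof.
have cl := Utau_class_linear; have tl := tens_map_linear cl cl.
apply: (quot_lift (linear_comp tl (@env_comul_linear _ _))) => _ [v [d [sd ->]]].
rewrite env_comulM env_comul_gen; move: (env_comul v).
have [ml mr] := @tens_env_mul_bilinear k g.
apply: (@tens_linear_eq _ _ _ _ _ (fun=> 0)).
- exact: linear_comp tl (ml _).
- by move=> a x y; rewrite scaler0 addr0.
move=> a b; rewrite (linearDf (mr _)) !tens_env_mulE (linearDf tl) !tens_mapE //.
have [bl br] := tens_bilinear Utau Utau.
by rewrite !Utau_class_ideal // (linear0f (bl _)) (linear0f (br _)) addr0.
Qed.

Lemma Utau_counitE u : Utau_counit (Utau_class u) = env_counit u.
Proof.
apply: (quot_lift (W := k^o) (@env_counit_linear k g)) => _ [v [d [_ ->]]].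
by rewrite env_counitM env_counit_gen mulr0.
Qed.

(* The classes of symmetrized products of elements of c span U(g) / U(g)s, so this
   determines mul; that such a mul exists is part of the Poincare-Birkhoff-Witt
   theorem. *)
Definition Utau_product (mul : Utau -> Utau -> Utau) : Prop :=
  bilinear_map mul /\
  forall (u : env g) (n : nat) (x : 'I_n -> g), (forall i, x i \in c) ->
    mul (Utau_class u)
        (\sum_(sigma : 'S_n) Utau_class (\prod_(i < n) env_gen (x (sigma i))))
    = \sum_(sigma : 'S_n)
        Utau_class ((\prod_(i < n) env_gen (x (sigma (rev_ord i)))) * u).

End Utau.

(* Main.v *)
Require Import Defs.
From mathcomp Require Import all_boot all_order perm all_algebra.
From mathcomp Require freeg classical_sets.
From mathcomp Require Import boolp ring zify.

Import GRing.Theory.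
Local Open Scope ring_scope.
Set Implicit Arguments.
Unset Strict Implicit.
Unset Printing Implicit Defensive.

(** Let G and S be the formal groups of g and s.  The elements of U(g) / U(g)s are
    the distributions on G / S supported at the base point, and (c in c) |-> e^c S
    is a coordinate system there.  Let iota be the linear section of
    U(g) -> U(g) / U(g)s that maps the class of c ^ n to c ^ n, for c in c.  Then the
    product has to be x y = iota(y) x, for the left action of U(g).

    The existence of iota is the part of the Poincare-Birkhoff-Witt theorem that is
    needed, and it is proved without bases.  A word x1 ... xn in g acts on functions on
    G / S; applied to the coordinate function e^c S |-> c, and evaluated at the base
    point, it gives an element of c.  This function [chart] from words to c is
    constructed by recursion on words, from the condition that conjugation by
    e^(-chart) turns the operators d_x - x (d_x is the derivative along x) into d_x
    plus a function with values in s.  These operators satisfy the commutation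
    relations of g because ad is a derivation, and because the recursion has only one
    solution the function respects the relation xy - yx = [x, y] of U(g)
    ([chart_bracket]); it also vanishes on U(g)s.  Composing it with a linear map
    alpha and exponentiating gives a linear map U(g) -> U(g) that sends c ^ n to
    alpha(c) ^ n ([symmetric_extension]).  The choice alpha = id gives iota, and
    alpha = -id gives the right division, since e^(-c) is the inverse of e^c.

    In characteristic zero U(g) is spanned by the products x ^ m y ^ n with x in c and
    y in s ([pow2_spanning]), so U(g) / U(g)s is spanned by the classes of the divided
    powers c ^ n / n!, whose comultiplication is a Cauchy product.  All the bialgebra
    identities and monoalternativity are checked on these classes.  The left division
    inverts the left multiplications by a geometric series, which is finite on each
    element.

    Pseudospeciality: for u = e^a and v = e^b write e^b e^a = e^q h with q in c and h
    in S.  Then r(u, v) is the action of h ([hopf_rE]).  For h = e^d, with d in s, put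
    D = d + 2 zeta(d) and let u • v be the class of e^D.  The required identity follows
    if Y |-> e^D Y e^(-d) preserves the span Sym of the powers of elements of c
    ([twist_mem]), as iota is the identity on Sym.  The infinitesimal form of this map
    is Y |-> D Y - Y d = [d + zeta(d), Y] + (zeta(d) Y + Y zeta(d)).  The first summand
    preserves Sym because d + zeta(d) normalizes c.  For Y = c ^ n the second one is the
    image of zeta(d) under L ^ n + R ^ n, where L and R are the multiplications by c;
    this symmetric polynomial is a combination of the products
    (L - R) ^ (2 k) (sum of the L ^ i R ^ j with i + j = n - 2 k), and
    (L - R) ^ (2 k) zeta(d) is in c ([even_symmetric]).  The bullet operation is linear
    because zeta can be replaced by a linear map ([linear_zeta]). *)

(** * Deciding linear identities *)

Section LinearReflection.
Variables (k : fieldType) (V : lmodType k).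

Inductive lexpr : Type :=
  | LAtom of nat
  | LZero
  | LAdd of lexpr & lexpr
  | LOpp of lexpr
  | LScale of k & lexpr.

Fixpoint leval (env : seq V) (e : lexpr) : V :=
  match e with
  | LAtom n => env`_n
  | LZero => 0
  | LAdd e1 e2 => leval env e1 + leval env e2
  | LOpp e1 => - leval env e1
  | LScale a e1 => a *: leval env e1
  end.

Fixpoint lcoef (e : lexpr) (i : nat) : k :=
  match e with
  | LAtom n => if eqn n i then 1 else 0
  | LZero => 0
  | LAdd e1 e2 => lcoef e1 i + lcoef e2 i
  | LOpp e1 => - lcoef e1 i
  | LScale a e1 => a * lcoef e1 i
  end.

Fixpoint lcoef_eq (n : nat) (e1 e2 : lexpr) : Prop :=
  if n is n'.+1 then lcoef e1 n' = lcoef e2 n' /\ lcoef_eq n' e1 e2 else True.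

Lemma leval_coef env e : leval env e = \sum_(i < size env) lcoef e i *: env`_i.
Proof.
elim: e => [n||e1 IH1 e2 IH2|e IH|a e IH] /=.
- case: (ltnP n (size env)) => [ltn|gen].
    rewrite (bigD1 (Ordinal ltn)) //= ifT; last exact/eqnP.
    rewrite scale1r big1 ?addr0 // => i /eqP neq.
    by rewrite ifF ?scale0r //; apply/negP => /eqnP e; apply: neq; apply: val_inj.
  rewrite nth_default // big1 // => i _.
  rewrite ifF ?scale0r //; apply/negP => /eqnP e.
  by move: (leq_trans (ltn_ord i) gen); rewrite e ltnn.
- by rewrite big1 // => i _; rewrite scale0r.
- by rewrite IH1 IH2 -big_split; apply: eq_bigr => i _; rewrite scalerDl.
- by rewrite IH -sumrN; apply: eq_bigr => i _; rewrite scaleNr.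
- by rewrite IH scaler_sumr; apply: eq_bigr => i _; rewrite scalerA.
Qed.

(** Turns an equation in a vector space into equations in k, which [ring] can solve. *)
Lemma lcoef_eqP env e1 e2 :
  lcoef_eq (size env) e1 e2 -> leval env e1 = leval env e2.
Proof.
move=> H; rewrite !leval_coef; apply: eq_bigr => i _; congr (_ *: _).
elim: (size env) i H => [[] //|n IH] i /= [e H].
by case: (ltnP i n) => [lt|ge]; [exact: (IH (Ordinal lt)) |
  have -> : (i : nat) = n by apply/eqP; rewrite eqn_leq ge -ltnS ltn_ord].
Qed.
End LinearReflection.

(** Atoms are compared up to conversion, because the same vector often occurs with
    different but convertible carrier types. *)
Ltac lmem x l :=
  lazymatch l with
  | nil => constr:(false)
  | cons ?y ?l' =>
    match goal with
    | _ => let _ := match goal with _ => constr_eq x y end in constr:(true)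
    | _ => let _ := match goal with _ => unify x y end in constr:(true)
    | _ => lmem x l'
    end
  end.
Ltac lindex x l :=
  lazymatch l with
  | cons ?y ?l' =>
    match goal with
    | _ => let _ := match goal with _ => constr_eq x y end in constr:(0%N)
    | _ => let _ := match goal with _ => unify x y end in constr:(0%N)
    | _ => let n := lindex x l' in constr:(S n)
    end
  end.
Ltac latoms t l :=
  lazymatch t with
  | (?a + ?b)%R => let l' := latoms a l in latoms b l'
  | (- ?a)%R => latoms a l
  | (?c *: ?a)%R => latoms a l
  | 0%R => l
  | _ => let b := lmem t l in
         lazymatch b with true => l | false => constr:(cons t l) end
  end.
Ltac lreify k t l :=
  lazymatch t with
  | (?a + ?b)%R => let a' := lreify k a l in let b' := lreify k b l in
                   constr:(@LAdd k a' b')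
  | (- ?a)%R => let a' := lreify k a l in constr:(@LOpp k a')
  | (?c *: ?a)%R => let a' := lreify k a l in constr:(@LScale k c a')
  | 0%R => constr:(@LZero k)
  | _ => let n := lindex t l in constr:(@LAtom k n)
  end.
Ltac lmod_coefs k V :=
  lazymatch goal with
  | |- ?x = ?y =>
    let l0 := latoms x (@nil V) in
    let l := latoms y l0 in
    let ex := lreify k x l in
    let ey := lreify k y l in
    apply: (@lcoef_eqP k V l ex ey);
    cbv beta iota delta [lcoef_eq lcoef size eqn]; do ?split
  end.
Ltac lmod k V := lmod_coefs k V; ring.


(** * Subspaces and Cauchy sums *)

Section Subspaces.
Variables (k : fieldType) (V : lmodType k) (S : {pred V}).
Hypothesis SP : submod_closed S.

Lemma subspace0 : 0 \in S. Proof. by case: SP. Qed.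
Lemma subspaceD x y : x \in S -> y \in S -> x + y \in S.
Proof. by move=> Sx Sy; rewrite -[x]scale1r SP.2. Qed.
Lemma subspaceZ a x : x \in S -> a *: x \in S.
Proof. by move=> Sx; rewrite -[_ *: _]addr0 SP.2 // subspace0. Qed.
Lemma subspaceN x : x \in S -> - x \in S.
Proof. by rewrite -scaleN1r; apply: subspaceZ. Qed.
Lemma subspaceB x y : x \in S -> y \in S -> x - y \in S.
Proof. by move=> Sx /subspaceN; apply: subspaceD. Qed.
Lemma subspace_sum I (r : seq I) (P : pred I) (F : I -> V) :
  (forall i, P i -> F i \in S) -> \sum_(i <- r | P i) F i \in S.
Proof. move=> SF; elim/big_ind: _ => //; [exact: subspace0 | exact: subspaceD]. Qed.
Lemma subspaceDr x y : x \in S -> (x + y \in S) = (y \in S).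
Proof.
move=> Sx; apply/idP/idP => [|]; last exact: subspaceD.
by move=> Sxy; rewrite -(addKr x y) subspaceD // subspaceN.
Qed.
End Subspaces.

Lemma cauchy_square (V : nmodType) (T : nat -> nat -> V) N :
    (forall i j, ((N <= i) || (N <= j))%N -> T i j = 0) ->
  \sum_(n < N + N) \sum_(i < n.+1) T i (n - i)%N
  = \sum_(i < N) \sum_(j < N) T i j.
Proof.
move=> T0.
have tri M : \sum_(n < M) \sum_(i < n.+1) T i (n - i)%N
           = \sum_(i < M) \sum_(j < (M - i)%N) T i j.
  elim: M => [|M IH]; first by rewrite !big_ord0.
  rewrite big_ord_recr /= IH [in RHS]big_ord_recr /= subSn // subnn.
  rewrite [in RHS]big_ord_recr big_ord0 /= add0r.
  rewrite [X in _ + X = _]big_ord_recr /= subnn addrA.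
  congr (_ + _); rewrite -big_split; apply: eq_bigr => i _ /=.
  by rewrite subSn 1?ltnW // big_ord_recr.
rewrite tri big_split_ord /= [X in _ + X]big1 ?addr0 => [|i _].
  apply: eq_bigr => i _; rewrite -addnBA 1?ltnW // big_split_ord /=.
  rewrite [X in _ + X]big1 ?addr0 // => j _.
  by rewrite T0 // leq_addr orbT.
by rewrite big1 // => j _; rewrite T0 ?leq_addr.
Qed.

(** * Convolution of functions on words *)

Section Convolution.
Variables (k : fieldType) (X : eqType).
Implicit Types (w : seq X) (x : X) (Pr : pred X).

(** The product dual to the unshuffle coproduct of words: it sums B (f w1) (h w2) over
    the ways to distribute the letters of w to two subwords.  The recursion says that
    each f |-> f (x :: _) is a derivation, so that identities between convolutions
    reduce to the values at the empty word. *)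
Fixpoint conv (V1 V2 : Type) (V : lmodType k) (B : V1 -> V2 -> V)
    (f : seq X -> V1) (h : seq X -> V2) w : V :=
  match w with
  | [::] => B (f [::]) (h [::])
  | x :: w' => conv B (fun u => f (x :: u)) h w' + conv B f (fun u => h (x :: u)) w'
  end.

(** The two sides may have different codomains and bilinear maps, so this also compares
    a convolution with one that involves a constant. *)
Lemma conv_ext Pr (V1 V2 V1' V2' : Type) (V : lmodType k)
    (B : V1 -> V2 -> V) (B' : V1' -> V2' -> V) f h f' h' w :
  all Pr w ->
  (forall u1 u2, all Pr u1 -> all Pr u2 -> (size u1 + size u2 = size w)%N ->
     B (f u1) (h u2) = B' (f' u1) (h' u2)) ->
  conv B f h w = conv B' f' h' w.
Proof.
elim: w f h f' h' => [|x w IH] f h f' h' /=; first by move=> _; apply.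
case/andP=> Px Pw H; congr (_ + _); apply: IH => // u1 u2 P1 P2 sz;
  by apply: H; rewrite /= ?Px // ?addnS ?addSn sz.
Qed.

Lemma conv_mem Pr (V1 V2 : Type) (V : lmodType k) (B : V1 -> V2 -> V)
    (S : {pred V}) f h w :
  submod_closed S -> all Pr w ->
  (forall u1 u2, all Pr u1 -> all Pr u2 -> (size u1 + size u2 = size w)%N ->
     B (f u1) (h u2) \in S) ->
  conv B f h w \in S.
Proof.
move=> SP; elim: w f h => [|x w IH] f h /=; first by move=> _; apply.
case/andP=> Px Pw H; apply: subspaceD => //; apply: IH => // u1 u2 P1 P2 sz;
  by apply: H; rewrite /= ?Px // ?addnS ?addSn sz.
Qed.

Lemma conv_eq0 (V1 V2 : Type) (V : lmodType k) (B : V1 -> V2 -> V) f h w :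
  (forall u1 u2, (size u1 + size u2 = size w)%N -> B (f u1) (h u2) = 0) ->
  conv B f h w = 0.
Proof.
move=> H; apply/eqP; apply: (@conv_mem predT _ _ _ B (pred1 0)).
- by split=> [|a u v]; rewrite !inE // => /eqP-> /eqP->; rewrite scaler0 addr0.
- by rewrite all_predT.
- by move=> *; rewrite inE H.
Qed.

Section Bilinear.
Variables (V1 V2 V : lmodType k) (B : V1 -> V2 -> V).
Hypothesis BP : bilinear_map B.

Lemma bil0l v : B 0 v = 0. Proof. exact: linear0f (BP.1 v). Qed.
Lemma bil0r v : B v 0 = 0. Proof. exact: linear0f (BP.2 v). Qed.
Lemma bilDl u u' v : B (u + u') v = B u v + B u' v.
Proof. exact: linearDf (BP.1 v) u u'. Qed.
Lemma bilDr u v v' : B u (v + v') = B u v + B u v'.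
Proof. exact: linearDf (BP.2 u) v v'. Qed.
Lemma bilZl a u v : B (a *: u) v = a *: B u v.
Proof. exact: linearZf a (BP.1 v) u. Qed.
Lemma bilZr a u v : B u (a *: v) = a *: B u v.
Proof. exact: linearZf a (BP.2 u) v. Qed.
Lemma bilNr u v : B u (- v) = - B u v.
Proof. by rewrite -!scaleN1r bilZr. Qed.
Lemma bil_suml I (r : seq I) (P : pred I) F v :
  B (\sum_(i <- r | P i) F i) v = \sum_(i <- r | P i) B (F i) v.
Proof. exact: linear_sumf (BP.1 v). Qed.
Lemma bil_sumr I (r : seq I) (P : pred I) F u :
  B u (\sum_(i <- r | P i) F i) = \sum_(i <- r | P i) B u (F i).
Proof. exact: linear_sumf (BP.2 u). Qed.

Lemma conv_linearl a f f' h w :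
  conv B (fun u => a *: f u + f' u) h w = a *: conv B f h w + conv B f' h w.
Proof.
elim: w f f' h => [|x w IH] f f' h /=; first by rewrite bilDl bilZl.
by rewrite !IH scalerDr addrACA.
Qed.
Lemma conv_linearr a f h h' w :
  conv B f (fun u => a *: h u + h' u) w = a *: conv B f h w + conv B f h' w.
Proof.
elim: w f h h' => [|x w IH] f h h' /=; first by rewrite bilDr bilZr.
by rewrite !IH scalerDr addrACA.
Qed.
Lemma conv0l h w : conv B (fun=> 0) h w = 0.
Proof. by apply: conv_eq0 => *; rewrite bil0l. Qed.
Lemma conv0r f w : conv B f (fun=> 0) w = 0.
Proof. by apply: conv_eq0 => *; rewrite bil0r. Qed.
Lemma convDl f f' h w :
  conv B (fun u => f u + f' u) h w = conv B f h w + conv B f' h w.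
Proof.
rewrite -[conv B f h w]scale1r -conv_linearl.
by apply: (@conv_ext predT); rewrite ?all_predT // => *; rewrite scale1r.
Qed.
Lemma convDr f h h' w :
  conv B f (fun u => h u + h' u) w = conv B f h w + conv B f h' w.
Proof.
rewrite -[conv B f h w]scale1r -conv_linearr.
by apply: (@conv_ext predT); rewrite ?all_predT // => *; rewrite scale1r.
Qed.
Lemma convZl a f h w : conv B (fun u => a *: f u) h w = a *: conv B f h w.
Proof.
rewrite -[RHS]addr0 -(conv0l h w) -conv_linearl.
by apply: (@conv_ext predT); rewrite ?all_predT // => *; rewrite addr0.
Qed.
Lemma convZr a f h w : conv B f (fun u => a *: h u) w = a *: conv B f h w.
Proof.
rewrite -[RHS]addr0 -(conv0r f w) -conv_linearr.
by apply: (@conv_ext predT); rewrite ?all_predT // => *; rewrite addr0.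
Qed.
Lemma convNl f h w : conv B (fun u => - f u) h w = - conv B f h w.
Proof.
rewrite -scaleN1r -convZl; congr conv; apply: funext => u; by rewrite scaleN1r.
Qed.
Lemma convNr f h w : conv B f (fun u => - h u) w = - conv B f h w.
Proof.
rewrite -scaleN1r -convZr; congr conv; apply: funext => u; by rewrite scaleN1r.
Qed.
Lemma conv_suml I (r : seq I) (P : pred I) F h w :
  conv B (fun u => \sum_(i <- r | P i) F i u) h w
  = \sum_(i <- r | P i) conv B (F i) h w.
Proof.
elim: r => [|i r IH].
  rewrite big_nil -(conv0l h w); congr conv; apply: funext => u; by rewrite big_nil.
rewrite big_cons -IH; case Pi: (P i); rewrite -?convDl; congr conv;
  by apply: funext => u; rewrite big_cons Pi.
Qed.
Lemma conv_sumr I (r : seq I) (P : pred I) f F w :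
  conv B f (fun u => \sum_(i <- r | P i) F i u) w
  = \sum_(i <- r | P i) conv B f (F i) w.
Proof.
elim: r => [|i r IH].
  rewrite big_nil -(conv0r f w); congr conv; apply: funext => u; by rewrite big_nil.
rewrite big_cons -IH; case Pi: (P i); rewrite -?convDr; congr conv;
  by apply: funext => u; rewrite big_cons Pi.
Qed.
End Bilinear.

(** The constant functions: they are killed by all the derivatives. *)
Definition wconst (V : lmodType k) (v : V) : seq X -> V :=
  fun w => if w is [::] then v else 0.

Lemma conv_constr (V1 V2 V : lmodType k) (B : V1 -> V2 -> V) f v w :
  bilinear_map B -> conv B f (wconst v) w = B (f w) v.
Proof.
move=> BP; elim: w f => [|x w IH] f //=.
by rewrite IH [X in _ + X](conv0r BP) addr0.
Qed.
Lemma conv_constl (V1 V2 V : lmodType k) (B : V1 -> V2 -> V) v h w :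
  bilinear_map B -> conv B (wconst v) h w = B v (h w).
Proof.
move=> BP; elim: w h => [|x w IH] h //=.
by rewrite IH [X in X + _](conv0l BP) add0r.
Qed.

Definition word_comb := seq (k * seq X).
Definition wder (V : lmodType k) (p : word_comb) (f : seq X -> V) w : V :=
  \sum_(q <- p) q.1 *: f (q.2 ++ w).

(** The letters, and the commutator relation of U(g), are primitive for the unshuffle
    coproduct: they act on convolutions as derivations. *)
Definition primitive_comb (p : word_comb) : Prop :=
  all (fun q => q.2 != [::]) p /\
  forall (V1 V2 V : lmodType k) (B : V1 -> V2 -> V), bilinear_map B ->
  forall f h w,
  wder p (conv B f h) w = conv B (wder p f) h w + conv B f (wder p h) w.

(** f vanishes on the multiples w1 p w2 of p with fewer than n further letters.  If Om
    is false only the left multiples are considered, as for the left ideal U(g)s. *)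
Definition kills (V : lmodType k) (p : word_comb) (Om : bool) n
    (f : seq X -> V) : Prop :=
  forall w1 w2, Om || nilp w2 -> (size w1 + size w2 < n)%N ->
  wder p (fun u => f (w1 ++ u)) w2 = 0.

Lemma kills_leq (V : lmodType k) p Om n m (f : seq X -> V) :
  (m <= n)%N -> kills p Om n f -> kills p Om m f.
Proof. by move=> le H w1 w2 O sz; apply: H => //; apply: leq_trans le. Qed.

Lemma kills_tail (V : lmodType k) p Om n (f : seq X -> V) x :
  kills p Om n.+1 f -> kills p Om n (fun u => f (x :: u)).
Proof. by move=> H w1 w2 O sz; apply: (H (x :: w1) w2). Qed.

Lemma wder_conv_nil (V1 V2 V : lmodType k) (B : V1 -> V2 -> V) p f h x w1 w2 :
  wder p (fun u => conv B f h ((x :: w1) ++ u)) w2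
  = wder p (fun u => conv B (fun u => f (x :: u)) h (w1 ++ u)) w2
  + wder p (fun u => conv B f (fun u => h (x :: u)) (w1 ++ u)) w2.
Proof. by rewrite /wder -big_split; apply: eq_bigr => q _ /=; rewrite scalerDr. Qed.

Lemma kills_conv (V1 V2 V : lmodType k) (B : V1 -> V2 -> V) p Om n f h :
  bilinear_map B -> primitive_comb p ->
  kills p Om n f -> kills p Om n h -> kills p Om n (conv B f h).
Proof.
move=> BP pP; elim: n f h => [|n IH] f h Kf Kh w1 w2 O //.
case: w1 => [|x w1] sz; last first.
  by rewrite wder_conv_nil !IH ?addr0 //; try exact: kills_tail; apply: kills_leq Kf || apply: kills_leq Kh.
have sm (u v : seq X) :
    (size u + size v = size w2)%N -> Om || nilp u /\ (size u < n.+1)%N.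
  move=> e; split; first by case: (Om) O => //= /nilP w0; move: e; rewrite w0; case: u.
  by apply: leq_ltn_trans sz; rewrite -e leq_addr.
rewrite -[LHS]/(wder p (conv B f h) w2) (pP.2 _ _ _ _ BP) !conv_eq0 ?addr0 // => u1 u2 e.
  rewrite addnC in e; case: (sm _ _ e) => *.
  by rewrite [wder _ _ _](Kh [::]) // (bil0r BP).
by case: (sm _ _ e) => *; rewrite [wder _ _ _](Kf [::]) // (bil0l BP).
Qed.

(** Since f vanishes on the empty word, h is only evaluated on shorter words.  This is
    what makes inductions on the length of words possible. *)
Lemma kills_conv_strict (V1 V2 V : lmodType k) (B : V1 -> V2 -> V) p Om n f h :
  bilinear_map B -> primitive_comb p -> f [::] = 0 ->
  kills p Om n.+1 f -> kills p Om n h -> kills p Om n.+1 (conv B f h).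
Proof.
move=> BP pP f0; elim: n h => [|n IH] h Kf Kh w1 w2 O sz.
  case: w1 w2 O sz => [|//] [|//] O sz.
  rewrite -[LHS]/(wder p (conv B f h) [::]) (pP.2 _ _ _ _ BP) /= f0 (bil0l BP) addr0.
  by rewrite [wder _ _ _](Kf [::]) // (bil0l BP).
case: w1 sz => [|x w1] sz; last first.
  rewrite wder_conv_nil [X in X + _](@kills_conv _ _ _ _ p Om n.+1) //; first 1 last.
  - exact: kills_tail.
  by rewrite add0r IH //; [exact: kills_leq Kf | exact: kills_tail].
have sm (u v : seq X) :
    (size u + size v = size w2)%N -> Om || nilp u /\ (size u < n.+2)%N.
  move=> e; split; first by case: (Om) O => //= /nilP w0; move: e; rewrite w0; case: u.
  by apply: leq_ltn_trans sz; rewrite -e leq_addr.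
rewrite -[LHS]/(wder p (conv B f h) w2) (pP.2 _ _ _ _ BP) !conv_eq0 ?addr0 // => u1 u2 e; last first.
  by case: (sm _ _ e) => *; rewrite [wder _ _ _](Kf [::]) // (bil0l BP).
case: u1 e => [|x u1] e; first by rewrite f0 (bil0l BP).
have e' := e; rewrite addnC in e'; case: (sm _ _ e') => O2 _.
rewrite [wder _ _ _](Kh [::]) ?(bil0r BP) //.
by rewrite add0n -ltnS; apply: leq_ltn_trans sz; rewrite -e /= addSn ltnS leq_addl.
Qed.

Lemma kills_linear (V : lmodType k) p Om n a (f f' : seq X -> V) :
  kills p Om n f -> kills p Om n f' -> kills p Om n (fun u => a *: f u + f' u).
Proof.
move=> Kf Kf' w1 w2 O sz.
transitivity (a *: wder p (fun u => f (w1 ++ u)) w2 + wder p (fun u => f' (w1 ++ u)) w2).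
  rewrite /wder scaler_sumr -big_split; apply: eq_bigr => q _ /=.
  by rewrite scalerDr !scalerA mulrC.
by rewrite Kf // Kf' // scaler0 addr0.
Qed.

Lemma kills_const (V : lmodType k) p Om n (v : V) :
  primitive_comb p -> kills p Om n (wconst v).
Proof.
move=> [/allP p0 _] w1 w2 _ _; rewrite /wder big1_seq // => q /andP[_ /p0].
by case: q => a [|x u] //= _; case: w1 => *; rewrite scaler0.
Qed.

Lemma kills_lin (V W : lmodType k) p Om n (al : V -> W) (f : seq X -> V) :
  linear al -> kills p Om n f -> kills p Om n (fun u => al (f u)).
Proof.
move=> la Kf w1 w2 O sz; rewrite -(linear0f la) -(Kf w1 w2 O sz) /wder linear_sumf //.
by apply: eq_bigr => q _; rewrite linearZf.
Qed.

Lemma primitive_letters (p : seq (k * X)) :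
  primitive_comb [seq (q.1, [:: q.2]) | q <- p].
Proof.
split; first by rewrite all_map; apply/allP.
move=> V1 V2 V B BP f h w; rewrite /wder (conv_suml BP) (conv_sumr BP) -big_split.
rewrite !big_map; apply: eq_bigr => q _ /=.
by rewrite (convZl BP) (convZr BP) scalerDr.
Qed.


Lemma primitive_swap x y z :
  primitive_comb [:: (1, [:: x; y]); (-1, [:: y; x]); (-1, [:: z])].
Proof.
split=> // V1 V2 V B BP f h w; rewrite /wder (conv_suml BP) (conv_sumr BP).
rewrite !big_cons !big_nil /= !(convZl BP) !(convZr BP).
lmod k V.
Qed.

End Convolution.

Section Primitive.
Variables (k : fieldType) (g : lieAlgType k).

Definition lin_comb (a : k) (x y : g) : word_comb k g :=
  [:: (1, [:: a *: x + y]); (- a, [:: x]); (-1, [:: y])].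
Definition brk_comb (x y : g) : word_comb k g :=
  [:: (1, [:: x; y]); (-1, [:: y; x]); (-1, [:: lie x y])].
Definition end_comb (d : g) : word_comb k g := [:: (1, [:: d])].

Lemma lin_primitive a x y : primitive_comb (lin_comb a x y).
Proof. exact: (primitive_letters [:: (1, a *: x + y); (- a, x); (-1, y)]). Qed.
Lemma end_primitive d : primitive_comb (end_comb d).
Proof. exact: (primitive_letters [:: (1, d)]). Qed.
Lemma brk_primitive x y : primitive_comb (brk_comb x y).
Proof. exact: primitive_swap. Qed.
End Primitive.

(** * The coordinate function of a triple *)

Lemma sum_widen (V : nmodType) (F : nat -> V) m n :
  (m <= n)%N -> (forall i, (m <= i)%N -> F i = 0) ->
  \sum_(i < n) F i = \sum_(i < m) F i.
Proof.
move=> le F0; rewrite -(subnKC le) big_split_ord /= [X in _ + X]big1 ?addr0 //.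
by move=> i _; rewrite F0 ?leq_addr.
Qed.

Section Chart.
Variables (k : fieldType) (g : lieAlgType k).
Hypothesis char0 : forall n, n.+1%:R != 0 :> k.
Variables (s c : {pred g}) (pc : g -> g).
Hypotheses (sP : submod_closed s) (sL : {in s &, forall x y, lie x y \in s}).
Hypotheses (cP : submod_closed c) (pc_lin : linear pc).
Hypotheses (pc_c : forall x, pc x \in c) (pc_s : forall x, x - pc x \in s).
Hypothesis sc0 : forall x, x \in s -> x \in c -> x = 0.

Let lieP : bilinear_map (@lie k g) := @lie_bilinear k g.
Local Notation br := (@conv k g g g g (@lie k g)).

Lemma pc_id x : x \in c -> pc x = x.
Proof.
move=> cx; apply/esym/eqP; rewrite -subr_eq0; apply/eqP/sc0; first exact: pc_s.
exact: subspaceB.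
Qed.

Lemma pc_eq0 x : pc x = 0 -> x \in s.
Proof. by move=> e; rewrite -[x]subr0 -e. Qed.

Lemma pc0s x : x \in s -> pc x = 0.
Proof.
move=> sx; apply: sc0 (pc_c x); rewrite -[pc x](subKr x).
by apply: subspaceB => //; apply: pc_s.
Qed.

Lemma lie_anti (x y : g) : lie x y = - lie y x.
Proof.
apply/eqP; rewrite -addr_eq0; have := liexx (x + y).
by rewrite (bilDl lieP) !(bilDr lieP) !liexx add0r addr0 => ->.
Qed.

Lemma lie_jacobi (v f h : g) :
  lie v (lie f h) = lie (lie v f) h + lie f (lie v h).
Proof.
have := jacobi v f h; rewrite (lie_anti (lie v f)) (lie_anti v h) (bilNr lieP).
by move/eqP; rewrite -addrA addr_eq0 => /eqP ->; rewrite opprD addrC.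
Qed.

Lemma br_anti f h w : br f h w = - br h f w.
Proof.
elim: w f h => [|x w IH] f h /=; first exact: lie_anti.
by rewrite [X in X + _]IH [X in _ + X]IH -opprD addrC.
Qed.

Lemma br_jacobi v f h w : br v (br f h) w = br (br v f) h w + br f (br v h) w.
Proof.
elim: w v f h => [|x w IH] v f h /=; first exact: lie_jacobi.
set dv := fun u => v (x :: u); set df := fun u => f (x :: u).
set dh := fun u => h (x :: u).
rewrite (convDr lieP v (br df h) (br f dh)) (convDr lieP f (br dv h) (br v dh)).
rewrite (convDl lieP (br dv f) (br v df) h) (IH dv) (IH v df) (IH v f dh).
lmod k g.
Qed.

(** frame v x n is the component of degree n in v of e^(- ad v) (d_x - x), where
    [d_x, v] is the derivative of v along x.  The operator d_x itself, which is also in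
    the component of degree 0, is left out: then all components are functions. *)
Fixpoint frame (v : seq g -> g) (x : g) (n : nat) (w : seq g) : g :=
  if n is n'.+1 then
    n'.+1%:R^-1 *: ((if n' is 0 then v (x :: w) else 0) - br v (frame v x n') w)
  else - wconst x w.

Lemma frameS v x n w : frame v x n.+1 w =
  n.+1%:R^-1 *: ((if n is 0 then v (x :: w) else 0) - br v (frame v x n) w).
Proof. by []. Qed.

Lemma frame_rec v x n w :
  n.+1%:R *: frame v x n.+1 w
  = (if n is 0 then v (x :: w) else 0) - br v (frame v x n) w.
Proof. by rewrite /= scalerA divff ?scale1r. Qed.

Section FrameLocal.
Variables (v v' : seq g -> g) (m : nat).
Hypotheses (v0 : v [::] = 0) (v'0 : v' [::] = 0).
Hypothesis agree : forall u, (size u <= m)%N -> v u = v' u.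

Lemma frame_local_lt x n w : (size w < m)%N -> frame v x n w = frame v' x n w.
Proof.
elim: n w => [|n IH] w sw //=; congr (_ *: (_ - _)).
  by case: n {IH} => // ; apply: agree.
apply: (@conv_ext _ _ predT); rewrite ?all_predT // => u1 u2 _ _ e.
by rewrite agree ?IH //; [apply: leq_ltn_trans sw; rewrite -e leq_addl
  | apply/ltnW/(leq_ltn_trans _ sw); rewrite -e leq_addr].
Qed.

(** The component of degree 1 is excluded: it contains the value of v on x :: w, which
    is longer than w. *)
Lemma frame_local x n w : (size w <= m)%N -> n != 1%N ->
  frame v x n w = frame v' x n w.
Proof.
case: n => [|[|n]] sw // _; rewrite ![frame _ _ n.+2 _]/=; congr (_ *: (_ - _)).
apply: (@conv_ext _ _ predT); rewrite ?all_predT // => u1 u2 _ _ e.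
have s1 : (size u1 <= m)%N by apply: leq_trans sw; rewrite -e leq_addr.
rewrite -(agree s1); case: u1 e s1 => [|y u1] e s1; first by rewrite v0 !(bil0l lieP).
have s2 : (size u2 < m)%N.
  by apply: leq_trans sw; rewrite -e /= addSn ltnS leq_addl.
by congr (lie _ _); apply: (frame_local_lt x n.+1 s2).
Qed.

Lemma frame_sum_local x N w : (size w <= m)%N ->
  v (x :: w) - \sum_(n < N.+2) frame v x n w
  = v' (x :: w) - \sum_(n < N.+2) frame v' x n w.
Proof.
move=> sw; rewrite !big_ord_recl.
have -> : \sum_(i < N) frame v x (lift ord0 (lift ord0 i)) w
        = \sum_(i < N) frame v' x (lift ord0 (lift ord0 i)) w.
  by apply: eq_bigr => i _; apply: frame_local.
have e1 u : frame u x (lift ord0 (@ord0 N)) w = u (x :: w) - br u (frame u x 0) w.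
  by rewrite /= invr1 scale1r.
rewrite !e1.
have -> : br v (frame v x 0) w = br v' (frame v' x 0) w.
  apply: (@conv_ext _ _ predT); rewrite ?all_predT // => u1 u2 _ _ e.
  by rewrite agree // (leq_trans _ sw) // -e leq_addr.
rewrite (frame_local x (n := 0)) //; lmod k g.
Qed.
End FrameLocal.

(** One step of the iteration for the equation that the sum of the components of the
    frame has its values in s.  The value of v on x :: w' cancels in the argument of pc,
    which therefore depends only on the values of v on words not longer than w'.  The
    components of degree larger than 1 + size w' vanish on w'. *)
Definition chart_step (v : seq g -> g) (w : seq g) : g :=
  if w is x :: w' then
    pc (v (x :: w') - \sum_(n < (size w').+2) frame v x n w')
  else 0.

Definition chart (w : seq g) : g := iter (size w) chart_step (fun=> 0) w.

(** The iteration stabilizes on each word, after as many steps as it has letters. *)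
Lemma chart_iter m j w : (size w <= m)%N ->
  iter m chart_step (fun=> 0) w = iter (m + j) chart_step (fun=> 0) w.
Proof.
have i0 n : iter n chart_step (fun=> 0) [::] = 0 by case: n.
elim: m w => [|m IH] [|x w] // sw; rewrite ?i0 //.
rewrite addSn !iterS /=; congr (pc _).
by apply: (frame_sum_local (m := m)).
Qed.

Lemma chart0 : chart [::] = 0. Proof. by []. Qed.

Lemma chartE x w :
  chart (x :: w) = pc (chart (x :: w) - \sum_(n < (size w).+2) frame chart x n w).
Proof.
rewrite {1}/chart /=; congr (pc _).
apply: (frame_sum_local (m := size w)) => // [|u su]; first by case: (size w).
by rewrite /chart -(subnKC su) -chart_iter.
Qed.

Lemma chart_c w : chart w \in c.
Proof. by case: w => [|x w]; [exact: subspace0 | rewrite chartE]. Qed.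

Lemma frame_eq0 x n w : ((size w).+1 < n)%N -> frame chart x n w = 0.
Proof.
case: n => [|[|n]] //; elim: n w => [|n IH] w sw;
  rewrite frameS conv_eq0 ?subrr ?scaler0 // => u1 u2 e.
  case: u1 e => [|y u1] e; first by rewrite chart0 (bil0l lieP).
  by move: sw; rewrite -e.
case: u1 e => [|y u1] e; first by rewrite chart0 (bil0l lieP).
rewrite IH ?(bil0r lieP) //.
by move: sw; rewrite -e /=; lia.
Qed.

Lemma frame_sum N x w : ((size w).+2 <= N)%N ->
  \sum_(n < N) frame chart x n w = \sum_(n < (size w).+2) frame chart x n w.
Proof. move=> le; apply: (sum_widen (F := fun n => frame chart x n w)) => // i.
exact: frame_eq0. Qed.

(** The equation that characterizes the coordinate function: conjugation by e^(- chart)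
    maps d_x - x into d_x plus a function with values in s. *)
Lemma frame_sum_s N x w : ((size w).+2 <= N)%N ->
  \sum_(n < N) frame chart x n w \in s.
Proof.
move=> le; rewrite frame_sum //; apply: pc_eq0.
have /eqP := chartE x w; rewrite (linearBf pc_lin) pc_id ?chart_c //.
by rewrite -subr_eq0 opprB addrC subrK => /eqP.
Qed.

(** Uniqueness for the linearized equation.  Q is the expansion of
    (1 - e^(- ad chart)) / ad chart applied to f, with a shift of the degrees by one;
    its sum agrees with f on the shortest words on which f does not vanish, and there
    it is both in s and in c. *)
Lemma frame_unique (Q : nat -> seq g -> g) (f : seq g -> g) :
  (forall w, f w \in c) ->
  (forall w, Q 0%N w = 0) ->
  (forall n w, n.+1%:R *: Q n.+1 w = (if n is 0 then f w else 0) - br chart (Q n) w) ->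
  (forall w, exists2 N, (1 < N)%N & \sum_(n < N) Q n w \in s) ->
  forall w, f w = 0.
Proof.
move=> fc Q0 QS Qs w; have [m] := ubnP (size w); elim: m w => // m IH w sw.
have QSE n u : Q n.+1 u = n.+1%:R^-1 *: ((if n is 0 then f u else 0) - br chart (Q n) u).
  by rewrite -QS scalerA mulVf ?scale1r.
have Qlt n u : (size u < m)%N -> Q n u = 0.
  elim: n u => [|n IHn] u su //; rewrite QSE conv_eq0 ?subr0 => [|u1 u2 e].
    by case: n {IHn} => [|n]; rewrite ?scaler0 // IH // scaler0.
  by rewrite IHn ?(bil0r lieP) //; apply: leq_ltn_trans su; rewrite -e leq_addl.
have br0 n : br chart (Q n) w = 0.
  apply: conv_eq0 => -[|y u1] u2 e; first by rewrite chart0 (bil0l lieP).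
  rewrite Qlt ?(bil0r lieP) //; move: sw; rewrite -e /= addSn ltnS.
  by apply: leq_trans; rewrite ltnS leq_addl.
have [[|[|N]] // _] := Qs w; rewrite !big_ord_recl Q0 add0r big1 => [|i _].
  by rewrite addr0 QSE br0 subr0 invr1 scale1r => fs; apply: sc0.
by rewrite QSE br0 /= subr0 scaler0.
Qed.

Lemma chart_linear1 a x y w :
  chart ((a *: x + y) :: w) = a *: chart (x :: w) + chart (y :: w).
Proof.
apply/eqP; rewrite -subr_eq0; apply/eqP.
(* linearity of the frame in x, as the vanishing of the defect Q *)
pose Q n u := frame chart (a *: x + y) n u
              - (a *: frame chart x n u + frame chart y n u).
apply: (@frame_unique Q (fun w => chart ((a *: x + y) :: w)
  - (a *: chart (x :: w) + chart (y :: w)))) => [u|u|n u|u].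
- by apply: subspaceB => //; [|apply: subspaceD => //; first apply: subspaceZ => //];
    apply: chart_c.
- rewrite /Q /=; case: u => [|z u] /=; lmod k g.
- transitivity (n.+1%:R *: frame chart (a *: x + y) n.+1 u
      - (a *: (n.+1%:R *: frame chart x n.+1 u) + n.+1%:R *: frame chart y n.+1 u)).
    rewrite /Q; lmod k g.
  rewrite (frame_rec _ (a *: x + y)) (frame_rec _ x) (frame_rec _ y).
  have -> : br chart (Q n) u = br chart (frame chart (a *: x + y) n) u
    - (a *: br chart (frame chart x n) u + br chart (frame chart y n) u).
    by rewrite -(convZr lieP) -(convDr lieP) -(convNr lieP) -(convDr lieP).
  case: n => [|n]; lmod k g.
- exists (size u).+2 => //; rewrite /Q sumrB big_split -scaler_sumr /=.
  apply: subspaceB => //; first exact: frame_sum_s.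
  by apply: subspaceD => //; first apply: subspaceZ => //; apply: frame_sum_s.
Qed.

(** The Leibniz rule for - ad v, on the components of e^(- ad v) applied to sums of a
    function and a derivation; al and be are the derivatives of v along the two
    derivations, which enter in degree 1. *)
Lemma cauchy_bracket (v al be : seq g -> g) (X Y : nat -> seq g -> g) n u :
  (forall n w, n.+1%:R *: X n.+1 w = (if n is 0 then al w else 0) - br v (X n) w) ->
  (forall n w, n.+1%:R *: Y n.+1 w = (if n is 0 then be w else 0) - br v (Y n) w) ->
  n.+1%:R *: (\sum_(i < n.+2) br (X i) (Y (n.+1 - i)%N) u)
  = br al (Y n) u + br (X n) be u
    - br v (fun w => \sum_(i < n.+1) br (X i) (Y (n - i)%N) w) u.
Proof.
move=> XS YS; rewrite (conv_sumr lieP) scaler_sumr.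
have -> : \sum_(i < n.+2) n.+1%:R *: br (X i) (Y (n.+1 - i)%N) u
  = \sum_(i < n.+2) i%:R *: br (X i) (Y (n.+1 - i)%N) u
  + \sum_(i < n.+2) (n.+1 - i)%:R *: br (X i) (Y (n.+1 - i)%N) u.
  rewrite -big_split; apply: eq_bigr => i _ /=; rewrite -scalerDl -natrD subnKC //.
  by rewrite -ltnS.
rewrite big_ord_recl /= scale0r add0r.
rewrite [X in _ + X]big_ord_recr /= subnn scale0r addr0.
have -> : \sum_(i < n.+1) (lift ord0 i)%:R *: br (X (lift ord0 i)) (Y (n.+1 - lift ord0 i)%N) u
  = br al (Y n) u - \sum_(i < n.+1) br (br v (X i)) (Y (n - i)%N) u.
  rewrite -[br al _ _]addr0.
  have E (i : 'I_n.+1) : (lift ord0 i)%:R *: br (X (lift ord0 i)) (Y (n.+1 - lift ord0 i)%N) u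
    = (if val i is 0 then br al (Y n) u else 0) - br (br v (X i)) (Y (n - i)%N) u.
    rewrite lift0 subSS -(convZl lieP).
    have -> : (fun w => (val i).+1%:R *: X (val i).+1 w)
            = (fun w => (if val i is 0 then al w else 0) + - br v (X i) w).
      by apply: funext => w; apply: XS.
    rewrite (convDl lieP) (convNl lieP); congr (_ - _).
    by case: i => [[|i] /= _]; rewrite ?subn0 // (conv0l lieP).
  rewrite (eq_bigr _ (fun i _ => E i)) sumrB; congr (_ - _).
  by rewrite big_ord_recl /= big1.
have -> : \sum_(i < n.+1) (n.+1 - i)%:R *: br (X i) (Y (n.+1 - i)%N) u
  = br (X n) be u - \sum_(i < n.+1) br (X i) (br v (Y (n - i)%N)) u.
  have E (i : 'I_n.+1) : (n.+1 - i)%:R *: br (X i) (Y (n.+1 - i)%N) u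
    = (if (n - i)%N is 0 then br (X i) be u else 0) - br (X i) (br v (Y (n - i)%N)) u.
    rewrite (subSn (ltn_ord i : (i <= n)%N)) -(convZr lieP).
    have -> : (fun w => (n - i).+1%:R *: Y (n - i).+1 w)
            = (fun w => (if (n - i)%N is 0 then be w else 0) + - br v (Y (n - i)%N) w).
      by apply: funext => w; apply: YS.
    rewrite (convDr lieP) (convNr lieP); congr (_ - _).
    by case: (n - i)%N => [|j] //; rewrite (conv0r lieP).
  rewrite (eq_bigr _ (fun i _ => E i)) sumrB; congr (_ - _).
  rewrite big_ord_recr /= subnn big1 ?add0r // => i _.
  by rewrite -[(n - i)%N]prednK // subn_gt0.
have -> : \sum_(i < n.+1) br v (br (X i) (Y (n - i)%N)) u
  = \sum_(i < n.+1) br (br v (X i)) (Y (n - i)%N) u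
  + \sum_(i < n.+1) br (X i) (br v (Y (n - i)%N)) u.
  by rewrite -big_split; apply: eq_bigr => i _; apply: br_jacobi.
lmod k g.
Qed.

(** Flatness.  The commutator of the transforms of d_x - x and d_y - y is the transform
    of their commutator, and functions with values in s are stable under brackets and
    derivatives.  Adding the transform of d_[x, y] - [x, y] leaves the transform of
    d_x d_y - d_y d_x + d_[x, y], so the derivative of chart along this derivation solves
    the linearized equation.  The sign comes from the fact that the derivatives act on words by
    prefixing letters, which reverses their order. *)
Lemma chart_bracket1 x y w :
  chart [:: x, y & w] = chart [:: y, x & w] + chart (lie x y :: w).
Proof.
(* the transform of the commutator of d_x - x and d_y - y, without its derivation part *)
pose Z n u := \sum_(i < n.+1) br (frame chart x i) (frame chart y (n - i)%N) u
  + (frame chart y n (x :: u) - frame chart x n (y :: u)).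
pose Q n u := Z n u + frame chart (lie x y) n u.
pose f u := chart [:: y, x & u] - chart [:: x, y & u] + chart (lie x y :: u).
have : f w = 0.
  apply: (@frame_unique Q f) => [u|u|n u|u].
  - by apply: subspaceD => //; [apply: subspaceB => //|]; apply: chart_c.
  - rewrite /Q /Z big_ord_recl big_ord0 addr0 /= (convNl lieP) (convNr lieP).
    rewrite (conv_constl _ _ _ lieP) /=; case: u => [|z u] /=; rewrite ?(bil0r lieP).
      by rewrite !oppr0 !addr0 opprK subrr.
    by rewrite !oppr0 !addr0.
  - transitivity (n.+1%:R *: (\sum_(i < n.+2) br (frame chart x i) (frame chart y (n.+1 - i)%N) u)
      + (n.+1%:R *: frame chart y n.+1 (x :: u) - n.+1%:R *: frame chart x n.+1 (y :: u))
      + n.+1%:R *: frame chart (lie x y) n.+1 u).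
      rewrite /Q /Z; lmod k g.
    rewrite (cauchy_bracket _ _ (frame_rec chart x) (frame_rec chart y)).
    rewrite (frame_rec _ x) (frame_rec _ y) (frame_rec _ (lie x y)) /=.
    have -> : br chart (Q n) u
      = br chart (fun w0 => \sum_(i < n.+1) br (frame chart x i) (frame chart y (n - i)%N) w0) u
      + (br chart (fun w => frame chart y n (x :: w)) u
         - br chart (fun w => frame chart x n (y :: w)) u)
      + br chart (frame chart (lie x y) n) u.
      by rewrite -(convNr lieP) -!(convDr lieP).
    rewrite (br_anti (frame chart x n)) /f.
    case: n => [|n]; lmod k g.
  - pose m := (size u).+3; exists (m + m)%N => //.
    have sT : \sum_(n < m + m) \sum_(i < n.+1) br (frame chart x i) (frame chart y (n - i)%N) u
      = br (fun w => \sum_(i < m) frame chart x i w)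
           (fun w => \sum_(i < m) frame chart y i w) u.
      have -> := @cauchy_square _ (fun i j => br (frame chart x i) (frame chart y j) u) m.
        by rewrite (conv_suml lieP); apply: eq_bigr => i _; rewrite (conv_sumr lieP).
      move=> i j ij; apply: conv_eq0 => u1 u2 e; move: ij; rewrite /m => /orP[] le.
        rewrite frame_eq0 ?(bil0l lieP) //; apply: leq_trans le.
        by apply: leqW; rewrite !ltnS -e leq_addr.
      rewrite [X in lie _ X]frame_eq0 ?(bil0r lieP) //; apply: leq_trans le.
      by apply: leqW; rewrite !ltnS -e leq_addl.
    rewrite /Q /Z !big_split sT sumrN /=.
    apply: subspaceD => //; last by apply: frame_sum_s; rewrite /m; lia.
    apply: subspaceD => //; last first.
      by apply: subspaceB => //; apply: frame_sum_s; rewrite /m /=; lia.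
    apply: (@conv_mem _ _ predT); rewrite ?all_predT // => u1 u2 _ _ e.
    have s1 : (size u1 <= size u)%N by rewrite -e leq_addr.
    have s2 : (size u2 <= size u)%N by rewrite -e leq_addl.
    by apply: sL; apply: frame_sum_s; rewrite /m; apply: leqW.
by move=> /eqP; rewrite /f addrAC subr_eq0 => /eqP <-.
Qed.

(** Relations at the start of a word propagate to the inside of all words, because the
    equation expresses the value on z :: w by convolutions of values on shorter words. *)
Lemma chart_kills p Om n :
  primitive_comb p -> (forall w, Om || nilp w -> wder p chart w = 0) ->
  kills p Om n chart.
Proof.
move=> pP base; elim: n => [|n Kn] [|z w1] w2 O sw //; first exact: base.
case: n => [|n] in Kn sw *; first by [].
have F0 m : kills p Om m (frame chart z 0).
  apply: (kills_lin (al := -%R)) (kills_const z pP).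
  by move=> a x y; rewrite opprD scalerN.
have F1 : kills p Om n (frame chart z 1).
  have -> : frame chart z 1 = fun w =>
      (- 1) *: br chart (frame chart z 0) w + chart (z :: w).
    by apply: funext => w; rewrite frameS invr1 scale1r scaleN1r addrC.
  apply: kills_linear; last exact: kills_tail.
  by apply: kills_conv => //; apply: kills_leq Kn.
have F2 m : kills p Om n.+1 (frame chart z m.+2).
  have step j : kills p Om n (frame chart z j.+1) -> kills p Om n.+1 (frame chart z j.+2).
    move=> Kj; have -> : frame chart z j.+2 = fun w =>
      (- j.+2%:R^-1) *: br chart (frame chart z j.+1) w + 0.
      by apply: funext => w; rewrite frameS sub0r addr0 scaleNr scalerN.
    apply: kills_linear; first exact: kills_conv_strict.
    by move=> v1 v2 _ _; rewrite /wder big1 // => q _; rewrite scaler0.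
  by elim: m => [|m IH]; apply: step => //; apply: kills_leq IH.
have sw' : (size w1 + size w2 < n.+1)%N by rewrite -ltnS.
pose N := (\max_(q <- p) size (w1 ++ q.2 ++ w2))%N.
apply: sc0; last first.
  by apply: subspace_sum => // q _; apply: subspaceZ => //; apply: chart_c.
suff <- : wder p (fun u => \sum_(m < N.+2) frame chart z m (w1 ++ u)) w2
        = wder p (fun u => chart ((z :: w1) ++ u)) w2.
  rewrite /wder big_seq; apply: subspace_sum => // q qp; apply: subspaceZ => //.
  by apply: frame_sum_s; rewrite !ltnS /N; apply: (leq_bigmax_seq (F := fun q => size (w1 ++ q.2 ++ w2))).
transitivity (\sum_(m < N.+2) wder p (fun u => frame chart z m (w1 ++ u)) w2).
  by rewrite /wder exchange_big; apply: eq_bigr => q _; rewrite scaler_sumr.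
rewrite !big_ord_recl big1 => [|i _]; last exact: (F2 i).
rewrite (F0 n.+1) // add0r addr0.
transitivity (wder p (fun u => chart ((z :: w1) ++ u)) w2
              - wder p (fun u => br chart (frame chart z 0) (w1 ++ u)) w2).
  rewrite /wder -sumrB; apply: eq_bigr => q _.
  by rewrite [frame chart z _ _]frameS invr1 scale1r scalerBr.
by rewrite [X in _ - X](kills_conv lieP pP Kn (F0 n.+1)) // subr0.
Qed.

Lemma chart_linear w1 w2 : linear (fun x => chart (w1 ++ x :: w2)).
Proof.
move=> a x y; have := @chart_kills _ true (size w1 + size w2).+1 (lin_primitive a x y).
move=> /(_ _ w1 w2 isT (ltnSn _)); rewrite /wder /lin_comb !big_cons big_nil /= addr0.
move=> H; apply/eqP; rewrite -subr_eq0; apply/eqP; rewrite -[RHS]H => [|w _].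
  lmod k g.
rewrite /wder !big_cons big_nil /= addr0 chart_linear1; lmod k g.
Qed.

Lemma chart_bracket x y w1 w2 :
  chart (w1 ++ [:: x, y & w2])
  = chart (w1 ++ [:: y, x & w2]) + chart (w1 ++ lie x y :: w2).
Proof.
have := @chart_kills _ true (size w1 + size w2).+1 (brk_primitive x y).
move=> /(_ _ w1 w2 isT (ltnSn _)); rewrite /wder /brk_comb !big_cons big_nil /= addr0.
move=> H; apply/eqP; rewrite -subr_eq0; apply/eqP; rewrite -[RHS]H => [|w _].
  lmod k g.
rewrite /wder !big_cons big_nil /= addr0 chart_bracket1; lmod k g.
Qed.

Lemma chart_single x : chart [:: x] = pc x.
Proof.
have := chartE x [::]; rewrite !big_ord_recl big_ord0 /= (bil0l lieP) invr1 scale1r.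
by move=> ->; rewrite subr0 addr0 opprD opprK addrCA subrr addr0.
Qed.

Lemma chart_end d w : d \in s -> chart (rcons w d) = 0.
Proof.
move=> sd; have := @chart_kills _ false (size w).+1 (end_primitive d).
move=> /(_ _ w [::] isT); rewrite addn0 /wder big_cons big_nil addr0 scale1r cats1.
apply=> // u /nilP ->; rewrite /wder big_cons big_nil addr0 scale1r.
by rewrite chart_single pc0s.
Qed.

(** Along the line through x the coordinate of e^(t x) S is t x. *)
Lemma chart_nseq n x : x \in c -> chart (nseq n x) = if n == 1%N then x else 0.
Proof.
move=> cx; suff: forall j, (j <= n)%N -> chart (nseq j x) = if j == 1%N then x else 0.
  by apply.
elim: n => [[]//|n IH] j; rewrite leq_eqVlt => /orP[/eqP ->|]; last exact: IH.
have lie1 : forall m, (m <= n)%N -> lie (chart (nseq m x)) x = 0.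
  by move=> m le; rewrite IH //; case: eqP => _; rewrite ?liexx ?(bil0l lieP).
have F1 m : (m <= n)%N -> frame chart x 1 (nseq m x) = chart (nseq m.+1 x).
  move=> le; rewrite frameS invr1 scale1r (convNr lieP) (conv_constr _ _ _ lieP).
  by rewrite lie1 // oppr0 subr0.
have F2 m b : (b <= n)%N -> frame chart x m.+2 (nseq b x) = 0.
  have step i : (forall a, (a < n)%N -> lie x (frame chart x i.+1 (nseq a x)) = 0) ->
      forall b, (b <= n)%N -> frame chart x i.+2 (nseq b x) = 0.
    move=> Hi e le; rewrite frameS sub0r; apply/eqP.
    rewrite scaler_eq0 oppr_eq0; apply/orP; right.
    apply: (@conv_mem _ _ (pred1 x) _ _ _ _ (pred1 0)).
    - by split=> [|z u v]; rewrite !inE // => /eqP-> /eqP->; rewrite scaler0 addr0.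
    - by rewrite all_pred1_nseq.
    move=> u1 u2 /all_pred1P -> /all_pred1P -> /[!(size_nseq, inE)] sz.
    have le1 : (size u1 <= n)%N by apply: leq_trans le; rewrite -sz leq_addr.
    rewrite IH //; case: (size u1 =P 1%N) => [e1|_]; last by rewrite (bil0l lieP).
    by rewrite Hi // (leq_trans _ le) // -sz e1.
  elim: m b => [|m IHm]; apply: step => a lt; last by rewrite IHm ?(bil0r lieP) // ltnW.
  by rewrite F1 1?ltnW // lie_anti lie1 ?oppr0.
have := @frame_sum_s (size (nseq n x)).+2 x (nseq n x) (leqnn _).
rewrite !big_ord_recl big1 => [|i _]; last exact: F2.
rewrite F1 // addr0 => cs; apply/eqP; rewrite -subr_eq0; apply/eqP; apply: sc0; last first.
  by apply: subspaceB => //; [apply: chart_c | case: eqP => _ //; apply: subspace0].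
by move: cs; case: (n) => [|n'] /=; rewrite ?subr0 ?oppr0 ?add0r 1?addrC.
Qed.
End Chart.

(** * Linear maps on U(g) with prescribed values on powers *)

Lemma env_mul_bil (k : fieldType) (g : lieAlgType k) :
  bilinear_map ( *%R : env g -> env g -> env g).
Proof. exact: env_mul_bilinear. Qed.

Lemma env_word_cat (k : fieldType) (g : lieAlgType k) (w w' : seq g) :
  env_word (w ++ w') = env_word w * env_word w'.
Proof. by rewrite -env_mulE. Qed.

Lemma env_word_nseq (k : fieldType) (g : lieAlgType k) n (x : g) :
  env_word (nseq n x) = env_gen x ^+ n.
Proof.
by elim: n => [|n IH] //; rewrite exprS -IH -env_word_cat.
Qed.

(** The words in one letter x form the divided power coalgebra of a line, on which f is
    a linear function. *)
Lemma conv_nseq (k : fieldType) (X : eqType) (V1 V2 V : lmodType k)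
    (B : V1 -> V2 -> V) (f : seq X -> V1) h x y n :
  bilinear_map B -> (forall m, f (nseq m x) = if m == 1%N then y else 0) ->
  conv B f h (nseq n x) = n%:R *: B y (h (nseq n.-1 x)).
Proof.
move=> BP fE; elim: n h => [|n IH] h /=.
  by rewrite (fE 0%N) (bil0l BP) scale0r.
have -> : conv B (fun u => f (x :: u)) h (nseq n x) = B y (h (nseq n x)).
  rewrite -(conv_constl y h (nseq n x) BP).
  apply: (@conv_ext _ _ (pred1 x)); first by rewrite all_pred1_nseq.
  move=> u1 u2 /all_pred1P -> _ _; rewrite (fE (size u1).+1).
  by case: u1.
rewrite IH; case: n {IH} => [|n] /=; first by rewrite scale0r addr0 scale1r.
by rewrite -{1}[B y _]scale1r -scalerDl nat1r.
Qed.

Section ConvolutionExponential.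
Variables (k : fieldType) (X : eqType) (A : lmodType k).
Variables (mul : A -> A -> A) (one : A).
Hypothesis mulP : bilinear_map mul.
Variable f : seq X -> A.
Hypothesis f0 : f [::] = 0.

Fixpoint cpow (m : nat) : seq X -> A :=
  if m is m'.+1 then conv mul f (cpow m') else wconst one.

(** The convolution exponential of f.  The powers of exponent larger than the number of
    letters vanish, because f vanishes on the empty word. *)
Definition cexp (w : seq X) : A := \sum_(m < (size w).+1) (m`!%:R)^-1 *: cpow m w.

Lemma cpow_eq0 m w : (size w < m)%N -> cpow m w = 0.
Proof.
elim: m w => [|m IH] w sw //=; apply: conv_eq0 => -[|x u1] u2 e.
  by rewrite f0 (bil0l mulP).
rewrite IH ?(bil0r mulP) //; apply: leq_trans (_ : size w <= m)%N => //.
by rewrite -e /= ltnS leq_addl.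
Qed.

Lemma cexpE N w : (size w < N)%N -> cexp w = \sum_(m < N) (m`!%:R)^-1 *: cpow m w.
Proof.
move=> sw; apply/esym/(sum_widen (F := fun m => (m`!%:R)^-1 *: cpow m w)) => // i.
by move=> lt; rewrite cpow_eq0 // scaler0.
Qed.

Lemma cexp_kills p Om n :
  primitive_comb p -> (forall m, kills p Om m f) -> kills p Om n cexp.
Proof.
move=> pP Kf w1 w2 O _.
have Km m j : kills p Om j (cpow m).
  elim: m j => [|m IH] j; first exact: kills_const.
  exact: kills_conv (Kf _) (IH _).
pose N := (\max_(q <- p) size (w1 ++ q.2 ++ w2))%N.
transitivity (\sum_(m < N.+1) (m`!%:R)^-1 *: wder p (fun u => cpow m (w1 ++ u)) w2).
  transitivity (\sum_(q <- p) \sum_(m < N.+1)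
      q.1 *: ((m`!%:R)^-1 *: cpow m (w1 ++ q.2 ++ w2))).
    rewrite /wder !big_seq; apply: eq_bigr => q qp; rewrite (@cexpE N.+1) ?scaler_sumr //.
    by rewrite ltnS; apply: (leq_bigmax_seq (F := fun q => size (w1 ++ q.2 ++ w2))).
  rewrite exchange_big; apply: eq_bigr => m _; rewrite /wder scaler_sumr.
  by apply: eq_bigr => q _; rewrite !scalerA mulrC.
by rewrite big1 // => m _; rewrite (Km m (size w1 + size w2).+1) ?scaler0.
Qed.
End ConvolutionExponential.

Section SymmetricExtension.
Variables (k : fieldType) (g : lieAlgType k).
Hypothesis char0 : forall n, n.+1%:R != 0 :> k.
Variables (s c : {pred g}) (pc : g -> g).
Hypotheses (sP : submod_closed s) (sL : {in s &, forall x y, lie x y \in s}).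
Hypotheses (cP : submod_closed c) (pc_lin : linear pc).
Hypotheses (pc_c : forall x, pc x \in c) (pc_s : forall x, x - pc x \in s).
Hypothesis sc0 : forall x, x \in s -> x \in c -> x = 0.

Lemma fact_neq0 n : n`!%:R != 0 :> k.
Proof. by rewrite -(prednK (fact_gt0 n)). Qed.

(** The convolution exponential of al composed with the coordinate function of the
    triple; in terms of groups, e^c S |-> e^(al c). *)
Lemma symmetric_extension (al : g -> env g) : linear al ->
  exists kap : env g -> env g,
    [/\ linear kap,
        (forall u d, d \in s -> kap (u * env_gen d) = 0)
      & (forall x n, x \in c -> kap (env_gen x ^+ n) = al x ^+ n)].
Proof.
move=> al_lin; pose f w := al (chart pc w).
have f0 : f [::] = 0 by rewrite /f chart0 (linear0f al_lin).
have mulP := env_mul_bil g.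
have f_lin w1 w2 : linear (fun x => f (w1 ++ x :: w2)).
  by move=> a x y; rewrite /f (chart_linear char0 sP cP pc_lin pc_c pc_s sc0) al_lin.
have f_brk x y w1 w2 :
    f (w1 ++ [:: x, y & w2]) = f (w1 ++ [:: y, x & w2]) + f (w1 ++ lie x y :: w2).
  by rewrite /f -(linearDf al_lin) -(chart_bracket char0 sP sL cP pc_lin pc_c pc_s sc0).
have f_end d w : d \in s -> f (rcons w d) = 0.
  by move=> sd; rewrite /f (chart_end sP cP pc_lin pc_c pc_s sc0) //.
pose E := cexp *%R 1 f.
have E_lin w1 w2 : linear (fun x => E (w1 ++ x :: w2)).
  move=> a x y; apply/eqP; rewrite -subr_eq0; apply/eqP.
  have := @cexp_kills _ _ _ _ 1 mulP f f0 _ true (size w1 + size w2).+1 (lin_primitive a x y).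
  move=> /(_ _ w1 w2 isT (ltnSn _)) <- => [|m u1 u2 _ _];
    rewrite /wder !big_cons big_nil /=; first lmod k (env g).
  rewrite f_lin; lmod k (env g).
have E_brk x y w1 w2 :
    E (w1 ++ [:: x, y & w2]) = E (w1 ++ [:: y, x & w2]) + E (w1 ++ lie x y :: w2).
  apply/eqP; rewrite -subr_eq0; apply/eqP.
  have := @cexp_kills _ _ _ _ 1 mulP f f0 _ true (size w1 + size w2).+1 (brk_primitive x y).
  move=> /(_ _ w1 w2 isT (ltnSn _)) <- => [|m u1 u2 _ _];
    rewrite /wder !big_cons big_nil /=; first lmod k (env g).
  rewrite f_brk; lmod k (env g).
exists (env_lift E); split; first exact: env_lift_linear.
- move=> u d sd; move: u; apply: (env_linear_eq (h := fun=> 0)).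
  + apply: linear_comp (env_lift_linear E_lin E_brk) _; exact: mulP.1.
  + by move=> a x y; rewrite scaler0 addr0.
  move=> w; rewrite -env_word_cat env_liftE // cats1.
  have := @cexp_kills _ _ _ _ 1 mulP f f0 _ false (size w).+1 (end_primitive d).
  move=> /(_ _ w [::] isT); rewrite addn0 /wder big_cons big_nil addr0 scale1r cats1.
  apply=> // m u1 u2 /nilP -> _; rewrite /wder big_cons big_nil addr0 scale1r cats1.
  exact: f_end.
- move=> x n cx; rewrite -env_word_nseq env_liftE //.
  have fn m : f (nseq m x) = if m == 1%N then al x else 0.
    rewrite /f (chart_nseq cP pc_lin pc_c pc_s sc0) //.
    by case: eqP => // _; apply: linear0f al_lin.
  have pE m j : cpow *%R 1 f m (nseq j x) = if m == j then m`!%:R *: al x ^+ m else 0.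
    elim: m j => [|m IH] [|j] //=; rewrite ?scale1r //.
      by rewrite f0 mul0r.
    rewrite [LHS](conv_nseq (cpow *%R 1 f m) j.+1 mulP fn) /= IH eqSS.
    case: eqP => [->|_]; last by rewrite mulr0 scaler0.
    by rewrite -scalerAr scalerA -exprS factS natrM.
  rewrite /E /cexp size_nseq big_ord_recr /= pE eqxx scalerA mulVf ?fact_neq0 // scale1r.
  rewrite big1 ?add0r // => i _; rewrite pE ltn_eqF ?scaler0 //.
Qed.
End SymmetricExtension.

(** * Polarization *)

(** Expand the product over D of 1 - 1. *)
Lemma alternating_subsets (R : comNzRingType) (I : finType) (D : {set I}) :
  \sum_(J : {set I} | J \subset D) (-1) ^+ #|J| = (D == set0)%:R :> R.
Proof.
transitivity (\prod_(i : I) ((if i \in D then -1 else 0) + 1 : R)).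
  rewrite bigA_distr [RHS](bigID (fun J : {set I} => J \subset D)) /= [X in _ = _ + X]big1 ?addr0.
    apply: eq_bigr => J sJD; rewrite -big_mkcond /= -prodr_const.
    by apply: eq_bigr => i /(subsetP sJD) ->.
  move=> J /subsetPn [i iJ iD]; rewrite (bigD1 i) //= iJ (negbTE iD); exact: mul0r.
have [->|/set0Pn [i iD]] := eqVneq D set0.
  by rewrite big1 // => i _; rewrite inE add0r.
by rewrite (bigD1 i) //= iD addNr mul0r.
Qed.

(** Inclusion-exclusion: the power of the sum over B is the sum of the words with letters
    in B, and the signs cancel all the words in which some letter is missing. *)
Lemma polarization (R : nzRingType) n (x : 'I_n -> R) :
  \sum_(sigma : 'S_n) \prod_(i < n) x (sigma i)
  = \sum_(B : {set 'I_n}) (-1) ^+ #|~: B| * (\sum_(i in B) x i) ^+ n.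
Proof.
pose P (f : {ffun 'I_n -> 'I_n}) := \prod_(i < n) x (f i).
have pw (B : {set 'I_n}) :
    (\sum_(i in B) x i) ^+ n = \sum_(f in ffun_on (mem B)) P f.
  transitivity (\prod_(i < n) \sum_(j in B) x j); first by rewrite prodr_const card_ord.
  exact: (bigA_distr_big (mem B) (fun _ j => x j)).
under [RHS]eq_bigr do rewrite pw mulr_sumr.
rewrite (exchange_big_dep xpredT) //=.
transitivity (\sum_(f : {ffun 'I_n -> 'I_n}) (f @: 'I_n == setT)%:R * P f); last first.
  apply: eq_bigr => f _; rewrite -mulr_suml; congr (_ * _).
  transitivity ((\sum_(J : {set 'I_n} | J \subset ~: (f @: 'I_n)) (-1) ^+ #|J| : int)%:~R : R).
    by rewrite alternating_subsets -setCT (inj_eq (can_inj (@setCK _))); case: eqP.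
  rewrite (reindex_inj (can_inj (@setCK _))) rmorph_sum /=.
  apply: eq_big => [B|B _]; last by rewrite rmorph_sign.
  rewrite setCS; apply/subsetP/ffun_onP => [H i|H j /imsetP [i _ ->]]; last exact: H.
  by apply: H; apply: imset_f.
rewrite (bigID (fun f : {ffun 'I_n -> 'I_n} => f @: 'I_n == setT)) /= [X in _ + X]big1 ?addr0.
  rewrite (reindex (fun s : 'S_n => pval s)) /=.
    apply: eq_big => [s|s _]; last first.
      suff -> : pval s @: 'I_n = setT by rewrite eqxx mul1r /P -pvalE.
      apply/eqP; rewrite eqEcard subsetT cardsT card_imset ?card_ord ?leqnn //.
      by move=> i j e; apply: (@perm_inj _ s); rewrite -!pvalE.
    apply/esym/eqP/eqP; rewrite eqEcard subsetT cardsT card_imset ?card_ord ?leqnn //.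
    by move=> i j e; apply: (@perm_inj _ s); rewrite -!pvalE.
  exists (insubd (1%g : 'S_n)) => [s _|f /eqP fT]; first exact: valKd.
  apply: insubdK; apply/injectiveP => i j.
  suff /imset_injP inj : #|f @: 'I_n| == #|'I_n| by apply: inj.
  by rewrite fT cardsT.
by move=> f /negbTE ->; rewrite mul0r.
Qed.

(** * Products of powers span U(g) *)

Section Span.
Variables (k : fieldType) (V : lmodType k) (G : V -> Prop).

Lemma span_closed : submod_closed (span_pred G).
Proof. exact: span_submod_closed. Qed.

Lemma span_ind (S : {pred V}) : submod_closed S -> (forall x, G x -> x \in S) ->
  forall x, x \in span_pred G -> x \in S.
Proof. by move=> SP GS x /span_predP; apply. Qed.

Lemma eq_on_span (W : lmodType k) (f h : V -> W) : linear f -> linear h ->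
  (forall x, G x -> f x = h x) -> forall x, x \in span_pred G -> f x = h x.
Proof.
move=> lf lh e x xG; apply/eqP; apply: (@span_ind [pred x | f x == h x]) xG => [|y Gy].
  split=> [|a u v]; first by rewrite inE (linear0f lf) (linear0f lh).
  by rewrite !inE lf lh => /eqP -> /eqP ->.
by rewrite inE; apply/eqP/e.
Qed.
End Span.

Section EnvSpan.
Variables (k : fieldType) (g : lieAlgType k).
Implicit Types (x y : g) (w p : seq g).

Lemma env_word_prod w : env_word w = \prod_(x <- w) env_gen x.
Proof.
by elim: w => [|x w IH]; rewrite ?big_nil // big_cons -IH -env_word_cat.
Qed.

Definition is_power (c : {pred g}) (u : env g) : Prop :=
  exists x n, x \in c /\ u = env_gen x ^+ n.
Definition sym_space (c : {pred g}) := span_pred (is_power c).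

Lemma sym_product_mem (c : {pred g}) n (x : 'I_n -> g) : submod_closed c ->
  (forall i, x i \in c) ->
  \sum_(sigma : 'S_n) \prod_(i < n) env_gen (x (sigma i)) \in sym_space c.
Proof.
move=> cP xc; rewrite (polarization (fun i => env_gen (x i))).
apply: (subspace_sum (span_closed _)) => B _.
rewrite -linear_sumf; last exact: env_gen_linear.
set z := env_gen _ ^+ n.
have zS : z \in sym_space c.
  by apply: mem_span; exists (\sum_(i in B) x i), n; split=> //; apply: subspace_sum.
rewrite -signr_odd; case: odd; rewrite ?expr0 ?mul1r // mulN1r.
exact: (subspaceN (span_closed _)).
Qed.

Hypothesis char0 : forall n, n.+1%:R != 0 :> k.
Variables (s c : {pred g}).
Hypotheses (sP : submod_closed s) (cP : submod_closed c).
Hypothesis sc : forall x, exists y z, [/\ y \in s, z \in c & x = y + z].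

Definition is_power2 (u : env g) : Prop :=
  exists x m y n, [/\ x \in c, y \in s & u = env_gen x ^+ m * env_gen y ^+ n].
Definition pow2_space := span_pred is_power2.

Lemma pow2_closed : submod_closed pow2_space.
Proof. exact: span_closed. Qed.

Lemma sym_mul_mem u v : u \in sym_space c -> v \in sym_space s -> u * v \in pow2_space.
Proof.
move=> uc vs; apply: (@span_ind _ _ _ [pred u | u * v \in pow2_space]) uc.
  split=> [|a u1 u2]; first by rewrite inE mul0r subspace0 //; apply: pow2_closed.
  by rewrite !inE mulrDl -scalerAl; apply: pow2_closed.2.
move=> _ [x [m [xc ->]]]; rewrite inE.
apply: (@span_ind _ _ _ [pred v | env_gen x ^+ m * v \in pow2_space]) vs.
  split=> [|a u1 u2]; first by rewrite inE mulr0 subspace0 //; apply: pow2_closed.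
  by rewrite !inE mulrDr -scalerAr; apply: pow2_closed.2.
by move=> _ [y [n [ys ->]]]; rewrite inE; apply: mem_span; exists x, m, y, n.
Qed.

Section Induction.
Variable N : nat.
Hypothesis IHN : forall w, (size w < N)%N -> env_word w \in pow2_space.

(** Moving a letter creates only commutators, that is shorter words. *)
Lemma word_move p w1 x w2 : size (p ++ w1 ++ x :: w2) = N ->
  env_word (p ++ w1 ++ x :: w2) - env_word (p ++ x :: w1 ++ w2) \in pow2_space.
Proof.
elim/last_ind: w1 w2 => [|w1 y IH] w2 sz; first by rewrite subrr subspace0 //; apply: pow2_closed.
rewrite -cats1 -!catA /= catA env_word_bracket addrAC; apply: (subspaceD pow2_closed).
  by rewrite -catA; apply: IH; rewrite -sz -cats1 !size_cat /= ?size_cat /=; lia.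
by apply: IHN; rewrite -sz -cats1 !size_cat /= ?size_cat /=; lia.
Qed.

Lemma word_perm p w w' : perm_eq w w' -> size (p ++ w) = N ->
  env_word (p ++ w) - env_word (p ++ w') \in pow2_space.
Proof.
elim: w p w' => [|x w IH] p w' pe sz.
  have -> : w' = [::] by apply/perm_nilP; rewrite perm_sym.
  by rewrite subrr subspace0 //; apply: pow2_closed.
have xw' : x \in w' by rewrite -(perm_mem pe) mem_head.
case/splitPr: xw' => w1 w2 in pe *.
have pe' : perm_eq w (w1 ++ w2).
  by rewrite -(perm_cons x) (perm_trans pe) // -cat1s perm_catCA.
have := word_move (p := p) (w1 := w1) (x := x) (w2 := w2).
move=> /(_ _); rewrite -(perm_size (perm_cat (perm_refl p) pe)) => /(_ sz) H.
have {IH} := IH (rcons p x) _ pe'; rewrite -cats1 -!catA => /(_ sz) H'.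
have := subspaceB pow2_closed H' H.
by rewrite opprB addrA subrK.
Qed.
End Induction.

Lemma word_sym_sum (w : seq g) :
  \sum_(sigma : 'S_(size w)) env_word [seq tnth (in_tuple w) (sigma i) | i <- enum 'I_(size w)]
  = \sum_(sigma : 'S_(size w)) \prod_(i < size w) env_gen (tnth (in_tuple w) (sigma i)).
Proof. apply: eq_bigr => sg _; rewrite env_word_prod.
rewrite -[map _ _]/(tval [tuple tnth (in_tuple w) (sg i) | i < size w]) big_tuple.
by apply: eq_bigr => i _; rewrite tnth_mktuple. Qed.

(** By induction on the length.  Up to shorter words the letters of a word commute, so
    those in c can be put in front of those in s, and both blocks can be replaced by
    the averages of their permutations, which are combinations of powers. *)
Lemma word_pow2 w : env_word w \in pow2_space.
Proof.
have P2 := pow2_closed.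
have [N] := ubnP (size w); elim: N w => // N IH w; rewrite ltnS leq_eqVlt.
case/orP => [/eqP sz|]; last exact: IH.
have sorted_case w1 w2 : size (w1 ++ w2) = N -> {subset w1 <= c} -> {subset w2 <= s} ->
    env_word (w1 ++ w2) \in pow2_space.
  move=> sz12 w1c w2s.
  pose r (v : seq g) (sg : 'S_(size v)) := [seq tnth (in_tuple v) (sg i) | i <- enum 'I_(size v)].
  have rP v sg : perm_eq v (r v sg).
    rewrite perm_sym; apply: (introT (@tuple_permP _ _ (r v sg) (in_tuple v))); by exists sg.
  have fN n : n`!%:R != 0 :> k by apply: fact_neq0.
  pose F := ((size w1)`! * (size w2)`!)%:R : k.
  have F0 : F != 0 by rewrite /F natrM mulf_neq0.
  suff FS : F *: env_word (w1 ++ w2) \in pow2_space.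
    by rewrite -[env_word _]scale1r -(mulVf F0) -scalerA subspaceZ.
  pose S := \sum_(sg : 'S_(size w1)) \sum_(sg' : 'S_(size w2)) env_word (r w1 sg ++ r w2 sg').
  have SP : S \in pow2_space.
    have -> : S = (\sum_sg env_word (r w1 sg)) * (\sum_sg env_word (r w2 sg)).
      rewrite mulr_suml; apply: eq_bigr => sg _; rewrite mulr_sumr.
      by apply: eq_bigr => sg' _; rewrite env_word_cat.
    rewrite /r !word_sym_sum; apply: sym_mul_mem; apply: sym_product_mem => // i.
      by apply: w1c; apply: mem_tnth.
    by apply: w2s; apply: mem_tnth.
  rewrite -(subrK S (F *: _)); apply: (subspaceD P2) SP.
  have -> : F *: env_word (w1 ++ w2) - S =
      \sum_(sg : 'S_(size w1)) \sum_(sg' : 'S_(size w2))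
        (env_word (w1 ++ w2) - env_word (r w1 sg ++ r w2 sg')).
    under eq_bigr do rewrite sumrB sumr_const; rewrite sumrB sumr_const -mulrnA /F.
    by rewrite scaler_nat !card_Sn mulnC.
  apply: (subspace_sum P2) => sg _; apply: (subspace_sum P2) => sg' _.
  by apply: (@word_perm N IH [::]); rewrite ?perm_cat.
have letters_case v : size v = N -> all [pred x | (x \in c) || (x \in s)] v ->
    env_word v \in pow2_space.
  move=> szv /allP vcs.
  have pv : perm_eq v (filter (mem c) v ++ filter (predC (mem c)) v).
    by rewrite perm_sym; apply/permPl/perm_filterC.
  have szf : size (filter (mem c) v ++ filter (predC (mem c)) v) = N.
    by rewrite -(perm_size pv).
  rewrite -(subrK (env_word (filter (mem c) v ++ filter (predC (mem c)) v)) (env_word v)).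
  apply: (subspaceD P2); first exact: (@word_perm N IH [::]).
  apply: sorted_case => // x; rewrite mem_filter => /andP [xc xv] //.
  by case/orP: (vcs x xv) => // xc'; case/negP: xc.
suff: forall p v, all [pred x | (x \in c) || (x \in s)] p -> size (p ++ v) = N ->
  env_word (p ++ v) \in pow2_space by move=> /(_ [::] w isT sz).
move=> p v; elim: v p => [|x v IHv] p pcs szp; first by rewrite cats0 in szp *; apply: letters_case.
have [y [z [ys zc ->]]] := sc x.
have -> : env_word (p ++ (y + z) :: v) = env_word (p ++ y :: v) + env_word (p ++ z :: v).
  exact: (linearDf (env_word_linear p v)).
have szr t : size (rcons p t ++ v) = N by rewrite -szp cat_rcons !size_cat.
by apply: (subspaceD P2); rewrite -cat_rcons; apply: IHv => //; rewrite all_rcons pcs /= ?ys ?zc ?orbT.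
Qed.

Lemma pow2_spanning u : u \in pow2_space.
Proof.
rewrite -[u]subr0; apply/clsP; have l := cls_linear is_power2.
rewrite (linear0f l); move: u; apply: (env_linear_eq (h := fun=> 0)) => // [a x y|w].
  by rewrite scaler0 addr0.
rewrite -(linear0f l); apply/clsP; rewrite subr0; exact: word_pow2.
Qed.

Lemma env_linear_eq_pow2 (W : lmodType k) (f h : env g -> W) : linear f -> linear h ->
  (forall x m y n, x \in c -> y \in s ->
     f (env_gen x ^+ m * env_gen y ^+ n) = h (env_gen x ^+ m * env_gen y ^+ n)) ->
  f =1 h.
Proof.
move=> lf lh e u; apply: (eq_on_span lf lh _ (pow2_spanning u)).
by move=> _ [x [m [y [n [xc ys ->]]]]]; apply: e.
Qed.
End EnvSpan.

(** * Symmetric elements of U(g) *)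

(** The derivative of a Cauchy product, for sequences of divided powers. *)
Lemma cauchy_derive (k : fieldType) (V : lmodType k) (F : nat -> nat -> V) n :
  \sum_(i < n.+1) (i.+1%:R *: F i.+1 (n - i)%N + (n - i).+1%:R *: F i (n - i).+1)
  = n.+1%:R *: \sum_(i < n.+2) F i (n.+1 - i)%N.
Proof.
have -> : n.+1%:R *: \sum_(i < n.+2) F i (n.+1 - i)%N
  = \sum_(i < n.+2) i%:R *: F i (n.+1 - i)%N
  + \sum_(i < n.+2) (n.+1 - i)%:R *: F i (n.+1 - i)%N.
  rewrite scaler_sumr -big_split; apply: eq_bigr => i _ /=.
  by rewrite -scalerDl -natrD subnKC // -ltnS.
rewrite big_split /=; congr (_ + _).
  by rewrite [RHS]big_ord_recl scale0r add0r; apply: eq_bigr => i _; rewrite lift0 subSS.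
rewrite [RHS]big_ord_recr /= subnn scale0r addr0; apply: eq_bigr => i _.
by rewrite subSn // -ltnS.
Qed.

Section Symmetric.
Variables (k : fieldType) (g : lieAlgType k).
Hypothesis char0 : forall n, n.+1%:R != 0 :> k.
Local Notation U := (env g).

(** f(2 t) - 2 ^ N f(t) has degree smaller than N, which gives an induction on the
    number of coefficients. *)
Lemma coefficients_mem (V : lmodType k) (S : {pred V}) (z : nat -> V) N :
  submod_closed S -> (forall t : k, \sum_(i < N) t ^+ i *: z i \in S) ->
  forall i, (i < N)%N -> z i \in S.
Proof.
move=> SP; elim: N z => // N IH z H.
have lt i : (i < N)%N -> z i \in S.
  move=> iN; pose b j : k := 2 ^+ j - 2 ^+ N.
  have b0 : b i != 0.
    have lt2 : (2 ^ i < 2 ^ N)%N by rewrite ltn_exp2l.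
    rewrite /b -oppr_eq0 opprB -!natrX -natrB 1?ltnW //.
    by rewrite -[X in X%:R]prednK ?subn_gt0.
  have bS : b i *: z i \in S.
    apply: (IH (fun j => b j *: z j)) iN => t.
    have := subspaceB SP (H (2 * t)) (subspaceZ SP (2 ^+ N) (H t)).
    rewrite !big_ord_recr /= scalerDr scaler_sumr.
    have -> : \sum_(j < N) (2 * t) ^+ j *: z j + (2 * t) ^+ N *: z N
      - (\sum_(j < N) 2 ^+ N *: (t ^+ j *: z j) + 2 ^+ N *: (t ^+ N *: z N))
      = \sum_(j < N) (2 * t) ^+ j *: z j - \sum_(j < N) 2 ^+ N *: (t ^+ j *: z j).
      rewrite exprMn; lmod k V.
    rewrite -sumrB.
    have -> : \sum_(j < N) ((2 * t) ^+ j *: z j - 2 ^+ N *: (t ^+ j *: z j))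
            = \sum_(j < N) t ^+ j *: (b j *: z j).
      by apply: eq_bigr => j _; rewrite exprMn /b; lmod k V.
    by [].
  by rewrite -[z i]scale1r -(mulVf b0) -scalerA (subspaceZ SP).
move=> i; rewrite ltnS leq_eqVlt => /orP [/eqP ->|]; last exact: lt.
have := H 1; rewrite big_ord_recr /= expr1n scale1r (subspaceDr SP) //.
by apply: (subspace_sum SP) => j _; rewrite expr1n scale1r lt.
Qed.

(** The coefficient of t ^ i in (C + t D) ^ m, for C and D that need not commute. *)
Fixpoint binom_coef (C D : U) (m i : nat) : U :=
  if m is m'.+1 then
    C * binom_coef C D m' i + (if i is i'.+1 then D * binom_coef C D m' i' else 0)
  else (i == 0%N)%:R.

Lemma binom_coefE C D m N t : (m < N)%N ->
  (C + t *: D) ^+ m = \sum_(i < N) t ^+ i *: binom_coef C D m i.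
Proof.
have big0 j i : (j < i)%N -> binom_coef C D j i = 0.
  elim: j i => [|j IH] [|i] //= lt; rewrite IH ?mulr0 ?add0r; last exact: ltnW.
  by rewrite IH ?mulr0.
elim: m N => [|m IH] [|N] // lt.
  rewrite big_ord_recl /= expr0 scale1r big1 ?addr0 // => i _.
  by rewrite scaler0.
rewrite exprS mulrDl {1}(IH N.+1) ?(IH N) //; last exact: ltnW.
rewrite !mulr_sumr /=.
under [RHS]eq_bigr do rewrite scalerDr; rewrite big_split /=; congr (_ + _).
  by apply: eq_bigr => i _; rewrite scalerAr.
rewrite [RHS]big_ord_recl scaler0 add0r; apply: eq_bigr => i _ /=.
by rewrite exprS -!(scalerAl, scalerAr) scalerA.
Qed.

Lemma binom_coef1 C D m :
  binom_coef C D m.+1 1 = \sum_(i < m.+1) C ^+ i * D * C ^+ (m - i).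
Proof.
have c0 j : binom_coef C D j 0 = C ^+ j.
  by elim: j => [|j IH] //=; rewrite IH addr0 -exprS.
elim: m => [|m IH]; first by rewrite big_ord1 /= mulr0 add0r expr0 mul1r.
rewrite [LHS]/= -/(binom_coef C D m.+1 1) IH c0 [RHS]big_ord_recl /= mul1r addrC subn0.
rewrite addr0 -exprS; congr (_ + _); rewrite mulr_sumr; apply: eq_bigr => i _.
by rewrite /bump /= add1n subSS exprS !mulrA.
Qed.

Section Sym.
Variable c : {pred g}.
Hypothesis cP : submod_closed c.
Local Notation Sym := (sym_space c).
Let SymP : submod_closed Sym := span_closed (is_power c).

(** This is the coefficient of t in the power of exponent n + 1 of x + t y. *)
Lemma sym_derivation x y n : x \in c -> y \in c ->
  \sum_(i < n.+1) env_gen x ^+ i * env_gen y * env_gen x ^+ (n - i) \in Sym.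
Proof.
move=> xc yc; rewrite -binom_coef1.
apply: (@coefficients_mem _ _ _ n.+2) => // t.
rewrite -binom_coefE // -(linearZf t (@env_gen_linear k g)).
rewrite -(linearDf (@env_gen_linear k g)); apply: mem_span.
by exists (x + t *: y), n.+1; split=> //; apply: subspaceD => //; apply: subspaceZ.
Qed.

Lemma telescope_comm (C W : U) i :
  \sum_(a < i) C ^+ a * (C * W - W * C) * C ^+ (i.-1 - a) = C ^+ i * W - W * C ^+ i.
Proof.
case: i => [|i]; first by rewrite big_ord0 expr0 mul1r mulr1 subrr.
elim: i => [|i IH]; first by rewrite big_ord1 /= !expr1 expr0 mul1r mulr1.
rewrite big_ord_recl /= expr0 mul1r subn0.
have -> : \sum_(a < i.+1) C ^+ (lift ord0 a) * (C * W - W * C) * C ^+ (i.+1 - lift ord0 a)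
    = C * (C ^+ i.+1 * W - W * C ^+ i.+1).
  rewrite -IH mulr_sumr; apply: eq_bigr => a _.
  by rewrite lift0 subSS exprS !mulrA.
rewrite [C ^+ i.+2]exprS mulrBr mulrBl !mulrA; lmod k (env g).
Qed.

(** Let L and R be the left and right multiplications by e, h_p the sum of the L ^ a R ^ b
    with a + b = p, and N = i + j.  Then (L ^ i - R ^ i) (L ^ j - R ^ j) is
    (L - R) ^ 2 h_(i - 1) h_(j - 1), whose value at x is symmetric by the induction
    hypothesis for [e, [e, x]].  Hence all the L ^ i R ^ j + L ^ j R ^ i agree at x with
    L ^ N + R ^ N up to symmetric elements, and their sum over i is 2 h_N, which is
    symmetric at x. *)
Lemma even_symmetric e : e \in c -> forall N x,
  (forall n, iter (2 * n) (lie e) x \in c) -> forall i j, (i + j)%N = N ->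
  env_gen e ^+ i * env_gen x * env_gen e ^+ j
  + env_gen e ^+ j * env_gen x * env_gen e ^+ i \in Sym.
Proof.
move=> ec N; have [M] := ubnP N; elim: M N => // M IH N; rewrite ltnS => NM x xP.
set C := env_gen e; set X := env_gen x.
pose Y := env_gen (lie e (lie e x)).
have YE : Y = C * (C * X - X * C) - (C * X - X * C) * C by rewrite /Y !env_gen_lie.
have hh_mem i j : (i + j)%N = N ->
    (C ^+ i * C ^+ j * X + X * (C ^+ i * C ^+ j))
    - (C ^+ i * X * C ^+ j + C ^+ j * X * C ^+ i) \in Sym.
  move=> ij; pose hh a b := C ^+ (a + b) * Y * C ^+ ((i.-1 - a) + (j.-1 - b)).
  have -> : (C ^+ i * C ^+ j * X + X * (C ^+ i * C ^+ j))
    - (C ^+ i * X * C ^+ j + C ^+ j * X * C ^+ i) = \sum_(a < i) \sum_(b < j) hh a b.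
    transitivity (\sum_(a < i) C ^+ a * (C * (C ^+ j * X - X * C ^+ j)
                    - (C ^+ j * X - X * C ^+ j) * C) * C ^+ (i.-1 - a)).
      rewrite telescope_comm mulrBr mulrBl -[X * C ^+ j * _]mulrA.
      have -> : C ^+ j * C ^+ i = C ^+ i * C ^+ j by rewrite -!exprD addnC.
      rewrite !mulrA; lmod k (env g).
    apply: eq_bigr => a _.
    have -> : C * (C ^+ j * X - X * C ^+ j) - (C ^+ j * X - X * C ^+ j) * C
      = C ^+ j * (C * X - X * C) - (C * X - X * C) * C ^+ j.
      have cC : C * C ^+ j = C ^+ j * C by rewrite -exprS exprSr.
      rewrite !mulrBr !mulrBl -[X * C ^+ j * C]mulrA -[X * C * C ^+ j]mulrA cC.
      rewrite [C * (C ^+ j * X)]mulrA cC !mulrA; lmod k (env g).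
    rewrite -telescope_comm -YE mulr_sumr mulr_suml; apply: eq_bigr => b _.
    by rewrite /hh [((i.-1 - a) + _)%N]addnC !exprD !mulrA.
  have -> : \sum_(a < i) \sum_(b < j) hh a b
    = 2^-1 *: \sum_(a < i) \sum_(b < j) (hh a b + hh (i.-1 - a)%N (j.-1 - b)%N).
    (* symmetrize with respect to the exchange of L and R *)
    have rv : \sum_(a < i) \sum_(b < j) hh a b
      = \sum_(a < i) \sum_(b < j) hh (i.-1 - a)%N (j.-1 - b)%N.
      rewrite (reindex_inj rev_ord_inj) /=; apply: eq_bigr => a _.
      rewrite (reindex_inj rev_ord_inj) /=; apply: eq_bigr => b _.
      by rewrite -!subn1 -!subnDA !add1n.
    under [in RHS]eq_bigr do rewrite big_split /=.
    by rewrite big_split /= -rv -mulr2n -scaler_nat scalerA mulVf ?scale1r //.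
  apply: (subspaceZ SymP); apply: (subspace_sum SymP) => a _.
  apply: (subspace_sum SymP) => b _; rewrite /hh.
  have -> : ((i.-1 - (i.-1 - a)) + (j.-1 - (j.-1 - b)) = a + b)%N.
    by have := ltn_ord a; have := ltn_ord b; lia.
  apply: (IH (a + b + ((i.-1 - a) + (j.-1 - b)))%N) => // [|n].
    by have := ltn_ord a; have := ltn_ord b; lia.
  by have := xP n.+1; rewrite mulnS addnC iterD.
have xc : x \in c by exact: (xP 0%N).
have Q_mem : C ^+ N * X + X * C ^+ N \in Sym.
  have H : \sum_(i < N.+1) ((C ^+ N * X + X * C ^+ N)
     - (C ^+ i * X * C ^+ (N - i) + C ^+ (N - i) * X * C ^+ i)) \in Sym.
    apply: (subspace_sum SymP) => i _.
    have := hh_mem i (N - i)%N; rewrite -exprD subnKC; last by rewrite -ltnS.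
    exact.
  move: H; rewrite sumrB sumr_const card_ord big_split /=.
  have -> : \sum_(i < N.+1) C ^+ (N - i) * X * C ^+ i
          = \sum_(i < N.+1) C ^+ i * X * C ^+ (N - i).
    rewrite (reindex_inj rev_ord_inj) /=; apply: eq_bigr => i _.
    by rewrite subSS subKn // -ltnS.
  have sd := sym_derivation N ec xc.
  move=> /(subspaceD SymP)/(_ (subspaceD SymP sd sd)); rewrite subrK -scaler_nat => H.
  by rewrite -[_ + _]scale1r -(mulVf (char0 N)) -scalerA (subspaceZ SymP).
move=> i j ij; have := subspaceB SymP Q_mem (hh_mem i j ij).
by rewrite -exprD ij opprB addrC subrK.
Qed.
End Sym.
End Symmetric.

(** * Sweedler sums *)

Lemma sum_assoc (V : nmodType) (F : nat -> nat -> nat -> V) n :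
  \sum_(i < n.+1) \sum_(j < i.+1) F j (i - j)%N (n - i)%N
  = \sum_(i < n.+1) \sum_(j < (n - i).+1) F i j (n - i - j)%N.
Proof.
elim: n F => [|n IH] F; first by rewrite !big_ord1.
rewrite big_ord_recr /=; under eq_bigr => i _ do rewrite (subSn (leq_ord i)).
rewrite (IH (fun a b c => F a b c.+1)) [RHS]big_ord_recr /= subnn big_ord1 subn0.
rewrite [X in _ + X = _]big_ord_recr /= !subnn addrA; congr (_ + _).
rewrite -big_split; apply: eq_bigr => i _ /=.
have le : (i <= n)%N by rewrite -ltnS.
rewrite subSn // [RHS]big_ord_recr /= subnn; congr (_ + _).
by apply: eq_bigr => j _; rewrite subSn // leq_ord.
Qed.

Lemma mem_eqr (T : Type) (S : {pred T}) x y : x \in S -> y = x -> y \in S.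
Proof. by move=> xS ->. Qed.

Section SweedlerLinearity.
Import freeg.
Variables (k : fieldType).

(** For a given tensor, a Sweedler sum is a fixed linear combination of values of its
    summand, hence linear in the parameters of the summand. *)
Lemma tens_lift_linearB (Z U V W : lmodType k) (B : Z -> U -> V -> W) t :
  (forall u v, linear (fun z => B z u v)) -> linear (fun z => tens_lift (B z) t).
Proof.
move=> lB a z z'; rewrite /tens_lift; move: (repr t).
apply: (freeg_linear_eq (f := fglift (fun p => B (a *: z + z') p.1 p.2))
  (g := fun D => a *: fglift (fun p => B z p.1 p.2) D + fglift (fun p => B z' p.1 p.2) D))
  => [||[u v]].
- exact: fglift_linear.
- apply: linear_addf; last exact: fglift_linear.
  apply: linear_comp (fglift_linear _) => b x y.
  by rewrite scalerDr !scalerA mulrC.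
- by rewrite !fgliftE lB.
Qed.

Lemma tens_lift_ext (U V W : lmodType k) (B B' : U -> V -> W) t :
  (forall u v, B u v = B' u v) -> tens_lift B t = tens_lift B' t.
Proof. by move=> e; congr tens_lift; apply: funext => u; apply: funext. Qed.

Lemma linear_scale (V : lmodType k) (a : k) : linear (fun x : V => a *: x).
Proof. by move=> b x y; rewrite scalerDr !scalerA mulrC. Qed.

Lemma linear_scalel (V : lmodType k) (v : V) (f : V -> k) : scalar f ->
  linear (fun x : V => f x *: v).
Proof. by move=> lf b x y; rewrite lf scalerDl scalerA. Qed.

Lemma linear_id (V : lmodType k) : linear (fun x : V => x).
Proof. by []. Qed.

Lemma bilinear_pre (U V U' V' W : lmodType k) (B : U' -> V' -> W)
    (f : U -> U') (h : V -> V') : bilinear_map B -> linear f -> linear h ->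
  bilinear_map (fun u v => B (f u) (h v)).
Proof.
move=> BP lf lh; split=> [v|u]; first exact: linear_comp (BP.1 _) lf.
exact: linear_comp (BP.2 _) lh.
Qed.

Lemma bilinear_post (U V W W' : lmodType k) (B : U -> V -> W) (f : W -> W') :
  bilinear_map B -> linear f -> bilinear_map (fun u v => f (B u v)).
Proof.
move=> BP lf; split=> [v|u]; first exact: linear_comp lf (BP.1 _).
exact: linear_comp lf (BP.2 _).
Qed.

End SweedlerLinearity.

(** * Divided powers and the twisted conjugation *)

Section DividedPowers.
Variables (k : fieldType) (g : lieAlgType k).
Hypothesis char0 : forall n, n.+1%:R != 0 :> k.

Fact dp_key : unit. Proof. exact: tt. Qed.
(** The divided powers x ^ n / n!, locked so that they are not confused with scalar
    multiples of powers in rewriting. *)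
Definition dp : nat -> g -> env g :=
  locked_with dp_key (fun n x => (n`!%:R)^-1 *: env_gen x ^+ n).

Lemma dpE n x : dp n x = (n`!%:R)^-1 *: env_gen x ^+ n.
Proof. by rewrite /dp unlock. Qed.

Lemma dp0 x : dp 0 x = 1.
Proof. by rewrite !dpE invr1 scale1r. Qed.

Lemma power_dp n x : env_gen x ^+ n = n`!%:R *: dp n x.
Proof. by rewrite !dpE scalerA divff ?scale1r // fact_neq0. Qed.

Lemma dpSl n x : env_gen x * dp n x = n.+1%:R *: dp n.+1 x.
Proof.
rewrite !dpE -scalerAr -exprS scalerA factS natrM invfM mulrA divff ?mul1r //.
Qed.

Lemma dpSr n x : dp n x * env_gen x = n.+1%:R *: dp n.+1 x.
Proof. by rewrite -dpSl !dpE -scalerAl -scalerAr -exprS -exprSr. Qed.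

Lemma scale_succ_inj (V : lmodType k) n (x y : V) :
  n.+1%:R *: x = n.+1%:R *: y -> x = y.
Proof.
by move=> e; rewrite -[x]scale1r -(mulVf (char0 n)) -scalerA e scalerA mulVf ?scale1r.
Qed.

Lemma env_comul_dp n x :
  env_comul (dp n x) = \sum_(i < n.+1) dp i x ⊗ dp (n - i) x.
Proof.
have [bl br] := tens_bilinear (env g) (env g).
elim: n => [|n IH]; first by rewrite big_ord1 !dp0 env_comul1.
apply: (@scale_succ_inj _ n); rewrite -(linearZf _ (@env_comul_linear k g)) -dpSr.
rewrite env_comulM IH env_comul_gen.
rewrite (bil_suml (@tens_env_mul_bilinear k g)).
rewrite -(cauchy_derive (fun i j => dp i x ⊗ dp j x)).
apply: eq_bigr => i _; rewrite (bilDr (@tens_env_mul_bilinear k g)) !tens_env_mulE !mulr1.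
by rewrite !dpSr (linearZf _ (bl _)) (linearZf _ (br _)).
Qed.

Lemma env_counit_dp n x : env_counit (dp n x) = (n == 0%N)%:R.
Proof.
case: n => [|n]; first by rewrite dp0 env_counit1.
apply: (mulfI (char0 n)).
have := linearZf (V := k^o) n.+1%:R (@env_counit_linear k g) (dp n.+1 x).
rewrite -dpSr env_counitM env_counit_gen mulr0 => H; rewrite mulr0.
exact: (esym H).
Qed.

Lemma env_genN (x : g) : env_gen (- x) = - env_gen x.
Proof. by rewrite -(scaleN1r x) (linearZf (-1) (@env_gen_linear k g)) scaleN1r. Qed.

Lemma dp_antipode n x : \sum_(i < n.+1) dp i (- x) * dp (n - i) x = (n == 0%N)%:R.
Proof.
case: n => [|n]; first by rewrite big_ord1 !dp0 mulr1.
apply: (@scale_succ_inj _ n); rewrite -(@cauchy_derive k (env g) (fun i j => dp i (- x) * dp j x)).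
rewrite scaler0 big1 // => i _.
by rewrite scalerAl scalerAr -dpSr -dpSl env_genN mulrN mulNr mulrA addNr.
Qed.

Lemma dp_antipode' n x : \sum_(i < n.+1) dp i x * dp (n - i) (- x) = (n == 0%N)%:R.
Proof. by rewrite -[x in LHS]opprK; under eq_bigr do rewrite opprK; rewrite -(dp_antipode n (- x)) opprK. Qed.

Section Twist.
Variables (c : {pred g}) (d z : g).
Hypothesis cP : submod_closed c.
Hypothesis norm : forall y, y \in c -> lie (d + z) y \in c.
Hypothesis even : forall e, e \in c -> forall n, iter (2 * n) (lie e) z \in c.
Local Notation Sym := (sym_space c).
Let SymP : submod_closed Sym := span_closed (is_power c).
Let D := d + 2 *: z.

(** The infinitesimal form of the conjugation Y |-> e^D Y e^(- d).  This is where the two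
    conditions on pseudoreductive triples are used. *)
Lemma twist1 Y : Y \in Sym -> env_gen D * Y - Y * env_gen d \in Sym.
Proof.
apply: (@span_ind _ _ _ [pred Y | env_gen D * Y - Y * env_gen d \in Sym]).
  split=> [|a u v]; first by rewrite inE mulr0 mul0r subrr (subspace0 SymP).
  rewrite !inE => uS vS; apply: (mem_eqr (SymP.2 a _ _ uS vS)).
  rewrite !(mulrDr, mulrDl) -scalerAl -scalerAr; lmod k (env g).
move=> _ [e [n [ec ->]]]; rewrite inE.
have -> : env_gen D * env_gen e ^+ n - env_gen e ^+ n * env_gen d
  = (env_gen (d + z) * env_gen e ^+ n - env_gen e ^+ n * env_gen (d + z))
  + (env_gen e ^+ 0 * env_gen z * env_gen e ^+ n
     + env_gen e ^+ n * env_gen z * env_gen e ^+ 0).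
  rewrite /D !(linearDf (@env_gen_linear k g)) (linearZf _ (@env_gen_linear k g)).
  rewrite expr0 mul1r mulr1 !mulrDl !mulrDr -scalerAl; lmod k (env g).
apply: (subspaceD SymP); last first.
  by apply: (even_symmetric char0 cP ec (N := n)) => //; apply: even.
case: n => [|n]; first by rewrite !expr0 mulr1 mul1r subrr (subspace0 SymP).
have -> : env_gen (d + z) * env_gen e ^+ n.+1 - env_gen e ^+ n.+1 * env_gen (d + z)
  = \sum_(i < n.+1) env_gen e ^+ i * env_gen (lie (d + z) e) * env_gen e ^+ (n - i).
  rewrite -[RHS]opprK -sumrN -[LHS]opprB; congr (- _).
  rewrite -telescope_comm; apply: eq_bigr => i _.
  by rewrite env_gen_lie -[X in _ * X * _ = _]opprB mulrN mulNr.
exact: (sym_derivation char0 cP n ec (norm ec)).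
Qed.

Definition twist n Y : env g := \sum_(i < n.+1) dp i D * Y * dp (n - i) (- d).

(** The n-th term of e^D Y e^(- d) is, up to the factor n!, the n-th iterate of the map
    Y |-> D Y - Y d. *)
Lemma twist_mem n Y : Y \in Sym -> twist n Y \in Sym.
Proof.
move=> YS; elim: n => [|n IH].
  by rewrite /twist big_ord1 !dp0 mulr1 mul1r.
suff H : n.+1%:R *: twist n.+1 Y \in Sym.
  by rewrite -[twist _ _]scale1r -(mulVf (char0 n)) -scalerA (subspaceZ SymP).
rewrite /twist -(@cauchy_derive k (env g) (fun i j => dp i D * Y * dp j (- d))).
apply: (mem_eqr (twist1 IH)).
rewrite /twist mulr_sumr mulr_suml -sumrB; apply: eq_bigr => i _.
rewrite !mulrA dpSl -!scalerAl; congr (_ + _).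
by rewrite -mulrN -env_genN -[RHS]mulrA dpSr -scalerAr.
Qed.
End Twist.
End DividedPowers.

(** * The Hopf algebra structure *)

Section MoreLinear.
Variable k : fieldType.
Implicit Types U V W : lmodType k.

Lemma linear_sum_fun U W I (r : seq I) (P : pred I) (F : I -> U -> W) :
  (forall i, linear (F i)) -> linear (fun x => \sum_(i <- r | P i) F i x).
Proof.
move=> lF a x y; rewrite scaler_sumr -big_split; apply: eq_bigr => i _; exact: lF.
Qed.

Lemma tens_lift_map U V U' V' W (f : U -> U') (h : V -> V') (B : U' -> V' -> W) t :
  linear f -> linear h -> bilinear_map B ->
  tens_lift B (tens_map f h t) = tens_lift (fun a b => B (f a) (h b)) t.
Proof.
move=> lf lh BP; have B'P := bilinear_pre BP lf lh.
move: t; apply: tens_linear_eq.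
- exact: linear_comp (tens_lift_linear BP) (tens_map_linear lf lh).
- exact: tens_lift_linear B'P.
- by move=> u v; rewrite tens_mapE // !tens_liftE.
Qed.

Lemma tens_lift_comp U V W W' (B : U -> V -> W) (f : W -> W') t :
  bilinear_map B -> linear f ->
  f (tens_lift B t) = tens_lift (fun a b => f (B a b)) t.
Proof.
move=> BP lf; move: t; apply: tens_linear_eq.
- exact: linear_comp lf (tens_lift_linear BP).
- exact: tens_lift_linear (bilinear_post BP lf).
- by move=> u v; rewrite !tens_liftE //; apply: bilinear_post.
Qed.

Lemma bilinear_nested U V U' V' W (B : U -> V -> U' -> V' -> W) t :
  (forall u v, bilinear_map (B u v)) -> (forall u' v', bilinear_map (fun u v => B u v u' v')) ->
  bilinear_map (fun u v => tens_lift (B u v) t).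
Proof.
move=> b1 b2; split=> [v|u].
  by apply: tens_lift_linearB => u' v'; exact: (b2 u' v').1.
by apply: tens_lift_linearB => u' v'; exact: (b2 u' v').2.
Qed.
End MoreLinear.

Section UtauStructure.
Variables (k : fieldType) (g : lieAlgType k).
Hypothesis char0 : forall n, n.+1%:R != 0 :> k.
Variables (s c : {pred g}).
Hypotheses (sP : submod_closed s) (cP : submod_closed c).
Hypothesis sc : forall x, exists y z, [/\ y \in s, z \in c & x = y + z].
Local Notation cl := (@Utau_class k g s).
Local Notation comul := (@Utau_comul k g s).
Local Notation counit := (@Utau_counit k g s).
Local Notation one := (Utau_one s).

Definition class_dp n x : Utau s := cl (dp n x).

Lemma class_dp0 x : class_dp 0 x = one. Proof. by rewrite /class_dp dp0. Qed.

Lemma Utau_lift (W : lmodType k) (f : Utau s -> W) :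
  linear (fun u => f (cl u)) -> linear f.
Proof.
move=> lf a q r; rewrite -[q]clsK -[r]clsK -(cls_linear (left_ideal_rel s)).
exact: lf.
Qed.

Lemma Utau_class_dp_s u n d : d \in s -> cl (u * dp n.+1 d) = 0.
Proof.
move=> sd; apply: (scale_succ_inj char0 (n := n)); rewrite scaler0.
rewrite -(linearZf _ (@Utau_class_linear k g s)) env_scaleAr -(dpSr char0) mulrA.
exact: Utau_class_ideal.
Qed.

(** The classes of products x ^ m y ^ n with n > 0 vanish, so the divided powers of the
    elements of c are enough. *)
Lemma Utau_linear_eq (W : lmodType k) (f h : Utau s -> W) : linear f -> linear h ->
  (forall n x, x \in c -> f (class_dp n x) = h (class_dp n x)) -> f =1 h.
Proof.
move=> lf lh e q; rewrite -[q]clsK; have lc := @Utau_class_linear k g s.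
apply: (env_linear_eq_pow2 char0 sP cP sc (linear_comp lf lc) (linear_comp lh lc)).
move=> x m y n xc ys; rewrite (power_dp char0 n) (power_dp char0 m).
rewrite -env_scaleAr -env_scaleAl !(linearZf _ lc) !(linearZf _ lf) !(linearZf _ lh).
case: n => [|n]; last by rewrite Utau_class_dp_s // (linear0f lf) (linear0f lh).
by rewrite dp0 mulr1 [f _]e.
Qed.

Lemma comul_linear : linear comul.
Proof.
apply: Utau_lift => a u v; rewrite !Utau_comulE.
exact: (linear_comp (tens_map_linear (@Utau_class_linear _ _ _) (@Utau_class_linear _ _ _))
  (@env_comul_linear _ _)).
Qed.

Lemma counit_linear : scalar counit.
Proof.
apply: (Utau_lift (W := k^o)) => a u v; rewrite !Utau_counitE.
exact: (@env_counit_linear k g a u v).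
Qed.

Lemma counit_class_dp n x : counit (class_dp n x) = (n == 0%N)%:R.
Proof. by rewrite Utau_counitE env_counit_dp. Qed.

Lemma comul_class_dp n x : comul (class_dp n x) = \sum_(i < n.+1) class_dp i x ⊗ class_dp (n - i) x.
Proof.
have lc := @Utau_class_linear k g s.
rewrite Utau_comulE env_comul_dp // (linear_sumf _ _ _ (tens_map_linear lc lc)).
by apply: eq_bigr => i _; rewrite tens_mapE.
Qed.

Lemma sw_class_dp (W : lmodType k) (B : Utau s -> Utau s -> W) n x : bilinear_map B ->
  tens_lift B (comul (class_dp n x)) = \sum_(i < n.+1) B (class_dp i x) (class_dp (n - i) x).
Proof.
move=> BP; rewrite comul_class_dp (linear_sumf _ _ _ (tens_lift_linear BP)).
by apply: eq_bigr => i _; rewrite tens_liftE.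
Qed.

Lemma sum_counit (W : lmodType k) (F : nat -> W) n :
  \sum_(i < n.+1) (nat_of_ord i == 0%N)%:R *: F (n - i)%N = F n :> W.
Proof.
rewrite big_ord_recl /= scale1r subn0 big1 ?addr0 // => i _.
exact: scale0r.
Qed.

Lemma sum_counit_r (W : lmodType k) (F : nat -> W) n :
  \sum_(i < n.+1) ((n - i)%N == 0%N)%:R *: F i = F n :> W.
Proof.
rewrite big_ord_recr /= subnn scale1r big1 ?add0r // => i _.
by rewrite subn_eq0 leqNgt ltn_ord scale0r.
Qed.

Lemma tens_scale_bil (W : lmodType k) (f : W -> k) : scalar f ->
  bilinear_map (fun a b : W => f a *: b).
Proof.
move=> lf; split=> [v|u]; [exact: linear_scalel | exact: linear_scale].
Qed.
Lemma tens_scale_bil_r (W : lmodType k) (f : W -> k) : scalar f ->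
  bilinear_map (fun a b : W => f b *: a).
Proof.
move=> lf; split=> [v|u]; [exact: linear_scale | exact: linear_scalel].
Qed.

Lemma Utau_coalgebra : coalgebra_axioms comul counit.
Proof.
have cL := comul_linear; have eL := counit_linear.
have tb := tens_bilinear (Utau s) (Utau s).
have tb3 := tens_bilinear (Utau s) (tensor (Utau s) (Utau s)).
split=> //.
- have b0 (b : Utau s) : bilinear_map (fun a1 a2 : Utau s => a1 ⊗ (a2 ⊗ b)).
    split=> [v|u]; first exact: (tb3.1 (v ⊗ b)).
    exact: linear_comp (tb3.2 _) (tb.1 _).
  have b1 : bilinear_map (fun a b : Utau s => \Sw_(a1, a2 <- comul a) (a1 ⊗ (a2 ⊗ b))).
    split=> [v|u]; first exact: linear_comp (tens_lift_linear (b0 _)) cL.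
    apply: tens_lift_linearB => a1 a2; exact: linear_comp (tb3.2 _) (tb.2 _).
  have b2 : bilinear_map (fun a b : Utau s => a ⊗ comul b).
    by split=> [v|u]; [exact: tb3.1 | exact: linear_comp (tb3.2 _) cL].
  apply: Utau_linear_eq => [||n x xc].
  + exact: linear_comp (tens_lift_linear b1) cL.
  + exact: linear_comp (tens_lift_linear b2) cL.
  rewrite (sw_class_dp n x b1) (sw_class_dp n x b2).
  transitivity (\sum_(i < n.+1) \sum_(j < i.+1) class_dp j x ⊗ (class_dp (i - j) x ⊗ class_dp (n - i) x)).
    by apply: eq_bigr => i _; exact: (sw_class_dp i x (b0 _)).
  rewrite (sum_assoc (fun a b d => class_dp a x ⊗ (class_dp b x ⊗ class_dp d x))).
  by apply: eq_bigr => i _; rewrite comul_class_dp (bil_sumr tb3).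
- have bl := tens_scale_bil eL; have br := tens_scale_bil_r eL.
  move=> u; split; move: u; apply: Utau_linear_eq => [||n x xc];
    [exact: linear_comp (tens_lift_linear bl) cL|exact: linear_id| |
     exact: linear_comp (tens_lift_linear br) cL|exact: linear_id|].
    rewrite (sw_class_dp n x bl); under eq_bigr do rewrite counit_class_dp.
    exact: (sum_counit (fun i => class_dp i x)).
  rewrite (sw_class_dp n x br); under eq_bigr do rewrite counit_class_dp.
  exact: (sum_counit_r (fun i => class_dp i x)).
- have bs : bilinear_map (fun a b : Utau s => b ⊗ a).
    by split=> [v|u]; [exact: tb.2 | exact: tb.1].
  apply: Utau_linear_eq => [||n x xc] //.
    exact: linear_comp (tens_lift_linear bs) cL.
  rewrite (sw_class_dp n x bs) comul_class_dp (reindex_inj rev_ord_inj) /=; apply: eq_bigr => i _.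
  by rewrite subSS subKn // leq_ord.
Qed.

Definition Utau_act (w : env g) (q : Utau s) : Utau s := cl (w * repr q).

Lemma Utau_actE w u : Utau_act w (cl u) = cl (w * u).
Proof.
have lm : linear (fun u => cl (w * u)).
  exact: linear_comp (@Utau_class_linear k g s) ((@env_mul_bilinear k g).2 w).
apply: (quot_lift lm) => _ [v [d [sd ->]]].
by rewrite mulrA Utau_class_ideal.
Qed.

Lemma Utau_act_bilinear : bilinear_map Utau_act.
Proof.
have lc := @Utau_class_linear k g s.
split=> [q|w]; last first.
  apply: Utau_lift => a u v; rewrite !Utau_actE.
  by rewrite -lc; congr cl; exact: ((@env_mul_bilinear k g).2 w a u v).
move=> a w w'; rewrite -[q]clsK !Utau_actE -lc; congr cl.
exact: (@env_mul_bilinear k g).1.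
Qed.

Lemma Utau_actM w w' q : Utau_act (w * w') q = Utau_act w (Utau_act w' q).
Proof.
by rewrite -[q]clsK (Utau_actE w' (repr q)) (Utau_actE w) (Utau_actE (w * w')) mulrA.
Qed.
Lemma Utau_act1 q : Utau_act 1 q = q.
Proof. by rewrite -[q]clsK Utau_actE mul1r. Qed.

Section Product.
Variables (iota iotam : Utau s -> env g).
Hypotheses (iota_lin : linear iota) (iotam_lin : linear iotam).
Hypothesis iotaE : forall n x, x \in c -> iota (class_dp n x) = dp n x.
Hypothesis iotamE : forall n x, x \in c -> iotam (class_dp n x) = dp n (- x).

Definition Utau_mul (x y : Utau s) : Utau s := Utau_act (iota y) x.
Definition Utau_rdiv (x y : Utau s) : Utau s := Utau_act (iotam y) x.

Lemma Utau_mul_bilinear : bilinear_map Utau_mul.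
Proof.
split=> [y|x]; first exact: Utau_act_bilinear.2.
exact: linear_comp (Utau_act_bilinear.1 _) iota_lin.
Qed.
Lemma Utau_rdiv_bilinear : bilinear_map Utau_rdiv.
Proof.
split=> [y|x]; first exact: Utau_act_bilinear.2.
exact: linear_comp (Utau_act_bilinear.1 _) iotam_lin.
Qed.

Lemma cl_iota q : cl (iota q) = q.
Proof.
move: q; apply: Utau_linear_eq => [||n x xc]; last by rewrite iotaE.
  exact: linear_comp (@Utau_class_linear _ _ _) iota_lin.
exact: linear_id.
Qed.

(** On symmetric elements the section is the inverse of the class map.  All the explicit
    products below are computed in this way. *)
Lemma iota_sym z : z \in sym_space c -> iota (cl z) = z.
Proof.
have lc := @Utau_class_linear k g s.
apply: (@eq_on_span _ _ _ _ (fun z => iota (cl z)) id).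
- exact: linear_comp iota_lin lc.
- exact: linear_id.
move=> _ [x [n [xc ->]]].
by rewrite (power_dp char0) (linearZf _ lc) (linearZf _ iota_lin) iotaE.
Qed.

Lemma iota_one : iota one = 1.
Proof. by rewrite -(class_dp0 0) iotaE ?dp0 ?subspace0. Qed.

Lemma iota_counit q : env_counit (iota q) = counit q.
Proof.
move: q; apply: (Utau_linear_eq (W := k^o)) => [||n x xc].
- exact: (linear_comp (W := k^o) (@env_counit_linear _ _) iota_lin).
- exact: counit_linear.
by rewrite iotaE // env_counit_dp // counit_class_dp.
Qed.

Lemma comul_mul u v : comul (Utau_mul u v) = tens_mul Utau_mul (comul u) (comul v).
Proof.
have lc := @Utau_class_linear k g s.
have tmb := tens_mul_bilinear Utau_mul_bilinear.
have tb := tens_bilinear (Utau s) (Utau s).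
move: v; apply: Utau_linear_eq => [||n x xc].
- exact: linear_comp comul_linear (Utau_mul_bilinear.2 _).
- exact: linear_comp (tmb.2 _) comul_linear.
rewrite comul_class_dp (bil_sumr tmb) /Utau_mul iotaE // -[u]clsK Utau_actE !Utau_comulE.
rewrite env_comulM env_comul_dp // (bil_suml (@tens_env_mul_bilinear k g)).
rewrite (linear_sumf _ _ _ (tens_map_linear lc lc)); apply: eq_bigr => i _.
move: (env_comul _); apply: tens_linear_eq => [||a b].
- exact: linear_comp (tens_map_linear lc lc) ((@tens_env_mul_bilinear k g).2 _).
- exact: linear_comp (tmb.1 _) (tens_map_linear lc lc).
rewrite tens_env_mulE !tens_mapE // (tens_mulE Utau_mul_bilinear) /Utau_mul.
by rewrite !iotaE // !Utau_actE.
Qed.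

Lemma Utau_bialgebra : unital_bialgebra_axioms comul counit one Utau_mul.
Proof.
split; first exact: Utau_coalgebra.
- split; first exact: Utau_mul_bilinear.
    by move=> u; rewrite /Utau_mul Utau_actE mulr1 cl_iota.
  by move=> u; rewrite /Utau_mul iota_one Utau_act1.
- split; last exact: comul_mul.
  by rewrite -(class_dp0 0) comul_class_dp big_ord1.
split; first by rewrite -(class_dp0 0) counit_class_dp.
move=> u v; rewrite /Utau_mul -[u]clsK Utau_actE !Utau_counitE env_counitM iota_counit.
by rewrite mulrC.
Qed.

Lemma Utau_mul_class_dp u n x : x \in c -> Utau_mul u (class_dp n x) = Utau_act (dp n x) u.
Proof. by move=> xc; rewrite /Utau_mul iotaE. Qed.

(** In terms of groups, x / e^c S = e^(- c) x. *)
Lemma rdiv_axiom u v :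
  \Sw_(a, b <- comul v) Utau_rdiv (Utau_mul u a) b = counit v *: u /\
  \Sw_(a, b <- comul v) Utau_mul (Utau_rdiv u a) b = counit v *: u.
Proof.
have b1 : bilinear_map (fun a b => Utau_rdiv (Utau_mul u a) b).
  split=> [b|a]; last exact: Utau_rdiv_bilinear.2.
  exact: linear_comp (Utau_rdiv_bilinear.1 _) (Utau_mul_bilinear.2 _).
have b2 : bilinear_map (fun a b => Utau_mul (Utau_rdiv u a) b).
  split=> [b|a]; last exact: Utau_mul_bilinear.2.
  exact: linear_comp (Utau_mul_bilinear.1 _) (Utau_rdiv_bilinear.2 _).
split; move: v; apply: Utau_linear_eq => [||n x xc];
  [exact: linear_comp (tens_lift_linear b1) comul_linear
  |exact: linear_scalel counit_linear|
  |exact: linear_comp (tens_lift_linear b2) comul_linear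
  |exact: linear_scalel counit_linear|].
  rewrite (sw_class_dp n x b1) counit_class_dp (reindex_inj rev_ord_inj) /=.
  transitivity (Utau_act (\sum_(i < n.+1) dp i (- x) * dp (n - i) x) u).
    rewrite (bil_suml Utau_act_bilinear); apply: eq_bigr => i _.
    rewrite subSS subKn ?leq_ord // /Utau_rdiv iotamE // Utau_mul_class_dp //.
    by rewrite -Utau_actM.
  rewrite dp_antipode // ; case: n => [|n]; first by rewrite Utau_act1 scale1r.
  by rewrite (bil0l Utau_act_bilinear) scale0r.
rewrite (sw_class_dp n x b2) counit_class_dp (reindex_inj rev_ord_inj) /=.
transitivity (Utau_act (\sum_(i < n.+1) dp i x * dp (n - i) (- x)) u).
  rewrite (bil_suml Utau_act_bilinear); apply: eq_bigr => i _.
  rewrite subSS subKn ?leq_ord // Utau_mul_class_dp // /Utau_rdiv iotamE //.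
  by rewrite -Utau_actM.
rewrite dp_antipode' // ; case: n => [|n]; first by rewrite Utau_act1 scale1r.
by rewrite (bil0l Utau_act_bilinear) scale0r.
Qed.

Lemma Utau_ind (S : {pred Utau s}) : submod_closed S ->
  (forall n x, x \in c -> class_dp n x \in S) -> forall u, u \in S.
Proof.
move=> SP Sg u; rewrite -[u]clsK; have lc := @Utau_class_linear k g s.
have := pow2_spanning char0 sP cP sc (repr u).
apply: (@span_ind _ _ _ [pred w | cl w \in S]).
  split=> [|a v w]; first by rewrite inE (linear0f lc) (subspace0 SP).
  by rewrite !inE lc; apply: SP.2.
move=> _ [x [m [y [n [xc ys ->]]]]]; rewrite inE.
rewrite (power_dp char0 n) (power_dp char0 m) -env_scaleAr -env_scaleAl.
rewrite !(linearZf _ lc); do 2!apply: (subspaceZ SP).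
case: n => [|n]; last by rewrite Utau_class_dp_s // (subspace0 SP).
by rewrite dp0 mulr1; apply: Sg.
Qed.

(** Left multiplication by u, minus its part of degree 0 in u. *)
Definition left_red (u z : Utau s) : Utau s := Utau_mul u z - counit u *: z.

Lemma left_red_bilinear : bilinear_map left_red.
Proof.
split=> [z|u] a x y; rewrite /left_red.
  rewrite Utau_mul_bilinear.1 counit_linear; lmod k (Utau s).
rewrite Utau_mul_bilinear.2; lmod k (Utau s).
Qed.

Lemma left_red_one z : left_red one z = 0.
Proof.
have [_ [_ u1 _] _ [e1 _]] := Utau_bialgebra.
by rewrite /left_red u1 e1 scale1r subrr.
Qed.

Fixpoint red_power (m : nat) (u v : Utau s) : Utau s :=
  if m is m'.+1 then \Sw_(a, b <- comul u) left_red a (red_power m' b v)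
  else counit u *: v.

Lemma red_power_bilinear m : bilinear_map (red_power m).
Proof.
elim: m => [|m IH]; first exact: tens_scale_bil counit_linear.
have bb v : bilinear_map (fun a b => left_red a (red_power m b v)).
  split=> [b|a]; first exact: left_red_bilinear.1.
  exact: linear_comp (left_red_bilinear.2 _) (IH.1 _).
split=> [v|u]; first exact: linear_comp (tens_lift_linear (bb v)) comul_linear.
apply: tens_lift_linearB => a b.
exact: linear_comp (left_red_bilinear.2 _) (IH.2 _).
Qed.

Lemma red_power_class_dp m n x v : red_power m.+1 (class_dp n x) v
  = \sum_(i < n.+1) left_red (class_dp i x) (red_power m (class_dp (n - i) x) v).
Proof.
apply: (sw_class_dp n x (B := fun a b => left_red a (red_power m b v))).
split=> [b|a]; first exact: left_red_bilinear.1.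
exact: linear_comp (left_red_bilinear.2 _) ((red_power_bilinear m).1 _).
Qed.

(** The definition splits off the first factor of a convolution power; by
    coassociativity the last one can be split off instead. *)
Lemma red_power_class_dp_r m n x v : red_power m.+1 (class_dp n x) v
  = \sum_(i < n.+1) red_power m (class_dp i x) (left_red (class_dp (n - i) x) v).
Proof.
elim: m n => [|m IH] n.
  rewrite red_power_class_dp /=.
  transitivity (\sum_(i < n.+1) ((n - i)%N == 0%N)%:R *: left_red (class_dp i x) v).
    by apply: eq_bigr => i _; rewrite counit_class_dp (bilZr left_red_bilinear).
  rewrite (sum_counit_r (fun i => left_red (class_dp i x) v)).
  under eq_bigr do rewrite counit_class_dp.
  by rewrite (sum_counit (fun i => left_red (class_dp i x) v)).
rewrite red_power_class_dp.
transitivity (\sum_(i < n.+1) \sum_(j < (n - i).+1)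
   left_red (class_dp i x) (red_power m (class_dp j x) (left_red (class_dp (n - i - j) x) v))).
  by apply: eq_bigr => i _; rewrite IH (bil_sumr left_red_bilinear).
rewrite -(sum_assoc (fun a b d => left_red (class_dp a x)
            (red_power m (class_dp b x) (left_red (class_dp d x) v)))).
by apply: eq_bigr => i _; rewrite red_power_class_dp.
Qed.

(** Each factor of a convolution power consumes at least one degree. *)
Lemma red_power_eq0 m n x v : (n < m)%N -> red_power m (class_dp n x) v = 0.
Proof.
elim: m n => // m IH n nm; rewrite red_power_class_dp big1 // => -[[|i] lti] _ /=.
  by rewrite class_dp0 left_red_one.
rewrite IH ?(bil0r left_red_bilinear) //; lia.
Qed.

Definition red_bound u M := forall m, (M <= m)%N -> forall v, red_power m u v = 0.

Lemma red_bound_exists u : exists M, red_bound u M.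
Proof.
apply/asboolP; apply: (@Utau_ind (fun u => `[< exists M, red_bound u M >])) u.
  split=> [|a u v /asboolP [M Mu] /asboolP [N Nv]]; apply/asboolP.
    by exists 0%N => m _ v; rewrite (bil0l (red_power_bilinear m)).
  exists (maxn M N) => m; rewrite geq_max => /andP [Mm Nm] w.
  by rewrite (red_power_bilinear m).1 Mu // Nv // scaler0 addr0.
by move=> n x xc; apply/asboolP; exists n.+1 => m nm v; apply: red_power_eq0.
Qed.

(** The geometric series for the convolution inverse of u |-> (left multiplication by u).
    The bound is chosen for each u; by [Utau_ldivE] any larger one gives the same sum. *)
Definition Utau_ldiv (u v : Utau s) : Utau s :=
  \sum_(m < projT1 (cid (red_bound_exists u))) (-1) ^+ m *: red_power m u v.

Lemma Utau_ldivE u v M : red_bound u M ->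
  Utau_ldiv u v = \sum_(m < M) (-1) ^+ m *: red_power m u v.
Proof.
move=> bM; rewrite /Utau_ldiv; case: cid => N /= bN.
rewrite -(sum_widen (F := fun m => (-1) ^+ m *: red_power m u v) (leq_maxl M N)).
  rewrite (sum_widen (F := fun m => (-1) ^+ m *: red_power m u v) (leq_maxr M N)) //.
  by move=> i Ni; rewrite bN // scaler0.
by move=> i Mi; rewrite bM // scaler0.
Qed.

Lemma Utau_ldiv_bilinear : bilinear_map Utau_ldiv.
Proof.
split=> [v|u].
  move=> a u u'; have [M bM] := red_bound_exists u; have [N bN] := red_bound_exists u'.
  have b1 : red_bound u (maxn M N).
    by move=> m; rewrite geq_max => /andP [Mm _]; apply: bM.
  have b2 : red_bound u' (maxn M N).
    by move=> m; rewrite geq_max => /andP [_ Nm]; apply: bN.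
  have b3 : red_bound (a *: u + u') (maxn M N).
    by move=> m le w; rewrite (red_power_bilinear m).1 b1 // b2 // scaler0 addr0.
  rewrite (Utau_ldivE _ b1) (Utau_ldivE _ b2) (Utau_ldivE _ b3) scaler_sumr -big_split.
  apply: eq_bigr => m _ /=; rewrite (red_power_bilinear m).1; lmod k (Utau s).
apply: linear_sum_fun => m; exact: linear_comp (@linear_scale _ _ _) ((red_power_bilinear m).2 u).
Qed.

Lemma telescope_sign (F : nat -> Utau s) n : F n.+1 = 0 ->
  \sum_(m < n.+1) (-1) ^+ m *: (F m.+1 + F m) = F 0%N.
Proof.
move=> F0; suff H N : \sum_(m < N) (-1) ^+ m *: (F m.+1 + F m) = F 0%N - (-1) ^+ N *: F N.
  by rewrite H F0 scaler0 subr0.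
elim: N => [|N IH]; first by rewrite big_ord0 expr0 scale1r subrr.
rewrite big_ord_recr /= IH exprS; lmod k (Utau s).
Qed.

Lemma ldiv_axiom u v :
  \Sw_(a, b <- comul u) Utau_ldiv a (Utau_mul b v) = counit u *: v /\
  \Sw_(a, b <- comul u) Utau_mul a (Utau_ldiv b v) = counit u *: v.
Proof.
have b1 : bilinear_map (fun a b => Utau_ldiv a (Utau_mul b v)).
  split=> [b|a]; first exact: Utau_ldiv_bilinear.1.
  exact: linear_comp (Utau_ldiv_bilinear.2 _) (Utau_mul_bilinear.1 _).
have b2 : bilinear_map (fun a b => Utau_mul a (Utau_ldiv b v)).
  split=> [b|a]; first exact: Utau_mul_bilinear.1.
  exact: linear_comp (Utau_mul_bilinear.2 _) (Utau_ldiv_bilinear.1 _).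
have mulE a z : Utau_mul a z = left_red a z + counit a *: z by rewrite /left_red subrK.
have bd n i x : (i <= n)%N -> red_bound (class_dp i x) n.+1.
  by move=> le m lt w; apply: red_power_eq0; apply: leq_trans lt.
split; move: u; apply: Utau_linear_eq => [||n x xc];
  [exact: linear_comp (tens_lift_linear b1) comul_linear
  |exact: linear_scalel counit_linear|
  |exact: linear_comp (tens_lift_linear b2) comul_linear
  |exact: linear_scalel counit_linear|].
  rewrite (sw_class_dp n x b1) -[RHS]/(red_power 0 (class_dp n x) v).
  rewrite -(@telescope_sign (fun m => red_power m (class_dp n x) v) n) ?red_power_eq0 //.
  transitivity (\sum_(i < n.+1) \sum_(m < n.+1)
      (-1) ^+ m *: red_power m (class_dp i x) (Utau_mul (class_dp (n - i) x) v)).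
    by apply: eq_bigr => i _; rewrite (Utau_ldivE _ (bd n i x (leq_ord i))).
  rewrite exchange_big; apply: eq_bigr => m _; rewrite -scaler_sumr; congr (_ *: _).
  rewrite red_power_class_dp_r.
  rewrite -[in RHS](sum_counit_r (fun i => red_power m (class_dp i x) v)) -big_split.
  apply: eq_bigr => i _; rewrite mulE (bilDr (red_power_bilinear m)).
  by rewrite (bilZr (red_power_bilinear m)) counit_class_dp.
rewrite (sw_class_dp n x b2) -[RHS]/(red_power 0 (class_dp n x) v).
rewrite -(@telescope_sign (fun m => red_power m (class_dp n x) v) n) ?red_power_eq0 //.
transitivity (\sum_(i < n.+1) \sum_(m < n.+1)
    (-1) ^+ m *: Utau_mul (class_dp i x) (red_power m (class_dp (n - i) x) v)).
  apply: eq_bigr => i _; rewrite (Utau_ldivE _ (bd n _ x (leq_subr i n))).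
  rewrite (bil_sumr Utau_mul_bilinear); apply: eq_bigr => m _.
  by rewrite (bilZr Utau_mul_bilinear).
rewrite exchange_big; apply: eq_bigr => m _; rewrite -scaler_sumr; congr (_ *: _).
rewrite red_power_class_dp.
rewrite -[in RHS](sum_counit (fun i => red_power m (class_dp i x) v)) -big_split.
by apply: eq_bigr => i _; rewrite mulE counit_class_dp.
Qed.

Lemma Utau_hopf : hopf_axioms comul counit one Utau_mul Utau_ldiv Utau_rdiv.
Proof.
split; [exact: Utau_bialgebra|exact: Utau_ldiv_bilinear|exact: Utau_rdiv_bilinear| |].
  exact: ldiv_axiom.
exact: rdiv_axiom.
Qed.

Lemma dp_mul a b (x : g) : dp a x * dp b x = 'C(a + b, a)%:R *: dp (a + b) x.
Proof.
rewrite !dpE -env_scaleAr -env_scaleAl !scalerA -exprD; congr (_ *: _).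
have := congr1 (fun n => n%:R : k) (bin_fact (leq_addr b a)).
rewrite addKn !natrM => <-; have fb := fact_neq0 char0 b; have fa := fact_neq0 char0 a.
have Cn : 'C(a + b, a)%:R != 0 :> k.
  apply/negP => /eqP C0; have := congr1 (fun n => n%:R : k) (bin_fact (leq_addr b a)).
  by rewrite natrM C0 mul0r => /esym/eqP; apply/negP; apply: fact_neq0.
by field; rewrite fa fb.
Qed.

(** The product of e^(n x) and e^x, in degree m. *)
Lemma sum_dp_pow n m (x : g) :
  \sum_(i < m.+1) n%:R ^+ i *: (dp (m - i) x * dp i x) = n.+1%:R ^+ m *: dp m x.
Proof.
transitivity (\sum_(i < m.+1) (n%:R ^+ i *+ 'C(m, i)) *: dp m x).
  apply: eq_bigr => i _; rewrite dp_mul subnK ?leq_ord // scalerA bin_sub ?leq_ord //.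
  by rewrite mulr_natr.
by rewrite -scaler_suml -exprD1n -nat1r addrC.
Qed.

Lemma right_iter_mul_linear n x : linear (right_iter_mul comul counit Utau_mul n x).
Proof.
elim: n => [|n IH]; first exact: linear_scalel counit_linear.
apply: linear_comp (tens_lift_linear _) comul_linear.
exact: bilinear_pre Utau_mul_bilinear IH (@linear_id _ _).
Qed.

Lemma conv_power_linear n : linear (conv_power comul counit one Utau_mul n).
Proof.
elim: n => [|[|n] IH]; [exact: linear_scalel counit_linear|exact: linear_id|].
apply: linear_comp (tens_lift_linear _) comul_linear.
exact: bilinear_pre Utau_mul_bilinear IH (@linear_id _ _).
Qed.

Lemma counit_expr0 m (q : Utau s) : (m == 0%N)%:R *: q = 0%:R ^+ m *: q.
Proof. by case: m => [|m] //; rewrite exprS mul0r. Qed.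

Lemma right_iter_mul_class_dp n x m e : e \in c ->
  right_iter_mul comul counit Utau_mul n x (class_dp m e) = n%:R ^+ m *: Utau_act (dp m e) x.
Proof.
move=> ec; elim: n m => [|n IH] m.
  rewrite /= counit_class_dp -counit_expr0; case: m => [|m]; last by rewrite !scale0r.
  by rewrite dp0 Utau_act1.
have bb := bilinear_pre Utau_mul_bilinear (right_iter_mul_linear n x) (@linear_id _ _).
rewrite -[LHS]/(tens_lift _ _) (sw_class_dp m e bb).
rewrite -(linearZf _ (Utau_act_bilinear.1 x)) -sum_dp_pow (bil_suml Utau_act_bilinear).
apply: eq_bigr => i _; rewrite IH Utau_mul_class_dp // (linearZf _ (Utau_act_bilinear.2 _)).
by rewrite (linearZf _ (Utau_act_bilinear.1 x)) Utau_actM.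
Qed.

Lemma conv_power_class_dp n m e : e \in c ->
  conv_power comul counit one Utau_mul n (class_dp m e) = n%:R ^+ m *: class_dp m e.
Proof.
move=> ec; have lc := @Utau_class_linear k g s; elim: n m => [|[|n] IH] m.
- rewrite /= counit_class_dp -counit_expr0; case: m => [|m]; last by rewrite !scale0r.
  by rewrite class_dp0.
- by rewrite expr1n scale1r.
have bb := bilinear_pre Utau_mul_bilinear (conv_power_linear n.+1) (@linear_id _ _).
rewrite -[LHS]/(tens_lift _ _) (sw_class_dp m e bb).
rewrite -(linearZf _ lc) -sum_dp_pow (linear_sumf _ _ _ lc).
apply: eq_bigr => i _; rewrite IH Utau_mul_class_dp // (linearZf _ (Utau_act_bilinear.2 _)).
by rewrite (linearZf _ lc) Utau_actE.
Qed.

Lemma Utau_monoalternative : right_monoalternative comul counit one Utau_mul.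
Proof.
move=> n x; apply: Utau_linear_eq => [||m e ec].
- exact: right_iter_mul_linear.
- exact: linear_comp (Utau_mul_bilinear.2 _) (conv_power_linear n).
by rewrite right_iter_mul_class_dp // conv_power_class_dp // (bilZr Utau_mul_bilinear) Utau_mul_class_dp.
Qed.

End Product.
End UtauStructure.

(** * Right pseudospeciality *)

Section Pseudospecial.
Variables (k : fieldType) (g : lieAlgType k).
Hypothesis char0 : forall n, n.+1%:R != 0 :> k.
Variables (s c : {pred g}).
Hypotheses (sP : submod_closed s) (cP : submod_closed c).
Hypothesis sc : forall x, exists y z, [/\ y \in s, z \in c & x = y + z].
Variables (iota iotam : Utau s -> env g).
Hypotheses (iota_lin : linear iota) (iotam_lin : linear iotam).
Hypothesis iotaE : forall n x, x \in c -> iota (class_dp s n x) = dp n x.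
Hypothesis iotamE : forall n x, x \in c -> iotam (class_dp s n x) = dp n (- x).
Variables (zeta : g -> g) (kappa : env g -> env g).
Hypothesis kappa_lin : linear kappa.
Hypothesis kappaE : forall n d, d \in s -> kappa (dp n d) = dp n (d + 2 *: zeta d).
Hypothesis zeta_norm : {in s, forall d, lie_normalizer c (d + zeta d)}.
Hypothesis zeta_even : {in s & c, forall d e n, iter (2 * n) (lie e) (zeta d) \in c}.

Local Notation cl := (@Utau_class k g s).
Local Notation comul := (@Utau_comul k g s).
Local Notation counit := (@Utau_counit k g s).
Local Notation one := (Utau_one s).
Local Notation mul := (Utau_mul iota).
Local Notation rdiv := (Utau_rdiv iotam).
Let lc := @Utau_class_linear k g s.
Let mb := env_mul_bil g.
Let ab : bilinear_map (@Utau_act k g s) := @Utau_act_bilinear k g s.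

Lemma env_linear_eq_dp (W : lmodType k) (f h : env g -> W) : linear f -> linear h ->
  (forall m x n y, x \in c -> y \in s -> f (dp m x * dp n y) = h (dp m x * dp n y)) ->
  f =1 h.
Proof.
move=> lf lh e; apply: (env_linear_eq_pow2 char0 sP cP sc lf lh) => x m y n xc ys.
rewrite (power_dp char0 n) (power_dp char0 m) -env_scaleAr -env_scaleAl.
by rewrite !(linearZf _ lf) !(linearZf _ lh) e.
Qed.

Lemma env_comul_dp2 m x n y : env_comul (dp m x * dp n y)
  = \sum_(i < m.+1) \sum_(j < n.+1)
      (dp i x * dp j y) ⊗ (dp (m - i) x * dp (n - j) y) :> tensor (env g) (env g).
Proof.
have tb := @tens_env_mul_bilinear k g.
rewrite env_comulM !env_comul_dp // (bil_suml tb); apply: eq_bigr => i _.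
by rewrite (bil_sumr tb); apply: eq_bigr => j _; rewrite tens_env_mulE.
Qed.

Lemma sw_dp2 (W : lmodType k) (B : env g -> env g -> W) m x n y : bilinear_map B ->
  tens_lift B (env_comul (dp m x * dp n y))
  = \sum_(i < m.+1) \sum_(j < n.+1) B (dp i x * dp j y) (dp (m - i) x * dp (n - j) y).
Proof.
move=> BP; have lB := tens_lift_linear BP.
rewrite env_comul_dp2 (linear_sumf _ _ _ lB); apply: eq_bigr => i _.
by rewrite (linear_sumf _ _ _ lB); apply: eq_bigr => j _; rewrite tens_liftE.
Qed.

Lemma sw_dp (W : lmodType k) (B : env g -> env g -> W) n x : bilinear_map B ->
  tens_lift B (env_comul (dp n x)) = \sum_(i < n.+1) B (dp i x) (dp (n - i) x).
Proof.
move=> BP; rewrite env_comul_dp // (linear_sumf _ _ _ (tens_lift_linear BP)).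
by apply: eq_bigr => i _; rewrite tens_liftE.
Qed.

(** If w = e^q h with q in c and h in the formal group of s, then w = e^q modulo U(g)s, and
    this is e^(- q) w = h. *)
Definition stabilizer_part (w : env g) : env g :=
  \Sw_(a, b <- env_comul w) (iotam (cl b) * a).

Lemma stabilizer_part_bilinear : bilinear_map (fun a b : env g => iotam (cl b) * a).
Proof.
split=> [b|a]; first exact: mb.2.
exact: linear_comp (mb.1 _) (linear_comp iotam_lin lc).
Qed.

Lemma stabilizer_part_linear : linear stabilizer_part.
Proof. exact: linear_comp (tens_lift_linear stabilizer_part_bilinear) (@env_comul_linear k g). Qed.

Lemma stabilizer_partE m x n y : x \in c -> y \in s ->
  stabilizer_part (dp m x * dp n y) = (m == 0%N)%:R *: dp n y.
Proof.
move=> xc ys; rewrite /stabilizer_part (sw_dp2 _ _ _ _ stabilizer_part_bilinear).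
transitivity ((\sum_(i < m.+1) dp (m - i) (- x) * dp i x) * dp n y).
  rewrite mulr_suml; apply: eq_bigr => i _.
  rewrite big_ord_recr /= subnn dp0 mulr1 iotamE // mulrA big1 ?add0r // => j _.
  rewrite -[(n - j)%N]prednK ?subn_gt0 // Utau_class_dp_s //.
  by rewrite (linear0f iotam_lin) mul0r.
rewrite (reindex_inj rev_ord_inj) /=.
under eq_bigr => i _ do rewrite subSS (subKn (leq_ord i)).
rewrite dp_antipode //; case: m => [|m]; first by rewrite mul1r scale1r.
by rewrite mul0r scale0r.
Qed.

Lemma sw_stabilizer_part (W : lmodType k) (F : env g -> env g -> W) m x n y : bilinear_map F ->
  x \in c -> y \in s ->
  \Sw_(a, b <- env_comul (dp m x * dp n y)) F (stabilizer_part a) (stabilizer_part b)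
  = (m == 0%N)%:R *: \sum_(j < n.+1) F (dp j y) (dp (n - j) y).
Proof.
move=> FP xc ys; rewrite (sw_dp2 _ _ _ _ (bilinear_pre FP stabilizer_part_linear stabilizer_part_linear)).
rewrite -(sum_counit_r (fun i => (i == 0%N)%:R *: \sum_(j < n.+1) F (dp j y) (dp (n - j) y)) m).
apply: eq_bigr => i _; rewrite !scaler_sumr; apply: eq_bigr => j _.
by rewrite !stabilizer_partE // (bilZl FP) (bilZr FP) !scalerA mulrC.
Qed.

Lemma stabilizer_part_comul w : env_comul (stabilizer_part w) = tens_map stabilizer_part stabilizer_part (env_comul w).
Proof.
move: w; apply: env_linear_eq_dp => [||m x n y xc ys].
- exact: linear_comp (@env_comul_linear k g) stabilizer_part_linear.
- exact: linear_comp (tens_map_linear stabilizer_part_linear stabilizer_part_linear) (@env_comul_linear k g).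
rewrite [RHS](sw_stabilizer_part _ _ (tens_bilinear _ _)) // stabilizer_partE //.
by rewrite (linearZf _ (@env_comul_linear k g)) env_comul_dp.
Qed.

(** The products iota v * iota u depend on u and v through a morphism of coalgebras, so
    Sweedler sums over u and v become Sweedler sums over the product. *)
Lemma sw_prod (W : lmodType k) (F : env g -> env g -> W) u v : bilinear_map F ->
  \Sw_(u1, u2 <- comul u) \Sw_(v1, v2 <- comul v)
     F (iota v1 * iota u1) (iota v2 * iota u2)
  = \Sw_(a, b <- env_comul (iota v * iota u)) F a b.
Proof.
move=> FP; pose Q u1 u2 v1 v2 := F (iota v1 * iota u1) (iota v2 * iota u2).
have b1 u1 u2 : bilinear_map (Q u1 u2).
  apply: (bilinear_pre FP); exact: linear_comp (mb.1 _) iota_lin.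
have b2 v1 v2 : bilinear_map (fun u1 u2 => Q u1 u2 v1 v2).
  apply: (bilinear_pre FP); exact: linear_comp (mb.2 _) iota_lin.
have bn t : bilinear_map (fun u1 u2 => tens_lift (Q u1 u2) t) by apply: bilinear_nested.
have ll := linear_comp (tens_lift_linear FP) (@env_comul_linear k g).
move: u; apply: (Utau_linear_eq char0 sP cP sc) => [||m x xc].
- exact: linear_comp (tens_lift_linear (bn _)) (@comul_linear k g s).
- exact: linear_comp ll (linear_comp (mb.2 _) iota_lin).
rewrite -[LHS]/(tens_lift (fun u1 u2 => tens_lift (Q u1 u2) (comul v)) _).
rewrite (sw_class_dp char0 m x (bn _)).
move: v; apply: (Utau_linear_eq char0 sP cP sc) => [||n y yc].
- apply: linear_sum_fun => i.
  exact: linear_comp (tens_lift_linear (b1 _ _)) (@comul_linear k g s).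
- exact: linear_comp ll (linear_comp (mb.1 _) iota_lin).
rewrite !iotaE // (sw_dp2 _ _ _ _ FP) exchange_big; apply: eq_bigr => i _ /=.
rewrite (sw_class_dp char0 n y (b1 _ _)).
by apply: eq_bigr => j _; rewrite /Q !iotaE.
Qed.

(** r(e^a, e^b) x = e^(- q) e^b e^a x, where e^q is the class of e^b e^a. *)
Lemma hopf_rE u v x : hopf_r comul mul rdiv u v x = Utau_act (stabilizer_part (iota v * iota u)) x.
Proof.
have Fb : bilinear_map (fun a b : env g => Utau_act (iotam (cl b) * a) x : Utau s).
  exact: bilinear_post stabilizer_part_bilinear (ab.1 x).
rewrite /stabilizer_part (tens_lift_comp _ stabilizer_part_bilinear (ab.1 x)) -(sw_prod _ _ Fb).
apply: tens_lift_ext => u1 u2; apply: tens_lift_ext => v1 v2.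
rewrite /Utau_rdiv /Utau_mul !Utau_actM; congr (Utau_act (iotam _) _).
by rewrite -[in LHS](cl_iota char0 sP cP sc iota_lin iotaE u2) Utau_actE.
Qed.

(** If w = e^q e^d with q in c and d in s, then this is the class of e^(d + 2 zeta d). *)
Definition bullet0 (w : env g) : Utau s := cl (kappa (stabilizer_part w)).

Lemma bullet0_linear : linear bullet0.
Proof. exact: linear_comp lc (linear_comp kappa_lin stabilizer_part_linear). Qed.

Lemma bullet0E m x n y : x \in c -> y \in s ->
  bullet0 (dp m x * dp n y) = (m == 0%N)%:R *: class_dp s n (y + 2 *: zeta y).
Proof.
by move=> xc ys; rewrite /bullet0 stabilizer_partE // (linearZf _ kappa_lin) (linearZf _ lc) kappaE.
Qed.

Lemma bullet0_comul w : comul (bullet0 w) = tens_map bullet0 bullet0 (env_comul w).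
Proof.
have tb := tens_bilinear (Utau s) (Utau s); have l := linear_comp lc kappa_lin.
move: w; apply: env_linear_eq_dp => [||m x n y xc ys].
- exact: linear_comp (@comul_linear k g s) bullet0_linear.
- exact: linear_comp (tens_map_linear bullet0_linear bullet0_linear) (@env_comul_linear k g).
rewrite [RHS](sw_stabilizer_part _ _ (bilinear_pre tb l l)) // bullet0E //.
rewrite (linearZf _ (@comul_linear k g s)) comul_class_dp //; congr (_ *: _).
by apply: eq_bigr => j _; rewrite !kappaE.
Qed.

Lemma bullet0_counit w : counit (bullet0 w) = env_counit w.
Proof.
move: w; apply: (env_linear_eq_dp (W := k^o)) => [||m x n y xc ys].
- exact: (linear_comp (W := k^o) (@counit_linear k g s) bullet0_linear).
- exact: (@env_counit_linear k g).
have cz a q : counit (a *: q) = a * counit q.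
  exact: (linearZf (V := k^o) a (@counit_linear k g s) q).
by rewrite bullet0E // cz counit_class_dp // env_counitM !env_counit_dp.
Qed.

Definition bullet (t : tensor (Utau s) (Utau s)) : Utau s :=
  \Sw_(u, v <- t) bullet0 (iota v * iota u).

Lemma bullet_bilinear : bilinear_map (fun u v => bullet0 (iota v * iota u)).
Proof.
split=> [v|u]; apply: linear_comp bullet0_linear _.
  exact: linear_comp (mb.2 _) iota_lin.
exact: linear_comp (mb.1 _) iota_lin.
Qed.

Lemma bulletE u v : bullet (u ⊗ v) = bullet0 (iota v * iota u).
Proof. by rewrite /bullet tens_liftE //; apply: bullet_bilinear. Qed.

Lemma bullet_linear : linear bullet.
Proof. exact: tens_lift_linear bullet_bilinear. Qed.

Lemma bullet_morphism :
  coalgebra_morphism (tens_comul comul) (tens_counit counit) comul counit bullet.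
Proof.
have tb := tens_bilinear (Utau s) (Utau s).
have tb2 := tens_bilinear (tensor (Utau s) (Utau s)) (tensor (Utau s) (Utau s)).
have cL := @comul_linear k g s.
pose Q (u1 u2 v1 v2 : Utau s) := (u1 ⊗ v1) ⊗ (u2 ⊗ v2).
have b1 u1 u2 : bilinear_map (Q u1 u2) by apply: (bilinear_pre tb2); apply: tb.2.
have b2 v1 v2 : bilinear_map (fun u1 u2 => Q u1 u2 v1 v2).
  by apply: (bilinear_pre tb2); apply: tb.1.
have bn t : bilinear_map (fun u1 u2 => tens_lift (Q u1 u2) t) by apply: bilinear_nested.
have bb : bilinear_map (fun u v =>
    \Sw_(u1, u2 <- comul u) \Sw_(v1, v2 <- comul v) ((u1 ⊗ v1) ⊗ (u2 ⊗ v2))).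
  split=> [v|u]; first exact: linear_comp (tens_lift_linear (bn _)) cL.
  apply: tens_lift_linearB => u1 u2; exact: linear_comp (tens_lift_linear (b1 _ _)) cL.
have bullet2 := tens_map_linear bullet_linear bullet_linear.
split; first exact: bullet_linear.
- apply: tens_linear_eq => [||u v].
  + exact: linear_comp cL bullet_linear.
  + exact: linear_comp bullet2 (tens_lift_linear bb).
  rewrite bulletE bullet0_comul /tens_comul (tens_liftE bb).
  rewrite (tens_lift_comp _ (bn _) bullet2).
  apply: etrans (esym (sw_prod u v (bilinear_pre tb bullet0_linear bullet0_linear))) _.
  apply: tens_lift_ext => u1 u2; rewrite (tens_lift_comp _ (b1 _ _) bullet2).
  by apply: tens_lift_ext => v1 v2; rewrite tens_mapE ?bulletE //; apply: bullet_linear.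
have eL := @counit_linear k g s.
have eb : bilinear_map (fun u v : Utau s => counit u * counit v : k^o).
  split=> [v|u] a x y; rewrite eL.
    by rewrite mulrDl -mulrA.
  by rewrite mulrDr mulrCA.
apply: (tens_linear_eq (W := k^o)) => [||u v].
- exact: (linear_comp (W := k^o) eL bullet_linear).
- exact: tens_lift_linear eb.
rewrite bulletE bullet0_counit env_counitM !(iota_counit char0 sP cP sc iota_lin iotaE).
by rewrite /tens_counit (tens_liftE eb) mulrC.
Qed.

Lemma bullet0_iota u : bullet0 (iota u) = counit u *: one.
Proof.
move: u; apply: (Utau_linear_eq char0 sP cP sc) => [||n x xc].
- exact: linear_comp bullet0_linear iota_lin.
- exact: linear_scalel (@counit_linear k g s).
rewrite iotaE // -[dp n x]mulr1 -[1](dp0 0) bullet0E ?subspace0 // class_dp0.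
by rewrite counit_class_dp.
Qed.

Lemma bullet_one u : bullet (one ⊗ u) = counit u *: one /\ bullet (u ⊗ one) = counit u *: one.
Proof.
by rewrite !bulletE (iota_one cP iotaE) mulr1 mul1r !bullet0_iota.
Qed.

(** The map P of pseudospeciality, as a function of h = e^d in the formal group of s. *)
Definition pseudo_act (h : env g) (x : Utau s) : Utau s :=
  \Sw_(a, b <- env_comul h) Utau_act (iota (cl (kappa b)) * a) x.

Lemma pseudo_act_bil (x : Utau s) : bilinear_map (fun a b => Utau_act (iota (cl (kappa b)) * a) x).
Proof.
split=> [b|a]; first exact: linear_comp (ab.1 x) (mb.2 _).
apply: linear_comp (ab.1 x) _; apply: linear_comp (mb.1 _) _.
exact: linear_comp iota_lin (linear_comp lc kappa_lin).
Qed.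

Lemma pseudo_act_linear x : linear (pseudo_act^~ x).
Proof. exact: linear_comp (tens_lift_linear (pseudo_act_bil x)) (@env_comul_linear k g). Qed.

Lemma pseudo_linear2 h : linear (pseudo_act h).
Proof. by apply: tens_lift_linearB => a b; apply: ab.2. Qed.

Lemma hopf_PE u v x :
  hopf_P comul mul rdiv bullet u v x = pseudo_act (stabilizer_part (iota v * iota u)) x.
Proof.
have pb := bilinear_pre (pseudo_act_bil x) stabilizer_part_linear stabilizer_part_linear.
rewrite /pseudo_act stabilizer_part_comul (tens_lift_map _ stabilizer_part_linear stabilizer_part_linear (pseudo_act_bil x)).
apply: etrans _ (sw_prod u v pb).
apply: tens_lift_ext => u1 u2; apply: tens_lift_ext => v1 v2.
by rewrite hopf_rE bulletE /Utau_mul Utau_actM.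
Qed.

Section Twisted.
Variable d : g.
Hypothesis sd : d \in s.
Let D := d + 2 *: zeta d.
Let tw := twist d (zeta d).
Let tw_mem := twist_mem char0 cP (zeta_norm sd)
  (fun e ec n => zeta_even sd ec n).

(** e^D Y and e^D Y e^(- d) have the same class, and the second one is symmetric. *)
Lemma iota_twist n Y : Y \in sym_space c -> iota (cl (dp n D * Y)) = tw n Y.
Proof.
move=> YS; rewrite -[RHS](iota_sym char0 iota_lin iotaE (tw_mem n YS)); congr (iota _).
rewrite /tw /twist (linear_sumf _ _ _ lc) big_ord_recr /= subnn dp0 mulr1.
rewrite big1 ?add0r // => i _; rewrite -[(n - i)%N]prednK ?subn_gt0 //.
by rewrite Utau_class_dp_s //; apply: subspaceN.
Qed.

Lemma twist_dp n Y : \sum_(j < n.+1) tw j Y * dp (n - j) d = dp n D * Y.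
Proof.
transitivity (\sum_(j < n.+1) \sum_(i < j.+1)
    dp i D * Y * dp (j - i) (- d) * dp (n - j) d).
  by apply: eq_bigr => j _; rewrite /tw /twist mulr_suml.
rewrite (sum_assoc (fun a b e => dp a D * Y * dp b (- d) * dp e d)).
rewrite -(sum_counit_r (fun i => dp i D * Y)); apply: eq_bigr => i _.
transitivity (dp i D * Y * \sum_(j < (n - i).+1) dp j (- d) * dp (n - i - j) d).
  by rewrite mulr_sumr; apply: eq_bigr => j _; rewrite mulrA.
rewrite dp_antipode //; case: (_ == _); first by rewrite mulr1 scale1r.
by rewrite mulr0 scale0r.
Qed.

(** P acts as iota (class of e^D) e^d = (e^D e^(- d)) e^d = e^D. *)
Lemma pseudo_act_dp n y : pseudo_act (dp n d) y = Utau_act (dp n D) y.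
Proof.
rewrite /pseudo_act (sw_dp _ _ (pseudo_act_bil y)) (reindex_inj rev_ord_inj) /=.
rewrite -[dp n D]mulr1 -twist_dp (bil_suml ab); apply: eq_bigr => j _.
rewrite subSS (subKn (leq_ord j)) kappaE // -[dp j _]mulr1 iota_twist //.
by apply: mem_span; exists 0, 0%N; rewrite expr0; split=> //; apply: subspace0.
Qed.

Lemma pseudo_act_mul_dp n x l e : e \in c ->
  pseudo_act (dp n d) (mul x (class_dp s l e))
  = \sum_(j < n.+1) mul (Utau_act (dp j d) x) (pseudo_act (dp (n - j) d) (class_dp s l e)).
Proof.
move=> ec; rewrite pseudo_act_dp /Utau_mul iotaE // -Utau_actM -twist_dp (bil_suml ab).
rewrite (reindex_inj rev_ord_inj) /=; apply: eq_bigr => j _.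
have e1 : Utau_act (dp (n - j) D) (class_dp s l e) = cl (dp (n - j) D * dp l e) by exact: Utau_actE.
rewrite subSS (subKn (leq_ord j)) pseudo_act_dp e1 Utau_actM iota_twist //.
by rewrite dpE; apply: (subspaceZ (span_closed _)); apply: mem_span; exists e, l.
Qed.
End Twisted.

Lemma pseudo_act_mul w x y : pseudo_act (stabilizer_part w) (mul x y)
  = \Sw_(a, b <- env_comul w) mul (Utau_act (stabilizer_part a) x) (pseudo_act (stabilizer_part b) y).
Proof.
have mbi := Utau_mul_bilinear iota_lin.
have Fb z : bilinear_map (fun a b => mul (Utau_act a x) (pseudo_act b z)).
  exact: (bilinear_pre mbi (ab.1 x) (pseudo_act_linear z)).
have bf z := bilinear_pre (Fb z) stabilizer_part_linear stabilizer_part_linear.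
move: w; apply: env_linear_eq_dp => [||m e n d ec ds].
- exact: linear_comp (pseudo_act_linear _) stabilizer_part_linear.
- exact: linear_comp (tens_lift_linear (bf y)) (@env_comul_linear k g).
rewrite (sw_stabilizer_part _ _ (Fb y)) // stabilizer_partE // (linearZf _ (pseudo_act_linear _)).
congr (_ *: _); move: y; apply: (Utau_linear_eq char0 sP cP sc) => [||l e' ec'].
- exact: linear_comp (pseudo_linear2 _) (mbi.2 x).
- apply: linear_sum_fun => j; exact: linear_comp (mbi.2 _) (pseudo_linear2 _).
exact: pseudo_act_mul_dp.
Qed.

Lemma Utau_pseudospecial : right_pseudospecial comul counit one mul rdiv.
Proof.
exists bullet; split; [exact: bullet_morphism|exact: bullet_one|].
move=> u v x y; have mbi := Utau_mul_bilinear iota_lin.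
have Fb := bilinear_pre (bilinear_pre mbi (ab.1 x) (pseudo_act_linear y)) stabilizer_part_linear stabilizer_part_linear.
rewrite hopf_PE pseudo_act_mul; apply: etrans (esym (sw_prod u v Fb)) _.
apply: tens_lift_ext => u1 u2; apply: tens_lift_ext => v1 v2.
by rewrite hopf_rE hopf_PE.
Qed.
End Pseudospecial.

(** * Linear selections of linear relations *)

Section LinearSelection.
Import classical_sets.
Variables (k : fieldType) (V W : lmodType k) (R : V -> W -> Prop).

Definition linear_graph (A : V * W -> Prop) : Prop :=
  [/\ A (0, 0), (forall a p q, A p -> A q -> A (a *: p.1 + q.1, a *: p.2 + q.2)),
      (forall p, A p -> R p.1 p.2) & (forall z, A (0, z) -> z = 0)].

Hypothesis R0 : R 0 0.
Hypothesis R_lin : forall a x y z t, R x y -> R z t -> R (a *: x + z) (a *: y + t).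

(** A linear graph that has no point over d can be extended by the line through (d, z). *)
Lemma linear_graph_extend A d z : linear_graph A -> R d z ->
  (forall y, ~ A (d, y)) ->
  linear_graph (fun p => exists a q, A q /\ p = (a *: d + q.1, a *: z + q.2)).
Proof.
move=> [A0 AL AR AF] Rdz dA; split.
- by exists 0, (0, 0); split=> //=; rewrite !scale0r !addr0.
- move=> a _ _ [b [p [Ap ->]]] [b' [q [Aq ->]]]; exists (a * b + b').
  exists (a *: p.1 + q.1, a *: p.2 + q.2); split; first exact: AL.
  by congr pair => /=; [lmod k V | lmod k W].
- by move=> _ [a [q [Aq ->]]] /=; apply: R_lin => //; apply: AR.
move=> y [a [q [Aq [e ->]]]]; have [a0|a0] := eqVneq a 0.
  move: e; rewrite a0 !scale0r !add0r => e; apply: AF; rewrite e.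
  by case: (q) Aq.
case: (dA (- a^-1 *: q.2)).
have := AL (- a^-1) q (0, 0) Aq A0; rewrite /= !addr0.
suff -> : - a^-1 *: q.1 = d by [].
have -> : q.1 = - (a *: d) by apply/eqP; rewrite -addr_eq0 addrC -e.
by rewrite scaleNr scalerN opprK scalerA mulVf // scale1r.
Qed.

(** Zorn's lemma for the linear graphs contained in R: a maximal one has a point over each
    d in s. *)
Lemma linear_selection (s : {pred V}) : submod_closed s ->
  {in s, forall d, exists z, R d z} ->
  exists f : V -> W, {in s, forall d, R d (f d)} /\
    forall a, {in s &, forall x y, f (a *: x + y) = a *: f x + f y}.
Proof.
move=> sP sR; pose ext (A : set (V * W)) : set (V * W) := fun p => A p \/ p = (0, 0).
pose P : set (set (V * W)) := fun A => linear_graph (ext A).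
have [|A [PA Amax]] := @Zorn_bigcup _ P.
  move=> F FP Ftot.
  have two p q : ext (\bigcup_(X in F) X)%classic p -> ext (\bigcup_(X in F) X)%classic q ->
      exists A, [/\ linear_graph A, A p, A q &
        forall r, A r -> ext (\bigcup_(X in F) X)%classic r].
    have up X : F X -> forall r, ext X r -> ext (\bigcup_(X in F) X)%classic r.
      by move=> FX r [Xr|->]; [left; exists X | right].
    case=> [[X FX Xp]|->] [[Y FY Yq]|->].
    - case: (Ftot X Y FX FY) => sXY.
        exists (ext Y); split; [exact: FP|by left; apply: sXY|by left|exact: up].
      exists (ext X); split; [exact: FP|by left|by left; apply: sXY|exact: up].
    - exists (ext X); split; [exact: FP|by left|by right|exact: up].
    - exists (ext Y); split; [exact: FP|by right|by left|exact: up].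
    exists (fun p => p = (0, 0)); split=> //; last by move=> r ->; right.
    split=> // [a _ _ -> ->|_ ->|z [->]] //=; by rewrite !scaler0 !addr0.
  split; first by right.
  - by move=> a p q Up Uq; have [B [[_ BL _ _] Bp Bq BU]] := two p q Up Uq; apply/BU/BL.
  - by move=> p Up; have [B [[_ _ BR _] Bp _ _]] := two p p Up Up; apply: BR.
  - by move=> z Uz; have [B [[_ _ _ BF] Bz _ _]] := two _ _ Uz Uz; apply: BF.
have dom d : d \in s -> exists y, ext A (d, y).
  move=> sd; apply: contrapT => nd; have [z Rdz] := sR d sd.
  have nA y : ~ ext A (d, y) by move=> Ay; apply: nd; exists y.
  pose B : set (V * W) := fun p =>
    exists a q, ext A q /\ p = (a *: d + q.1, a *: z + q.2).
  have gB : linear_graph B := linear_graph_extend PA Rdz nA.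
  refine (Amax B _ _).
    split=> [p Ap|/(_ (d, z)) BA].
      by exists 0, p; split; [left|rewrite !scale0r !add0r; case: (p)].
    apply: (nA z); left; apply: BA; exists 1, (0, 0).
    by case: PA => *; rewrite !scale1r !addr0.
  suff -> : P B = linear_graph B by [].
  congr linear_graph; apply: funext => p; apply: propext; split; last by left.
  by case=> [//|->]; case: gB.
have [|f fA] := @choice _ _ (fun d y => d \in s -> ext A (d, y)).
  move=> d; case: (boolP (d \in s)) => [/dom [y Ay]|_]; last by exists 0.
  by exists y.
have [A0 AL AR AF] := PA; exists f; split=> [d /fA /AR //|a x y sx sy].
have sxy : a *: x + y \in s by apply: sP.2.
have H1 := AL a _ _ (fA x sx) (fA y sy).
have H2 := AL (-1) _ _ H1 (fA _ sxy); move: H2 => /=.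
have -> : -1 *: (a *: x + y) + (a *: x + y) = 0 by lmod k V.
move/AF/eqP; rewrite addrC scaleN1r subr_eq0 => /eqP -> //.
Qed.
End LinearSelection.

(** * Pseudoreductive triples *)

Section PseudoreductiveTriple.
Variables (k : fieldType) (g : lieAlgType k) (s c : {pred g}).

Lemma triple_projection : lie_triple s c ->
  exists pc : g -> g,
    [/\ linear pc, (forall x, pc x \in c) & (forall x, x - pc x \in s)].
Proof.
case=> sP _ cP sc sc0.
have [|pc pcP] := @choice _ _ (fun x y => y \in c /\ x - y \in s).
  by move=> x; have [d [e [ds ec ->]]] := sc x; exists e; rewrite addrK.
exists pc; split=> [a x y|x|x]; try by case: (pcP x).
apply/eqP; rewrite -subr_eq0; apply/eqP; apply: sc0; last first.
  by apply: (subspaceB cP); [case: (pcP (a *: x + y))|apply: cP.2; [case: (pcP x)|case: (pcP y)]].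
apply: (@mem_eqr _ _ (a *: (x - pc x) + (y - pc y) - (a *: x + y - pc (a *: x + y)))).
  by apply: (subspaceB sP); [apply: sP.2; [case: (pcP x)|case: (pcP y)]|case: (pcP (a *: x + y))].
lmod k g.
Qed.

(** The conditions on zeta d are linear in the pair (d, zeta d). *)
Lemma linear_zeta : pseudoreductive_triple s c ->
  exists zeta : g -> g,
    [/\ {in s, forall d, zeta d \in c},
        {in s, forall d, lie_normalizer c (d + zeta d)},
        {in s & c, forall d e n, iter (2 * n) (lie e) (zeta d) \in c}
      & forall a, {in s &, forall x y, zeta (a *: x + y) = a *: zeta x + zeta y}].
Proof.
case=> -[sP _ cP _ _] [zeta [z1 z2 z3]]; have lieP := @lie_bilinear k g.
pose R d z := [/\ z \in c, lie_normalizer c (d + z)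
  & {in c, forall e n, iter (2 * n) (lie e) z \in c}].
have it n (e : g) : linear (iter n (lie e) : g -> g).
  by elim: n => [|n IH] a x y //=; rewrite IH; apply: lieP.2.
have [|a x y z t [yc yn ye] [tc tn te]||f [fR fL]] := @linear_selection k g g R _ _ s sP _.
- split; first exact: subspace0.
    by move=> y _; rewrite addr0 (bil0l lieP) subspace0.
  by move=> e _ n; rewrite (linear0f (it _ _)) subspace0.
- split; first exact: cP.2.
    move=> w wc; apply: (@mem_eqr _ _ (a *: lie (x + y) w + lie (z + t) w)).
      by apply: cP.2; [apply: yn|apply: tn].
    by rewrite -lieP.1; congr (lie _ w); lmod k g.
  by move=> e ec n; rewrite it; apply: cP.2; [apply: ye|apply: te].
- move=> d sd; exists (zeta d); split; [exact: z1|exact: z2|].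
  by move=> e ec n; apply: z3.
exists f; split=> [d /fR [] //|d /fR [] //|d e /fR [_ _ H] ec n|//].
exact: H.
Qed.
End PseudoreductiveTriple.

Theorem theorem5p7 (k : fieldType) (k_char0 : [pchar k] =i pred0)
    (g : lieAlgType k) (s c : {pred g}) :
  pseudoreductive_triple s c ->
  exists mul : Utau s -> Utau s -> Utau s,
    unique (Utau_product c) mul /\
    pseudoreductive_hopf (@Utau_comul k g s) (@Utau_counit k g s)
      (Utau_one s) mul.
Proof.
move=> tauP; have [tP _] := tauP; have [sP sL cP sc sc0] := tP.
have char0 n : n.+1%:R != 0 :> k by have /pcharf0P -> := k_char0.
have [zeta [z1 z2 z3 zL]] := linear_zeta tauP.
have [pc [pc_lin pc_c pc_s]] := triple_projection tP.
have lc := @Utau_class_linear k g s.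
have glin := @env_gen_linear k g.
have descend (kap : env g -> env g) : linear kap ->
    (forall u d, d \in s -> kap (u * env_gen d) = 0) ->
    exists io : Utau s -> env g, linear io /\ forall u, io (Utau_class s u) = kap u.
  move=> lk k0; have k0' u : left_ideal_rel s u -> kap u = 0.
    by move=> [v [d [sd ->]]]; apply: k0.
  exists (fun q => kap (repr q)); split; first exact: quot_lift_linear.
  exact: quot_lift.
have ext := symmetric_extension char0 sP sL cP pc_lin pc_c pc_s sc0.
have [kp [kpl /(descend _ kpl) [iota [iota_lin iotaE']] kpc]] := ext _ glin.
have gNlin : linear (fun x : g => env_gen (- x)).
  by move=> a x y; rewrite opprD -scalerN glin.
have [km [kml /(descend _ kml) [iotam [iotam_lin iotamE']] kmc]] := ext _ gNlin.
have iotaE n x : x \in c -> iota (class_dp s n x) = dp n x.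
  by move=> xc; rewrite iotaE' dpE (linearZf _ kpl) kpc.
have iotamE n x : x \in c -> iotam (class_dp s n x) = dp n (- x).
  by move=> xc; rewrite iotamE' !dpE (linearZf _ kml) kmc.
pose A x := x - pc x + 2 *: zeta (x - pc x).
have Alin : linear A.
  move=> a x y; rewrite /A pc_lin.
  have -> : a *: x + y - (a *: pc x + pc y) = a *: (x - pc x) + (y - pc y) by lmod k g.
  by rewrite zL //; lmod k g.
(* the triple (g, 0, g), whose coordinate function is the logarithm of G *)
have [kappa [kappa_lin _ kappac]] : exists kap : env g -> env g,
    [/\ linear kap,
        (forall u d, d \in pred1 (0 : g) -> kap (u * env_gen d) = 0)
      & (forall x n, x \in predT -> kap (env_gen x ^+ n) = env_gen (A x) ^+ n)].
  apply: (@symmetric_extension k g char0 (pred1 0) predT id) => //.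
  - by split=> [|a u v]; rewrite !inE // => /eqP -> /eqP ->; rewrite scaler0 addr0.
  - by move=> x y; rewrite !inE => /eqP -> /eqP ->; rewrite (bil0l (@lie_bilinear k g)).
  - by move=> x; rewrite inE subrr.
  - by move=> x; rewrite inE => /eqP.
  - exact: linear_comp glin Alin.
have kappaE n d : d \in s -> kappa (dp n d) = dp n (d + 2 *: zeta d).
  move=> sd; rewrite !dpE (linearZf _ kappa_lin) kappac // /A.
  by rewrite (pc0s sP pc_c pc_s sc0 sd) subr0.
have mulP : Utau_product c (Utau_mul iota).
  split=> [|u n x xc]; first exact: Utau_mul_bilinear.
  rewrite -(linear_sumf _ _ _ lc) /Utau_mul (iota_sym char0 iota_lin iotaE); last first.
    exact: sym_product_mem.
  rewrite Utau_actE mulr_suml (linear_sumf _ _ _ lc).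
  rewrite (reindex_inj (mulgI (perm (@rev_ord_inj n)))) /=.
  apply: eq_bigr => sg _; congr (Utau_class _ (_ * _)).
  by apply: eq_bigr => i _; rewrite permM permE.
exists (Utau_mul iota); split.
  split=> // mul' mul'P; apply: funext => u; apply: funext.
  apply: (Utau_linear_eq char0 sP cP sc); [exact: mulP.1.2|exact: mul'P.1.2|].
  move=> n x xc.
  (* one factor n! counts permutations, the other one comes from the divided power *)
  have F0 : (n`! ^ 2)%:R != 0 :> k by rewrite natrX expf_neq0 // fact_neq0.
  have e : class_dp s n x = ((n`! ^ 2)%:R)^-1 *: \sum_(sg : 'S_n)
      Utau_class s (\prod_(i < n) env_gen ((fun _ : 'I_n => x) (sg i))).
    under eq_bigr do rewrite prodr_const card_ord (power_dp char0) (linearZf _ lc).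
    rewrite sumr_const card_Sn -scaler_nat !scalerA -mulrA -natrM mulVf ?scale1r //.
  rewrite e !(linearZf _ (mulP.1.2 u)) !(linearZf _ (mul'P.1.2 u)); congr (_ *: _).
  rewrite -[u]clsK [LHS](mulP.2 _ n (fun=> x)) //.
  by rewrite [RHS](mul'P.2 _ n (fun=> x)).
exists (Utau_ldiv char0 sP cP sc iota_lin iotaE), (Utau_rdiv iotam); split.
- exact: Utau_hopf.
- exact: (Utau_pseudospecial char0 sP cP sc iota_lin iotam_lin iotaE iotamE
           kappa_lin kappaE).
- exact: (Utau_monoalternative char0 sP cP sc iota_lin iotaE).
Qed.
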